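(* For every integer $n\ge 3$, $\mathcal D_n^{\mathrm U}=\mathcal C_n^{\mathrm U}$. That is, a distribution $G$ on $\mathbb R$ with finite mean is the distribution of $X_1+\dots+X_n$ for some random variables $X_1,\dots,X_n$ each uniformly distributed on $[0,1]$ (with arbitrary dependence) if and only if $G$ is smaller than $\mathrm U[0,n]$ in convex order.
   Context: $\mathrm U[x,y]$ denotes the uniform distribution on $[x,y]$. $\mathcal D_n^{\mathrm U}$ is the set of all cumulative distribution functions of $X_1+\dots+X_n$, where $X_1,\dots,X_n$ are random variables on a common atomless probability space, each with distribution $\mathrm U[0,1]$, with arbitrary joint distribution. For distributions $F,G$ on $\mathbb R$ with finite mean, $G\prec_{\mathrm{cx}}F$ ($G$ is smaller than $F$ in convex order) means $\int\phi\,dG\le\int\phi\,dF$ for all convex $\phi:\mathbb R\to\mathbb R$ for which both integrals exist (finite or infinite). $\mathcal C_n^{\mathrm U}$ is the set of all distributions $G$ on $\mathbb R$ with finite mean such that $G\prec_{\mathrm{cx}}\mathrm U[0,n]$. *)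

(* Defs.v *)
From HB Require Import structures.
From mathcomp Require Import all_boot all_order all_algebra.
From mathcomp Require Import all_classical all_reals all_analysis measurable_realfun.

Set Implicit Arguments.
Unset Strict Implicit.
Unset Printing Implicit Defensive.

Import Order.TTheory GRing.Theory Num.Theory.
Import numFieldNormedType.Exports.

Local Open Scope classical_set_scope.
Local Open Scope ring_scope.

Definition atomless (R : realType) (d : measure_display) (T : measurableType d)
    (P : probability T R) : Prop :=
  forall A : set T, measurable A -> (0 < P A)%E ->
    exists B : set T, [/\ measurable B, B `<=` A & (0 < P B < P A)%E].

Definition finite_mean (R : realType)
    (G : probability (measurableTypeR R) R) : Prop :=
  G.-integrable [set: R] (fun x : R => x%:E).

(* The integral of f is the difference of the integrals of its positive and
   negative parts; it exists in the extended reals unless both are infinite.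
   This has to be required explicitly, since \int is total, with +oo - +oo
   evaluating to -oo. *)
Definition integral_exists (R : realType)
    (F : probability (measurableTypeR R) R) (f : R -> R) : Prop :=
  ((\int[F]_x ((EFin \o f)^\+ x) < +oo) \/
   (\int[F]_x ((EFin \o f)^\- x) < +oo))%E.

Definition convex_le (R : realType)
    (G F : probability (measurableTypeR R) R) : Prop :=
  forall phi : R -> R,
    convex_function ([set: R^o]) phi ->
    integral_exists G phi -> integral_exists F phi ->
    (\int[G]_x (phi x)%:E <= \int[F]_x (phi x)%:E)%E.

Lemma natr_gt0 (R : realType) (n : nat) : (0 < n)%N -> (0 : R) < n%:R.
Proof. by rewrite ltr0n. Qed.

(* A distribution on the real line is identified with its cumulative
   distribution function r |-> G `]-oo, r]. *)
Definition uniform_sums (R : realType) (d : measure_display)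
    (T : measurableType d) (P : probability T R) (n : nat) :
    set (probability (measurableTypeR R) R) :=
  [set G : probability (measurableTypeR R) R |
   exists X : 'I_n -> {RV P >-> R},
     (forall (i : 'I_n) (A : set R), measurable A ->
        distribution P (X i) A = uniform_prob (@ltr01 R) A) /\
     (forall r : R,
        cdf (P := P) (\sum_(i < n) X i) r = G `]-oo, r]%classic)].

Definition uniform_cx (R : realType) (n : nat) (n_gt0 : (0 < n)%N) :
    set (probability (measurableTypeR R) R) :=
  [set G : probability (measurableTypeR R) R |
     finite_mean G /\ convex_le G (uniform_prob (natr_gt0 R n_gt0))].

(* Main.v *)
Require Import Defs.
From HB Require Import structures.
From mathcomp Require Import all_boot all_order all_algebra perm.
From mathcomp Require Import all_classical all_reals all_analysis measurable_realfun.
From mathcomp Require Import ring lra.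
Set Implicit Arguments.
Unset Strict Implicit.
Unset Printing Implicit Defensive.
Import Order.TTheory GRing.Theory Num.Theory.
Import numFieldNormedType.Exports.
Local Open Scope classical_set_scope.
Local Open Scope ring_scope.

                                    

(** Necessity is Jensen's inequality: $\phi(\sum X_i)=\phi(\frac1n\sum
    nX_i)\le\frac1n\sum\phi(nX_i)$, and each $nX_i$ is uniform on $[0,n]$
    ([convex_le_of_uniform_sums]).

    Sufficiency is a duality argument. From the convex order one extracts bounds on the
    $G$-integrals of $(y-x)^+$ for $0\le y\le n$, of $x^+$ and of $(x-n)^+$. Concentrating $G$ on
    finitely many atoms $ns_k$ of mass $p_k$, cell by cell, preserves them ([discretize]). One then
    wants a law for pairs $(k,x)$ with $x\in[0,1]^n$ and $\sum_i x_i=ns_k$ in which $k$ has law $p$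
    and every $x_i$ looks uniform when tested on finitely many hinges $(x_i-t)^+$.
    Finite-dimensional separation ([approx_of_separation]) and symmetrization over the coordinates
    ([sum_shifts]) reduce its approximate existence to one inequality, [dual_bound]: if
    $n\psi_k\le\sum_j\phi(x_j)$ for all $x\in[0,1]^n$ with sum $ns_k$, then $\sum_k
    p_k\psi_k\le\int_0^1\phi$.

    The dual inequality is proved by induction on the number of atoms. Given three atoms, mass is
    exchanged between the middle one and the outer two, keeping total mass and mean, until an atom
    disappears or a stop-loss constraint becomes tight; in the latter case the interval and the
    atoms split into two smaller problems ([cxblock_split]). What remains is one or two atoms. One
    atom is the statement that $n\ge3$ uniform variables can have constant sum; more generally
    uniform laws on windows, each shorter than half the total length, admit such a coupling
    ([polygon_mean]). For two atoms, such windows yield parabolic lower bounds on the primitive of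
    $\phi$ from either end of $[0,1]$ ([tangent_parabola]), and averaging them over a cut point with
    prescribed first two moments cancels the unknown coefficients ([two_point_law], [two_atoms]).

    The approximate laws are only finitely additive states. Their ultrafilter limit prescribes the
    masses of all dyadic cubes; the atomless space carries a tree of events with these masses
    ([code_tree]), and the limits of the dyadic left ends along the tree are the desired variables
    ([realize_limit]). *)

Section primitive.
Context {R : realType}.
Implicit Types (f P : R -> R) (a b c x t : R).

(** * Constant-sum couplings of uniform laws on windows, in dual form *)

Lemma le_of_derive_ge0 P f : (forall t, is_derive t 1 P (f t)) ->
  (forall t, 0 <= t <= 1 -> 0 <= f t) -> P 0 <= P 1.
Proof.
move=> dP f0.
have cP : {within `[0, 1], continuous P}.
  apply: continuous_subspaceT => x; apply: differentiable_continuous.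
  by apply/derivable1_diffP; have [] := dP x.
have [c c01 E] := MVT_segment ler01 (fun x _ => dP x) cP.
rewrite -subr_ge0 E subr0 mulr1 f0//.
Qed.

Lemma is_derive_affine P f a b t : (forall x, is_derive x 1 P (f x)) ->
  is_derive t 1 (fun t => P (a + b * t)) (f (a + b * t) * b).
Proof.
move=> dP.
have dg : is_derive t 1 (fun t : R => a + b * t) b.
  have := is_deriveD (is_derive_cst a t 1) (is_deriveZ b (is_derive_id t 1)).
  by move/is_derive_eq; apply; rewrite add0r /GRing.scale/= mulr1.
exact: (@is_derive1_comp _ P _ t _ _ (dP _) dg).
Qed.

Lemma is_derive_bigsum I (r : seq I) (Q : pred I) (F dF : I -> R -> R) t :
  (forall i, is_derive t 1 (F i) (dF i t)) ->
  is_derive t 1 (fun t => \sum_(i <- r | Q i) F i t) (\sum_(i <- r | Q i) dF i t).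
Proof.
move=> dFi; elim: r => [|i r IH].
  rewrite big_nil; have -> : (fun t => \sum_(i <- [::] | Q i) F i t) = cst 0.
    by apply/funext => x; rewrite big_nil.
  exact: is_derive_cst.
rewrite big_cons; case: ifP => Qi; last first.
  by under eq_fun do rewrite big_cons Qi.
under eq_fun do rewrite big_cons Qi.
exact: (is_deriveD (dFi i) IH).
Qed.

Lemma is_derive_scale c P d t : is_derive t 1 P d ->
  is_derive t 1 (fun t => c * P t) (c * d).
Proof. move=> dP; exact: (is_deriveZ c dP). Qed.

Lemma is_derive_add P1 P2 t d1 d2 : is_derive t 1 P1 d1 ->
  is_derive t 1 P2 d2 -> is_derive t 1 (fun t => P1 t + P2 t) (d1 + d2).
Proof. exact: is_deriveD. Qed.

                                                                            
                                                                     
                                                                               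
                                                    
(** Integrates the hypothesis along the segment from $(0,g_1+g_3,g_2)$ to $(g_2+g_3,g_1,0)$, on
    which the coordinate sum is constant. The weight [g2 * g3] is the one for which three cyclic
    copies add up to uniform marginals. *)
Lemma triangle_path P1 P2 P3 f1 f2 f3 g1 g2 g3 c :
  (forall x, is_derive x 1 P1 (f1 x)) ->
  (forall x, is_derive x 1 P2 (f2 x)) ->
  (forall x, is_derive x 1 P3 (f3 x)) ->
  0 <= g1 -> 0 <= g2 -> 0 <= g3 -> 0 < g2 + g3 ->
  (forall x1 x2 x3, 0 <= x1 <= g2 + g3 -> 0 <= x2 <= g1 + g3 ->
     0 <= x3 <= g1 + g2 -> x1 + x2 + x3 = g1 + g2 + g3 ->
     c <= f1 x1 + f2 x2 + f3 x3) ->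
  g2 * g3 * c <= g2 * g3 * ((P1 (g2 + g3) - P1 0) / (g2 + g3))
    + g2 * (P2 (g1 + g3) - P2 g1) + g3 * (P3 g2 - P3 0).
Proof.
move=> d1 d2 d3 g10 g20 g30 L0 H.
pose k := g2 * g3 / (g2 + g3).
(* The claim is [h 0 <= h 1]; the derivative of [h] is $g_2g_3(f_1+f_2+f_3-c)$ along the segment. *)
pose h t := k * P1 (0 + (g2 + g3) * t) +
   ((- g2) * P2 (g1 + g3 + (- g3) * t) +
   ((- g3) * P3 (g2 + (- g2) * t) + (- (g2 * g3 * c)) * (0 + 1 * t))).
pose dh t := k * (f1 (0 + (g2 + g3) * t) * (g2 + g3)) +
   ((- g2) * (f2 (g1 + g3 + (- g3) * t) * (- g3)) +
   ((- g3) * (f3 (g2 + (- g2) * t) * (- g2)) + (- (g2 * g3 * c)) * (1 * 1))).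
have : h 0 <= h 1.
  apply: (@le_of_derive_ge0 _ dh).
    move=> t; rewrite /h /dh.
    apply: is_derive_add.
      exact: (is_derive_scale _ (is_derive_affine _ _ _ d1)).
    apply: is_derive_add.
      exact: (is_derive_scale _ (is_derive_affine _ _ _ d2)).
    apply: is_derive_add.
      exact: (is_derive_scale _ (is_derive_affine _ _ _ d3)).
    apply: is_derive_scale.
    exact: (@is_derive_affine id (cst 1) 0 1 t (fun x => is_derive_id x 1)).
  move=> t /andP[t0 t1]; rewrite /dh.
  have {}H := H (0 + (g2 + g3) * t) (g1 + g3 + (- g3) * t) (g2 + (- g2) * t).
  have H' : c <= f1 (0 + (g2 + g3) * t) + f2 (g1 + g3 + (- g3) * t)
     + f3 (g2 + (- g2) * t) by apply: H; [nra|nra|nra|ring].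
  have -> : k * (f1 (0 + (g2 + g3) * t) * (g2 + g3)) =
     g2 * g3 * f1 (0 + (g2 + g3) * t) by rewrite /k; field; rewrite gt_eqF.
  have := ler_wpM2l (mulr_ge0 g20 g30) H'; lra.
rewrite /h !mulr0 !addr0 !mulr1 !add0r.
have -> : g1 + g3 + - g3 = g1 by ring.
rewrite subrr.
have -> : g2 * g3 * ((P1 (g2 + g3) - P1 0) / (g2 + g3)) =
  k * P1 (g2 + g3) - k * P1 0 by rewrite /k; ring.
lra.
Qed.

(** The three cyclic segments of [triangle_path] bound a triangle in the plane of constant sum. Give
    them the weights $g_2g_3$, $g_3g_1$, $g_1g_2$. The first segment sweeps $[0,l_1]$ in the first
    coordinate, while the second and third sweep $[0,g_3]$ and $[g_3,l_1]$ with the same density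
    $g_1$; so the first marginal is uniform, and likewise the other two. *)
Lemma triangle_mean P1 P2 P3 f1 f2 f3 l1 l2 l3 c :
  (forall x, is_derive x 1 P1 (f1 x)) ->
  (forall x, is_derive x 1 P2 (f2 x)) ->
  (forall x, is_derive x 1 P3 (f3 x)) ->
  0 < l1 -> 0 < l2 -> 0 < l3 ->
  l1 <= l2 + l3 -> l2 < l1 + l3 -> l3 <= l1 + l2 ->
  (forall x1 x2 x3, 0 <= x1 <= l1 -> 0 <= x2 <= l2 ->
     0 <= x3 <= l3 -> x1 + x2 + x3 = (l1 + l2 + l3) / 2 ->
     c <= f1 x1 + f2 x2 + f3 x3) ->
  c <= (P1 l1 - P1 0) / l1 + (P2 l2 - P2 0) / l2 + (P3 l3 - P3 0) / l3.
Proof.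
move=> d1 d2 d3 l10 l20 l30 h1 h2 h3 H.
(* Ravi substitution: the side lengths are the pairwise sums of the [g]'s, and the triangle
   inequalities become sign conditions. *)
pose g1 := (l2 + l3 - l1) / 2.
pose g2 := (l1 + l3 - l2) / 2.
pose g3 := (l1 + l2 - l3) / 2.
have e1 : g2 + g3 = l1 by rewrite /g2 /g3; lra.
have e1' : g3 + g2 = l1 by rewrite /g2 /g3; lra.
have e2 : g1 + g3 = l2 by rewrite /g1 /g3; lra.
have e2' : g3 + g1 = l2 by rewrite /g1 /g3; lra.
have e3 : g1 + g2 = l3 by rewrite /g1 /g2; lra.
have e3' : g2 + g1 = l3 by rewrite /g1 /g2; lra.
have eg : g1 + g2 + g3 = (l1 + l2 + l3) / 2 by rewrite /g1 /g2 /g3; lra.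
have eg' : g2 + g3 + g1 = (l1 + l2 + l3) / 2 by rewrite /g1 /g2 /g3; lra.
have eg'' : g3 + g1 + g2 = (l1 + l2 + l3) / 2 by rewrite /g1 /g2 /g3; lra.
have g10 : 0 <= g1 by rewrite /g1; lra.
have g20 : 0 < g2 by rewrite /g2; lra.
have g30 : 0 <= g3 by rewrite /g3; lra.
have := @triangle_path P1 P2 P3 f1 f2 f3 g1 g2 g3 c d1 d2 d3 g10 (ltW g20) g30.
rewrite eg e1 e2 e3 => /(_ l10 H) A1.
have := @triangle_path P2 P3 P1 f2 f3 f1 g2 g3 g1 c d2 d3 d1 (ltW g20) g30 g10.
rewrite eg' e2' e3' e1.
move=> /(_ l20) A2; have {}A2 := A2 (ltac:(
  move=> x1 x2 x3 a1 a2 a3 s;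
  move: (H x3 x1 x2 a3 a1 a2); rewrite -s => /(_ ltac:(ring)); lra)).
have := @triangle_path P3 P1 P2 f3 f1 f2 g3 g1 g2 c d3 d1 d2 g30 g10 (ltW g20).
rewrite eg'' e3 e1' e2'.
move=> /(_ l30) A3; have {}A3 := A3 (ltac:(
  move=> x1 x2 x3 a1 a2 a3 s;
  move: (H x2 x3 x1 a2 a3 a1); rewrite -s => /(_ ltac:(ring)); lra)).
pose D1 := (P1 l1 - P1 0) / l1.
pose D2 := (P2 l2 - P2 0) / l2.
pose D3 := (P3 l3 - P3 0) / l3.
have E1 : P1 l1 - P1 0 = D1 * (g2 + g3) by rewrite e1 /D1 divfK ?gt_eqF.
have E2 : P2 l2 - P2 0 = D2 * (g1 + g3) by rewrite e2 /D2 divfK ?gt_eqF.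
have E3 : P3 l3 - P3 0 = D3 * (g1 + g2) by rewrite e3 /D3 divfK ?gt_eqF.
rewrite -/D1 -/D2 -/D3 in A1 A2 A3 *.
have K : 0 < g2 * g3 + g3 * g1 + g1 * g2.
  by have : 0 < g1 + g3; [rewrite e2|move=> ?; nra].
rewrite -(ler_pM2l K).
have : (g2 * g3 + g3 * g1 + g1 * g2) * (D1 + D2 + D3) =
  g2 * g3 * D1 + g3 * g1 * D2 + g1 * g2 * D3 +
  g1 * (P1 l1 - P1 0) + g2 * (P2 l2 - P2 0) + g3 * (P3 l3 - P3 0).
  by rewrite E1 E2 E3; ring.
lra.
Qed.
End primitive.

Section polygon.
Context {R : realType}.
Implicit Types (f P phi Phi : R -> R).

                                                                              
                                                                 
(** Dual form of joint mixability of uniform laws. Consecutive windows are gathered in three groups,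
    each driven by a single parameter; the group lengths obey the triangle inequalities, so
    [triangle_mean] applies. *)
Lemma polygon_mean n (a l : 'I_n -> R) (phi Phi : R -> R) (c : R) :
  (forall x : R, is_derive x 1 Phi (phi x)) ->
  (forall i, 0 < l i) -> (forall i, l i < (\sum_i l i) / 2) -> (0 < n)%N ->
  (forall x : 'I_n -> R, (forall i, a i <= x i <= a i + l i) ->
     \sum_i x i = \sum_i a i + (\sum_i l i) / 2 -> c <= \sum_i phi (x i)) ->
  c <= \sum_i (Phi (a i + l i) - Phi (a i)) / l i.
Proof.
move=> dPhi l0 lT n0 H.
set T := \sum_i l i in lT H.
pose S k := \sum_(i < n | (i < k)%N) l i.
have T0 : 0 < T.
  rewrite /T (bigD1 (Ordinal n0))//= ltr_pwDl//.
  by apply: sumr_ge0 => i _; exact: ltW.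
have Sn : T / 2 < S n.
  rewrite (_ : S n = T); first by rewrite ltr_pdivrMr// ltr_pMr// ltr1n.
  by apply: eq_bigl => i; rewrite ltn_ord.
have exk : exists k, T / 2 < S k by exists n.
(* The middle group is the single window at which the partial sums of lengths first exceed [T / 2];
   the groups on either side then have length at most [T / 2]. *)
have [k Sk kmin] := ex_minnP exk.
have k0 : (0 < k)%N.
  case: k Sk {kmin} => //; rewrite /S big_pred0// => /lt_geF.
  by rewrite divr_ge0// ltW.
have kn : (k <= n)%N by exact: kmin.
have jn : (k.-1 < n)%N by rewrite prednK.
pose j := Ordinal jn.
have Sj : S k.-1 <= T / 2.
  rewrite leNgt; apply/negP => /kmin; by rewrite -{1}(prednK k0) ltnn.
pose p1 := [pred i : 'I_n | (i < j)%N].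
pose p3 := [pred i : 'I_n | (j < i)%N].
have split3 (F : 'I_n -> R) :
    \sum_i F i = \sum_(i | p1 i) F i + F j + \sum_(i | p3 i) F i.
  rewrite (bigD1 j)//= (bigID p1)/= addrA [F j + _]addrC; congr (_ + _ + _).
    by apply: eq_bigl => i; rewrite andbC -(inj_eq val_inj)/=; case: (ltngtP i k.-1).
  by apply: eq_bigl => i; rewrite -(inj_eq val_inj)/=; case: (ltngtP i k.-1).
pose L1 := \sum_(i | p1 i) l i.
pose L3 := \sum_(i | p3 i) l i.
have ET : T = L1 + l j + L3 by rewrite /T split3.
have ESj : S k.-1 = L1 by [].
have ESk : S k = L1 + l j.
  rewrite /S (bigD1 j)/= ?prednK// addrC; congr (_ + _).
  apply: eq_bigl => i; rewrite -(inj_eq val_inj)/= -{1}(prednK k0) ltnS.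
  by case: (ltngtP i k.-1).
have lj := lT j.
have L30 : 0 < L3 by rewrite ESk in Sk; rewrite ESj in Sj; lra.
have L10 : 0 < L1 by rewrite ESk in Sk; lra.
(* As the parameter of a group of length [L] runs over $[0,L]$, window [i] is swept at speed
   [l i / L]; the mean over the parameter is therefore the sum of the window means. *)
have mean_sum (p : pred 'I_n) L : L != 0 ->
    \sum_(i | p i) (Phi (a i + l i) - Phi (a i)) / l i =
    (\sum_(i | p i) L / l i * Phi (a i + l i / L * L) -
     \sum_(i | p i) L / l i * Phi (a i + l i / L * 0)) / L.
  move=> L0; rewrite -sumrB mulr_suml; apply: eq_bigr => i _.
  rewrite divfK// mulr0 addr0; field.
  by rewrite L0 (gt_eqF (l0 i)).
have dgrp (p : pred 'I_n) (L x : R) : L != 0 ->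
    is_derive x 1 (fun x => \sum_(i | p i) L / l i * Phi (a i + l i / L * x))
      (\sum_(i | p i) phi (a i + l i / L * x)).
  move=> L0.
  rewrite [X in is_derive _ _ _ X](_ : _ =
    \sum_(i | p i) L / l i * (phi (a i + l i / L * x) * (l i / L))).
    pose G := fun (i : 'I_n) x => L / l i * Phi (a i + l i / L * x).
    pose G' := fun (i : 'I_n) x => L / l i * (phi (a i + l i / L * x) * (l i / L)).
    apply: (@is_derive_bigsum R 'I_n _ p G G') => i.
    exact: (is_derive_scale _ (is_derive_affine _ _ _ dPhi)).
  apply: eq_bigr => i _; field.
  by rewrite L0 (gt_eqF (l0 i)).
have in_win (i : 'I_n) L x : 0 < L -> 0 <= x <= L -> a i <= a i + l i / L * x <= a i + l i.
  move=> L0 /andP[x0 xL]; have li := l0 i; have xL1 : x / L <= 1.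
    by rewrite ler_pdivrMr// mul1r.
  have xL0 : 0 <= x / L by rewrite divr_ge0// ltW.
  rewrite [l i / L * x]mulrAC -[l i * x / L]mulrA; apply/andP; split; nra.
pose e2 := a j.
rewrite (split3 (fun i => (Phi (a i + l i) - Phi (a i)) / l i)).
rewrite (mean_sum p1 L1) ?gt_eqF// (mean_sum p3 L3) ?gt_eqF//.
have d2 (x : R) : is_derive x 1 (fun x => Phi (a j + 1 * x)) (phi (a j + x)).
  by have := is_derive_affine (a j) 1 x dPhi; rewrite mulr1 mul1r.
rewrite (_ : Phi (a j + l j) - Phi (a j) =
   Phi (a j + 1 * l j) - Phi (a j + 1 * 0)); last by rewrite mul1r mulr0 addr0.
have := @triangle_mean R _ (fun x => Phi (a j + 1 * x)) _ _
  (fun x => phi (a j + x)) _ L1 (l j) L3 c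
  (fun x => dgrp p1 L1 x (lt0r_neq0 L10)) d2
  (fun x => dgrp p3 L3 x (lt0r_neq0 L30)) L10 (l0 j) L30.
apply => //.
- by rewrite ESj in Sj; lra.
- lra.
- by rewrite ESk in Sk; lra.
move=> x1 x2 x3 b1 b2 b3 sx.
pose x i := if p1 i then a i + l i / L1 * x1 else
            if p3 i then a i + l i / L3 * x3 else a j + x2.
have xp1 i : p1 i -> x i = a i + l i / L1 * x1 by rewrite /x => ->.
have xp3 i : p3 i -> x i = a i + l i / L3 * x3.
  by rewrite /x/=; case: (ltngtP i k.-1).
have xj : x j = a j + x2 by rewrite /x/= ltnn.
have -> : \sum_(i | p1 i) phi (a i + l i / L1 * x1) + phi (a j + x2) +
   \sum_(i | p3 i) phi (a i + l i / L3 * x3) = \sum_i phi (x i).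
  rewrite split3 xj; congr (_ + _ + _); apply: eq_bigr => i pi.
    by rewrite xp1.
  by rewrite xp3.
apply: H.
- move=> i; rewrite /x; case: ifPn => [_|np1]; first exact: in_win.
  case: ifPn => [_|np3]; first exact: in_win.
  have -> : i = j.
    by apply/val_inj => /=; move: np1 np3 => /=; case: (ltngtP i k.-1).
  by move: b2 => /andP[? ?]; apply/andP; split; lra.
- rewrite split3 (split3 a) xj.
  rewrite (eq_bigr (fun i => a i + l i / L1 * x1) xp1).
  rewrite (eq_bigr (fun i => a i + l i / L3 * x3) xp3).
  rewrite !big_split/= -!mulr_suml -/L1 -/L3 !divff ?gt_eqF// !mul1r ET -sx.
  ring.
Qed.
End polygon.

                                     

(** * The dual inequality for one and two atoms *)

Section tangent.
Context {R : realType}.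
Implicit Types (phi Phi : R -> R).

Lemma sum_if_ltn (n r : nat) (a b : R) : (r <= n)%N ->
  \sum_(i < n) (if (i < r)%N then a else b) = r%:R * a + (n%:R - r%:R) * b.
Proof.
move=> /subnKC <-; rewrite big_split_ord/= natrD [_ + _ - _]addrC addKr.
rewrite (eq_bigr (fun=> a)) => [|i _]; last by rewrite ltn_ord.
rewrite [in X in _ + X](eq_bigr (fun=> b)) => [|i _]; last first.
  by rewrite ltnNge leq_addr.
by rewrite !sumr_const !card_ord -[a *+ r]mulr_natl -[b *+ _]mulr_natl.
Qed.

                                                                             
                                                 
(** Windows ending at [k] or at [l] have nonpositive mean of [phi], because [Phi] is minimal there
    among all earlier points of the interval. Choosing how many end at [l], and the lengths, so that
    the midpoints sum to $nm$ and the polygon condition holds, [polygon_mean] bounds the sum of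
    these means below by [c > 0]. *)
Lemma window_contra n (m : R) phi Phi (c k l : R) : (3 <= n)%N -> 0 < c ->
  (forall x : R, is_derive x 1 Phi (phi x)) ->
  0 < k < 2 * m -> 2 * m < l <= 5 / 2 * m -> l <= 1 ->
  (forall x : R, 0 <= x <= k -> Phi k <= Phi x) ->
  (forall x : R, 0 <= x <= l -> Phi l <= Phi x) ->
  (forall x : 'I_n -> R, (forall i, 0 <= x i <= 1) ->
     \sum_i x i = n%:R * m -> c <= \sum_i phi (x i)) -> False.
Proof.
move=> n3 c0 dPhi /andP[k0 km] /andP[ml l5] l1 mink minl H.
have n3R : 3 <= n%:R :> R by rewrite ler_nat.
have n0 : 0 < n%:R :> R by lra.
have kl : k < l by lra.
(* [r] counts the windows ending at [l]: it is the least number for which the right ends sum to more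
   than $nm$. *)
have exr : exists r, n%:R * (m - k) < r%:R * (l - k).
  by exists n; rewrite ltr_pM2l//; lra.
have [r Hr rmin] := ex_minnP exr.
have rn : (r <= n)%N by apply: rmin; rewrite ltr_pM2l//; lra.
have rnR : r%:R <= n%:R :> R by rewrite ler_nat.
have Hr1 : (0 < r)%N -> (r%:R - 1) * (l - k) <= n%:R * (m - k).
  move=> r0; rewrite leNgt; apply/negP => h.
  have := rmin r.-1; rewrite -subn1 natrB// => /(_ h).
  by rewrite subn1 leqNgt prednK// leqnn.
(* The total length is forced: half of it is the excess of the right ends over $nm$. *)
pose T := 2 * (r%:R * l + (n%:R - r%:R) * k) - 2 * (n%:R * m).
have T0 : 0 < T by rewrite /T; lra.
suff [lk [ll [lk0 lkk [ll0 lll] [lkT llT ET]]]] : exists lk ll : R,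
    [/\ 0 < lk, lk <= k, 0 < ll /\ ll <= l & [/\ lk < T / 2, (0 < r)%N -> ll < T / 2 &
       r%:R * ll + (n%:R - r%:R) * lk = T]].
  pose e (i : 'I_n) := if (i < r)%N then l else k.
  pose w (i : 'I_n) := if (i < r)%N then ll else lk.
  have sw : \sum_i w i = T by rewrite sum_if_ltn.
  have se : \sum_i e i = r%:R * l + (n%:R - r%:R) * k by rewrite sum_if_ltn.
  have w0 i : 0 < w i by rewrite /w; case: ifP.
  have := @polygon_mean R n (fun i => e i - w i) w phi Phi c dPhi w0.
  rewrite sw => /(_ _ (leq_trans (isT : 0 < 3)%N n3)) P.
  have : c <= \sum_i (Phi (e i - w i + w i) - Phi (e i - w i)) / w i.
    apply: P => [i|x xw sx].
      by rewrite /w; case: ifP => // ir; apply: llT; apply: leq_ltn_trans ir.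
    apply: H => [i|].
      have := xw i; rewrite /e /w; case: ifP => _ /andP[]; lra.
    by rewrite sx sumrB sw se /T; lra.
  rewrite leNgt => /negP; apply; apply: le_lt_trans c0.
  apply: sumr_le0 => i _; rewrite subrK pmulr_lle0 ?invr_gt0// subr_le0.
  by rewrite /e /w; case: ifP => _; [apply: minl|apply: mink]; lra.
(* Equal lengths fit if $T\le nk$. Otherwise the windows ending at [k] start at $0$ and those ending
   at [l] share the remaining length. *)
have [Tk|Tk] := leP T (n%:R * k).
  exists (T / n%:R), (T / n%:R).
  have Tn0 : 0 < T / n%:R by rewrite divr_gt0.
  have Tnk : T / n%:R <= k by rewrite ler_pdivrMr// mulrC.
  have TnT : T / n%:R < T / 2 by rewrite ltr_pM2l// ltf_pV2 ?posrE//; lra.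
  split => //; first by lra.
  by split => //; rewrite -mulrDl addrC subrK mulrC divfK// gt_eqF.
have r0 : (0 < r)%N.
  by rewrite lt0n; apply/eqP => r0; move: Tk; rewrite /T r0; nra.
have r0R : 0 < r%:R :> R by rewrite ltr0n.
have {}Hr1 := Hr1 r0.
pose ll := (T - (n%:R - r%:R) * k) / r%:R.
have ell : r%:R * ll = T - (n%:R - r%:R) * k by rewrite mulrC divfK// gt_eqF.
have kll : k < ll by rewrite -(ltr_pM2l r0R) ell; lra.
have r1R : 1 <= r%:R :> R by rewrite ler1n.
exists k, ll; split => //; first by split; [lra|rewrite -(ler_pM2l r0R) ell /T; nra].
split; [nra| |lra] => _.
(* For a single window ending at [l] the polygon condition reads $l<nm$, which holds since
   $l\le\frac52m$ and $n\ge3$. *)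
have [r1|r2] := leqP r 1.
  have er : r%:R = 1 :> R by apply: le_anti; rewrite r1R lern1 r1.
  move: ell; rewrite er mul1r => ->.
  by rewrite /T er; nra.
have r2R : 2 <= r%:R :> R by rewrite ler_nat.
rewrite -(ltr_pM2l r0R) ell.
have [rn'|rn'] := ltP (r%:R : R) n%:R; nra.
Qed.

Lemma lipschitz_of_derive phi Phi : continuous phi ->
  (forall x : R, is_derive x 1 Phi (phi x)) ->
  exists2 C : R, 0 < C & forall x y : R, 0 <= x <= 1 -> 0 <= y <= 1 -> x <= y ->
    `|Phi y - Phi x| <= C * (y - x).
Proof.
move=> cphi dPhi.
have cn : {within `[(0:R), 1], continuous (fun x => `|phi x|)}.
  apply: continuous_subspaceT => x.
  exact: (continuous_comp (cphi x) (@norm_continuous _ _ _)).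
have [c c01 Hc] := EVT_max ler01 cn.
exists (`|phi c| + 1); first by rewrite ltr_wpDl.
move=> x y /andP[x0 x1] /andP[y0 y1] xy.
have cP : {within `[x, y], continuous Phi}.
  apply: continuous_subspaceT => z; apply: differentiable_continuous.
  by apply/derivable1_diffP; have [] := dPhi z.
have [z zxy ->] := MVT_segment xy (fun x _ => dPhi x) cP.
rewrite normrM (@ger0_norm _ (y - x)) ?subr_ge0// ler_wpM2r ?subr_ge0//.
rewrite (le_trans (Hc z _)) ?lerDl//.
by move: zxy; rewrite !in_itv/= => /andP[xz zy]; apply/andP; split; lra.
Qed.

Lemma continuous_of_derive phi Phi : (forall x : R, is_derive x 1 Phi (phi x)) ->
  continuous Phi.
Proof.
move=> dPhi z; apply: differentiable_continuous.
by apply/derivable1_diffP; have [] := dPhi z.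
Qed.

(** Subtracting $\lambda(x-m)$ from [phi] leaves its sum over points of mean $m$ unchanged, so [Phi]
    may be corrected by any multiple of $q(x)=x^2/2-mx$, which is nonpositive on $[0,2m]$ and
    positive beyond. If no multiple worked, some corrected primitive would drop below its value at
    $0$ both before and after $2m$, contradicting [window_contra]. The factor $5/2$ is below $3$, as
    [window_contra] needs, and large enough for [two_point_law]. *)
Lemma tangent_parabola n (m : R) phi Phi (c : R) : (3 <= n)%N -> 0 < c -> 0 < m < 1 / 2 ->
  continuous phi -> (forall x : R, is_derive x 1 Phi (phi x)) ->
  (forall x : 'I_n -> R, (forall i, 0 <= x i <= 1) ->
     \sum_i x i = n%:R * m -> c <= \sum_i phi (x i)) ->
  exists lam : R, forall x : R, 0 <= x <= 1 -> x <= 5 / 2 * m ->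
    lam * (x ^+ 2 / 2 - m * x) <= Phi x - Phi 0.
Proof.
move=> n3 c0 /andP[m0 m1] cphi dPhi H.
have n3R : 3 <= n%:R :> R by rewrite ler_nat.
have n0 : 0 < n%:R :> R by lra.
have [C C0 lip] := lipschitz_of_derive cphi dPhi.
pose D (x : R) := Phi x - Phi 0.
pose q (x : R) := x ^+ 2 / 2 - m * x.
have q0 (x : R) : 0 <= x <= 2 * m -> q x <= 0 by move=> /andP[? ?]; rewrite /q; nra.
have D2m : 0 <= D (2 * m).
  have := @polygon_mean R n (fun=> 0) (fun=> 2 * m) phi Phi c dPhi.
  rewrite !sumr_const card_ord mul0rn -[_ *+ n]mulr_natl.
  move=> /(_ _ _ (leq_trans (isT : 0 < 3)%N n3)) P.
  have : c <= ((Phi (0 + 2 * m) - Phi 0) / (2 * m)) *+ n.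
    apply: P => [_|_|x xw sx]; [lra|nra|].
    by apply: H => [i|]; [have /andP[] := xw i; lra|rewrite sx; lra].
  rewrite add0r -mulr_natl => h.
  have : 0 < n%:R * ((Phi (2 * m) - Phi 0) / (2 * m)) by exact: lt_le_trans c0 h.
  rewrite pmulr_rgt0// pmulr_lgt0 ?invr_gt0 ?mulr_gt0 ?ltr0n//.
  by move/ltW.
pose good (lam : R) := forall x : R, 0 <= x <= 1 -> x <= 5 / 2 * m -> lam * q x <= D x.
apply: contrapT => nolam.
have bad lam : ~ good lam by move=> g; apply: nolam; exists lam.
(* [L] is upward closed, as $q\le0$ on $[0,2m]$; the critical coefficient is its infimum. The
   Lipschitz bound on [Phi] gives a lower bound of [L] through [right_ok] (any member below $-C/m$
   would be good) and a member through [left_ok]. *)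
pose L := [set lam : R | forall x : R, 0 <= x <= 2 * m -> lam * q x <= D x].
have right_ok x : 2 * m <= x -> x <= 1 -> (- (C / m)) * q x <= D x.
  move=> mx x1; have := @lip (2 * m) x; rewrite ler_norml.
  move=> /(_ ltac:(lra) ltac:(lra) mx) /andP[h _].
  have -> : - (C / m) * q x = - (C / m) * (x * (x - 2 * m) / 2) by rewrite /q; field; rewrite gt_eqF.
  have : C * (x - 2 * m) <= (C / m) * (x * (x - 2 * m) / 2).
    rewrite (_ : (C / m) * (x * (x - 2 * m) / 2) = C * (x - 2 * m) * (x / (2 * m))).
      apply: ler_peMr; first by nra.
      by rewrite ler_pdivlMr ?mul1r; lra.
    by field; rewrite gt_eqF.
  by rewrite /D in D2m *; lra.
have left_ok x : 0 <= x <= 2 * m -> (2 * C / m) * q x <= D x.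
  move=> /andP[x0 xm].
  have := @lip x (2 * m); rewrite ler_norml.
  move=> /(_ ltac:(lra) ltac:(lra) xm) /andP[_ h2].
  have := @lip 0 x; rewrite ler_norml.
  move=> /(_ ltac:(lra) ltac:(lra) x0) /andP[h1 _].
  have -> : 2 * C / m * q x = - (C * x * (2 * m - x) / m) by rewrite /q; field; rewrite gt_eqF.
  have K1 : - (C * x) <= D x by rewrite /D; lra.
  have K2 : - (C * (2 * m - x)) <= D x by rewrite /D in D2m *; lra.
  have [xm'|xm'] := leP x m.
    apply: le_trans K1; rewrite lerN2 ler_pdivlMr//.
    by apply: ler_wpM2l; [exact: mulr_ge0 (ltW C0) x0|lra].
  apply: le_trans K2; rewrite lerN2 ler_pdivlMr// mulrAC.
  apply: ler_wpM2r; first by lra.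
  by rewrite ler_pM2l// ltW.
have L0 : L !=set0 by exists (2 * C / m).
have Llb : lbound L (- (C / m)).
  move=> lam Llam; rewrite leNgt; apply/negP => h; apply: (bad lam) => x x01 xm.
  have [/andP[x0 x1]] := x01.
  have [x2|x2] := leP x (2 * m); first by apply: Llam; lra.
  apply: le_trans (right_ok x (ltW x2) x1).
  by rewrite ler_wpM2r ?ltW// /q; nra.
have hiL : has_inf L by split => //; exists (- (C / m)).
pose ls := inf L.
have lsL : L ls.
  move=> x x2; have := q0 _ x2; rewrite le_eqVlt => /orP[/eqP qx|qx].
    by have := left_ok _ x2; rewrite qx !mulr0.
  rewrite -ler_ndivrMr//; apply: lb_le_inf => // lam Llam.
  by rewrite ler_ndivrMr//; exact: Llam.
have [l l01 [lm lD]] : exists2 l, 0 <= l <= 1 & l <= 5 / 2 * m /\ D l < ls * q l.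
  apply: contrapT => h; apply: (bad ls) => x x01 xm.
  by rewrite leNgt; apply/negP => ?; apply: h; exists x.
have ml : 2 * m < l.
  rewrite ltNge; apply/negP => h.
  have : ls * q l <= D l by apply: lsL; lra.
  by rewrite leNgt lD.
(* Half the violation at [l]. Lowering the coefficient by [eta] keeps a violation at [l], because
   [q l <= 1], and creates one at some [k] in $[0,2m]$, because [lam] is below the infimum of
   [L]. *)
pose eta := (ls * q l - D l) / 2.
have eta0 : 0 < eta by rewrite /eta; lra.
pose lam := ls - eta.
have [k km kD] : exists2 k, 0 <= k <= 2 * m & D k < lam * q k.
  apply: contrapT => h.
  have : L lam.
    move=> x xm; rewrite leNgt; apply/negP => ?; apply: h; exists x => //.
  by move/(inf_lbound hiL.2); rewrite -/ls /lam; lra.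
pose Phi' x := Phi x + ((- (lam / 2)) * (x * x) + lam * m * x).
pose phi' x := phi x + ((- (lam / 2)) * (x * 1 + x * 1) + lam * m * 1).
have dPhi' (x : R) : is_derive x 1 Phi' (phi' x).
  apply: is_derive_add => //; apply: is_derive_add.
have EPhi' x : Phi' x = D x - lam * q x + Phi 0 by rewrite /Phi' /D /q; lra.
have cPhi' a b : {within `[a, b], continuous Phi'}.
  by apply: continuous_subspaceT; apply: continuous_of_derive dPhi'.
have m20 : 0 <= 2 * m by lra.
have [k0 k0i k0min] := EVT_min m20 (cPhi' 0 (2 * m)).
pose M := Num.min 1 (5 / 2 * m).
have mM : 2 * m <= M by rewrite /M le_min; apply/andP; split; move: m0 m1; clear; lra.
have [l0 l0i l0min] := EVT_min mM (cPhi' (2 * m) M).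
rewrite !in_itv/= in k0i l0i.
have D0 : D 0 = 0 by rewrite /D subrr.
have q00 : q 0 = 0 by rewrite /q; lra.
have q2m : q (2 * m) = 0 by rewrite /q; lra.
have k0neg : Phi' k0 < Phi 0.
  by apply: le_lt_trans (k0min k _) _; rewrite ?in_itv//= EPhi'; lra.
have l0neg : Phi' l0 <= Phi 0 - eta.
  have lM : l <= M by rewrite /M le_min lm andbT; case/andP: l01.
  apply: le_trans (l0min l _) _; first by rewrite in_itv/= (ltW ml) lM.
  have ql : q l <= 1 by rewrite /q; nra.
  have : eta * q l <= eta by nra.
  rewrite EPhi' /lam; move: eta0 ql; rewrite /eta; lra.
have k0_gt0 : 0 < k0.
  move: k0i => /andP[]; rewrite le_eqVlt => /orP[/eqP e|//].
  by move: k0neg; rewrite -e EPhi' D0 q00 mulr0 subr0 add0r ltxx.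
have k0_lt : k0 < 2 * m.
  move: k0i => /andP[_]; rewrite le_eqVlt => /orP[/eqP e|//].
  by move: k0neg; rewrite e EPhi' q2m; move: D2m; clear; lra.
have l0_gt : 2 * m < l0.
  move: l0i => /andP[]; rewrite le_eqVlt => /orP[/eqP e|//].
  by move: l0neg; rewrite -e EPhi' q2m; move: D2m eta0; clear; lra.
have [l01' l0m] : l0 <= 1 /\ l0 <= 5 / 2 * m.
  by move: l0i => /andP[_]; rewrite /M le_min => /andP[].
apply: (@window_contra n m phi' Phi' c k0 l0) => //.
- by rewrite k0_gt0.
- by rewrite l0_gt.
- by move=> x /andP[x0 xk]; apply: k0min; rewrite in_itv/= x0 (le_trans xk (ltW k0_lt)).
(* [l0] was chosen minimal only on $[2m,M]$; on $[0,2m]$ membership of [ls] in [L] gives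
   [Phi' >= Phi 0 - eta], hence [Phi' >= Phi' l0]. *)
- move=> x /andP[x0 xl]; have /orP[x2|x2] := le_total x (2 * m); last first.
    by apply: l0min; rewrite in_itv/= x2/=; move: l0i => /andP[_]; apply: le_trans.
  apply: le_trans l0neg _; rewrite EPhi'.
  have := lsL x; rewrite x0 x2 => /(_ isT) h.
  have : - eta <= eta * q x.
    by rewrite -mulN1r mulrC ler_pM2l// /q; move: x0 x2 m0 m1; clear; nra.
  by rewrite /lam; move: h; clear; lra.
- move=> x x01 sx; rewrite /phi' !big_split/=.
  have -> : \sum_(i < n) - (lam / 2) * (x i * 1 + x i * 1) = - lam * \sum_i x i.
    by rewrite mulr_sumr; apply: eq_bigr => i _; clear; lra.
  rewrite sumr_const card_ord -[X in _ + (_ + X)]mulr_natl sx.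
  by have := H x x01 sx; lra.
Qed.
End tangent.

Section two_atoms.
Context {R : realType}.
Implicit Types (phi Phi : R -> R).

(** A law of a cut point with mean [p] and second moment [2 * p * s1], kept in the range where both
    parabolic bounds are available. Its values are $a$ and $b=p-d$ with $(a-p)d$ equal to the
    variance; $a$ is taken as large as allowed, namely $\min(1,\frac52s_1)$. *)
Lemma two_point_law (p s1 s2 : R) : 0 < p < 1 -> p * s1 + (1 - p) * s2 = 1 / 2 ->
  p / 2 <= s1 < 1 / 2 ->
  exists a b c : R, [/\ 0 <= c <= 1, 0 <= b <= a, a <= 1 /\ a <= 5 / 2 * s1,
    1 - b <= 5 / 2 * (1 - s2) & c * a + (1 - c) * b = p /\
    c * a ^+ 2 + (1 - c) * b ^+ 2 = 2 * p * s1].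
Proof.
move=> /andP[p0 p1] mean /andP[s1p s12].
(* Half the variance of the law; [e2] shows that the mirrored data [1 - p], [1 - s2] give the same
   [w]. *)
pose w := p * s1 - p ^+ 2 / 2.
have w0 : 0 <= w by rewrite /w; nra.
have e1 : p * s1 = p ^+ 2 / 2 + w by rewrite /w; lra.
have e2 : (1 - p) * (1 - s2) = (1 - p) ^+ 2 / 2 + w by rewrite /w; lra.
have q0 : 0 < 1 - p by lra.
have tt : 0 < p * (1 - p) by apply: mulr_gt0.
have t4 : p * (1 - p) <= 1 / 4 by have := sqr_ge0 (p - 1 / 2); lra.
suff [a [ap a1 a5 va vb]] : exists a : R, [/\ p < a, a <= 1, a <= 5 / 2 * s1,
    2 * w <= (a - p) * p & 2 * w <= (a - p) * (p - 1 + 5 / 2 * (1 - s2))].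
  have ap0 : 0 < a - p by lra.
  pose d := 2 * w / (a - p).
  have d0 : 0 <= d by rewrite /d divr_ge0 ?mulr_ge0// ltW.
  have dp : d <= p by rewrite /d ler_pdivrMr// [leRHS]mulrC.
  have dp' : d <= p - 1 + 5 / 2 * (1 - s2) by rewrite /d ler_pdivrMr// [leRHS]mulrC.
  have ed : (a - p) * d = 2 * w by rewrite /d mulrC divfK// gt_eqF.
  have adp : 0 < a - p + d by lra.
  pose c := d / (a - p + d).
  have ec : c * (a - p + d) = d by rewrite /c divfK// gt_eqF.
  exists a, (p - d), c; split => //.
  - apply/andP; split; first by rewrite /c divr_ge0// ltW.
    by rewrite /c ler_pdivrMr// mul1r; lra.
  - by apply/andP; split; lra.
  - by lra.
  - have E : c * a + (1 - c) * (p - d) = p.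
      by rewrite -[RHS](subrK d) -{3}ec; ring.
    split => //.
    have -> : c * a ^+ 2 + (1 - c) * (p - d) ^+ 2 =
      (p - d) ^+ 2 + c * (a - p + d) * (a + p - d) by ring.
    rewrite ec; have -> : (p - d) ^+ 2 + d * (a + p - d) = p ^+ 2 + (a - p) * d by ring.
    by rewrite ed; lra.
have [h|h] := leP 1 (5 / 2 * s1).
  exists 1; split => //; first by rewrite e1 in mean *; nra.
  have -> : (1 - p) * (p - 1 + 5 / 2 * (1 - s2)) =
    5 / 2 * ((1 - p) * (1 - s2)) - (1 - p) ^+ 2 by ring.
  by rewrite e2; have := sqr_ge0 (1 - p); lra.
exists (5 / 2 * s1); split => //; [lra|exact: ltW| |].
  have -> : (5 / 2 * s1 - p) * p = 5 / 2 * (p * s1) - p ^+ 2 by ring.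
  by rewrite e1; have := sqr_ge0 p; lra.
rewrite -(ler_pM2l tt).
have -> : p * (1 - p) * ((5 / 2 * s1 - p) * (p - 1 + 5 / 2 * (1 - s2))) =
  (5 / 2 * (p * s1) - p ^+ 2) * (5 / 2 * ((1 - p) * (1 - s2)) - (1 - p) ^+ 2) by ring.
(* The factors become $p^2/4+\frac52w$ and $(1-p)^2/4+\frac52w$. Their product is at least
   $2p(1-p)w$ by the square [h1] and $p(1-p)\le1/4$. *)
rewrite e1 e2.
have h1 := sqr_ge0 (p * (1 - p) / 4 - 5 / 2 * w).
have h2 : p * (1 - p) * w <= 1 / 4 * w by apply: ler_wpM2r.
have h3 : 0 <= p * (1 - p) * w by apply: mulr_ge0 => //; exact: ltW.
lra.
Qed.

(** Cut $[0,1]$ at $x$. [tangent_parabola] bounds $\int_0^x\phi$ below by $\psi_1x$ plus a multiple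
    of $x^2/2-s_1x$ and, after reflection, $\int_x^1\phi$ by $\psi_2(1-x)$ plus a multiple of the
    mirrored parabola. Under the law of [two_point_law] both parabolas have mean zero and $x$ has
    mean $p$, so averaging gives the claim. *)
Lemma two_atoms n phi Phi (p s1 s2 psi1 psi2 : R) : (3 <= n)%N ->
  continuous phi -> (forall x : R, is_derive x 1 Phi (phi x)) ->
  0 < p < 1 -> p * s1 + (1 - p) * s2 = 1 / 2 -> p / 2 <= s1 < 1 / 2 ->
  (forall x : 'I_n -> R, (forall i, 0 <= x i <= 1) ->
     \sum_i x i = n%:R * s1 -> n%:R * psi1 <= \sum_i phi (x i)) ->
  (forall x : 'I_n -> R, (forall i, 0 <= x i <= 1) ->
     \sum_i x i = n%:R * s2 -> n%:R * psi2 <= \sum_i phi (x i)) ->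
  p * psi1 + (1 - p) * psi2 <= Phi 1 - Phi 0.
Proof.
move=> n3 cphi dPhi p01 mean s1p H1 H2.
have n0 : 0 < n%:R :> R by rewrite ltr0n (leq_trans _ n3).
have /andP[p0 p1] := p01; have /andP[s1p1 s1p2] := s1p.
have s10 : 0 < s1 by lra.
have s2h : 1 / 2 < s2 by rewrite -(ltr_pM2l (_ : 0 < 1 - p)); nra.
have s21 : s2 < 1.
  by rewrite -(ltr_pM2l (_ : 0 < 1 - p)); last lra; nra.
(* [tangent_parabola] needs a strictly positive sum; lowering both [psi]'s by [e] supplies the
   margin $ne$. *)
apply/ler_addgt0Pl => /= e e0.
pose phi1 (x : R) := phi x + (- (psi1 - e)).
pose phi2 (x : R) := (- 1) * (phi (1 + (-1) * x) * (-1)) + (- (psi2 - e)).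
have aff (k x : R) : is_derive x 1 (fun x : R => k * (0 + 1 * x)) k.
  apply: is_derive_eq (is_derive_scale k (@is_derive_affine R id (cst 1) 0 1 x (fun x => is_derive_id x 1))) _.
  by rewrite /cst !mulr1.
have d1 (x : R) : is_derive x 1 (fun x : R => Phi x + (- (psi1 - e)) * (0 + 1 * x)) (phi1 x).
  exact: is_derive_add (dPhi x) (aff _ x).
have d2 (x : R) : is_derive x 1 (fun x : R => (- 1) * Phi (1 + (-1) * x) + (- (psi2 - e)) * (0 + 1 * x)) (phi2 x).
  exact: is_derive_add (is_derive_scale _ (is_derive_affine _ _ _ dPhi)) (aff _ x).
have c1 : continuous phi1 by move=> x; apply: cvgD; [exact: cphi|exact: cvg_cst].
have c2 : continuous phi2.
  move=> x; apply: cvgD; last exact: cvg_cst.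
  apply: cvgM; first exact: cvg_cst.
  apply: cvgM; last exact: cvg_cst.
  apply: (@continuous_comp _ _ _ (fun x : R => 1 + -1 * x) phi); last exact: cphi.
  apply: cvgD; first exact: cvg_cst.
  by apply: cvgM; [exact: cvg_cst|exact: cvg_id].
have ne0 : 0 < n%:R * e by exact: mulr_gt0.
have [||lam1 J1] := tangent_parabola n3 ne0 _ c1 d1 (m := s1).
- by apply/andP; split.
- move=> x x01 sx; rewrite big_split/= sumr_const card_ord -mulr_natl.
  by have := H1 x x01 sx; lra.
have [||lam2 J2] := tangent_parabola n3 ne0 _ c2 d2 (m := 1 - s2).
- by apply/andP; split; lra.
- move=> x x01 sx; rewrite big_split/= sumr_const card_ord -mulr_natl.
  have := H2 (fun i => 1 - x i) _ _.
  rewrite sumrB sumr_const card_ord sx => /(_ _ _).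
  have -> : \sum_(i < n) -1 * (phi (1 + -1 * x i) * -1) = \sum_i phi (1 - x i).
    by apply: eq_bigr => i _; rewrite mulN1r mulrN1 opprK mulN1r.
  move=> h; have : n%:R * psi2 <= \sum_i phi (1 - x i).
    by apply: h => [i|]; [have /andP[] := x01 i; lra|lra].
  by lra.
have [a [b [c [/andP[c0 c1'] /andP[b0 ba] [a1 a5] b5 [Ea Eb]]]]] := two_point_law p01 mean s1p.
have K (x : R) : 0 <= x <= 1 -> x <= 5 / 2 * s1 -> 1 - x <= 5 / 2 * (1 - s2) ->
  (psi1 - e) * x + (psi2 - e) * (1 - x) + lam1 * (x ^+ 2 / 2 - s1 * x) +
  lam2 * ((1 - x) ^+ 2 / 2 - (1 - s2) * (1 - x)) <= Phi 1 - Phi 0.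
  move=> /andP[x0 x1] xs1 xs2.
  have := J1 x; rewrite x0 x1 => /(_ isT xs1).
  have := J2 (1 - x); rewrite subr_ge0 lerBlDr lerDl x0 x1.
  move=> /(_ isT xs2).
  rewrite !mulr0 !addr0 !mul1r !mulN1r !add0r opprB addrCA subrr addr0.
  lra.
have Ka : 0 <= a <= 1 by rewrite (le_trans b0 ba) a1.
have Kb : 0 <= b <= 1 by rewrite b0 (le_trans ba a1).
have {}Ka := K a Ka a5 ltac:(lra).
have {}Kb := K b Kb ltac:(lra) b5.
have c1'' : 0 <= 1 - c by lra.
have := lerD (ler_wpM2l c0 Ka) (ler_wpM2l c1'' Kb).
set A := (X in X <= _ -> _); set B := (X in _ <= X -> _).
have -> : A = (psi1 - e) * (c * a + (1 - c) * b) + (psi2 - e) * (1 - (c * a + (1 - c) * b))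
   + lam1 * ((c * a ^+ 2 + (1 - c) * b ^+ 2) / 2 - s1 * (c * a + (1 - c) * b))
   + lam2 * ((1 - 2 * (c * a + (1 - c) * b) + (c * a ^+ 2 + (1 - c) * b ^+ 2)) / 2 -
     (1 - s2) * (1 - (c * a + (1 - c) * b))) by rewrite /A; ring.
have -> : B = Phi 1 - Phi 0 by rewrite /B; ring.
rewrite Ea Eb.
have -> : 2 * p * s1 / 2 - s1 * p = 0 by lra.
have -> : (1 - 2 * p + 2 * p * s1) / 2 - (1 - s2) * (1 - p) = 0 by lra.
lra.
Qed.

(** All windows are $[0,1]$; the polygon condition is $1<n/2$. *)
Lemma one_atom n phi Phi (psi : R) : (3 <= n)%N ->
  (forall x : R, is_derive x 1 Phi (phi x)) ->
  (forall x : 'I_n -> R, (forall i, 0 <= x i <= 1) ->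
     \sum_i x i = n%:R / 2 -> n%:R * psi <= \sum_i phi (x i)) ->
  psi <= Phi 1 - Phi 0.
Proof.
move=> n3 dPhi H.
have n3R : 3 <= n%:R :> R by rewrite ler_nat.
have := @polygon_mean R n (fun=> 0) (fun=> 1) phi Phi (n%:R * psi) dPhi.
rewrite !sumr_const card_ord mul0rn => /(_ _ _ (leq_trans (isT : 0 < 3)%N n3)) P.
have : n%:R * psi <= ((Phi (0 + 1) - Phi 0) / 1) *+ n.
  apply: P => [//|_|x xw sx]; first by lra.
  by apply: H => [i|]; [have := xw i; rewrite add0r|rewrite sx add0r].
rewrite add0r divr1 mulr_natl lerMn2r => /orP[/eqP n0|//].
by move: n3; rewrite n0.
Qed.
End two_atoms.

                            

(** * Atomic measures below Lebesgue measure in convex order, and the dual inequality *)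

Section positive_part.
Context {R : realType}.
Implicit Types x y : R.

Definition pos x : R := Num.max x 0.

Lemma pos_ge0 x : 0 <= pos x. Proof. by rewrite /pos le_max lexx orbT. Qed.

Lemma pos_ge x : x <= pos x. Proof. by rewrite /pos le_max lexx. Qed.

Lemma pos_id x : 0 <= x -> pos x = x.
Proof. by move=> x0; rewrite /pos max_l. Qed.

Lemma pos_eq0 x : x <= 0 -> pos x = 0.
Proof. by move=> x0; rewrite /pos max_r. Qed.

Lemma pos_homo x y : x <= y -> pos x <= pos y.
Proof. by move=> xy; rewrite /pos ge_max !le_max xy lexx/= orbT. Qed.

Lemma pos_lip x y : x <= y -> pos y - pos x <= y - x.
Proof.
move=> xy; have [x0|/ltW x0] := leP 0 x.
  by rewrite !pos_id// (le_trans x0).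
rewrite (pos_eq0 x0) subr0; have [y0|/ltW y0] := leP 0 y.
  by rewrite pos_id//; lra.
by rewrite pos_eq0//; lra.
Qed.

Lemma continuous_pos : continuous pos.
Proof.
move=> x; apply: (@continuous_max _ _ (fun x : R => x) (fun=> 0)).
  exact: cvg_id.
exact: cvg_cst.
Qed.

Lemma continuous_pos_shift y : continuous (fun x : R => pos (x - y)).
Proof.
move=> x; apply: (@continuous_comp _ _ _ (fun x : R => x - y) (@pos)).
  by apply: cvgD; [exact: cvg_id|exact: cvg_cst].
exact: continuous_pos.
Qed.
End positive_part.

Section convex_order_block.
Context {R : realType} {I : finType}.
Variable s : I -> R.
Implicit Types (p F psi : I -> R) (a b x : R).

(** The integrated distribution function of the measure with mass [p i] at [s i]. *)
Definition call p x := \sum_i p i * pos (x - s i).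

                                                                             
                        
(** This says that $\sum_i p_i\delta_{s_i}$ is below Lebesgue measure on $[a,b]$ in convex order:
    $(x-a)^2/2$ is the integrated distribution function of the latter. *)
Definition cxblock a b p :=
  [/\ forall i, 0 <= p i, \sum_i p i = b - a,
      \sum_i p i * s i = (b ^+ 2 - a ^+ 2) / 2 &
      forall x, a <= x <= b -> call p x <= (x - a) ^+ 2 / 2].

Definition supp p := [set i | p i != 0]%SET.

Lemma continuous_call p : continuous (call p).
Proof.
apply: continuous_big => [|i _ x]; first exact: add_continuous.
by apply: cvgM; [exact: cvg_cst|exact: continuous_pos_shift].
Qed.

Lemma call_ge0 p x : (forall i, 0 <= p i) -> 0 <= call p x.
Proof. by move=> p0; apply: sumr_ge0 => i _; rewrite mulr_ge0 ?pos_ge0. Qed.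

Lemma call_ge p x i : (forall i, 0 <= p i) -> p i * pos (x - s i) <= call p x.
Proof.
move=> p0; rewrite /call (bigD1 i)//= lerDl.
by apply: sumr_ge0 => j _; rewrite mulr_ge0 ?pos_ge0.
Qed.

(** An atom at or left of [a] would make [call p] grow at least linearly to the right of [a],
    against the quadratic bound. At [b] the mass and mean conditions turn the bound into its mirror
    image. *)
Lemma cxblock_supp a b p i : a < b -> cxblock a b p -> p i != 0 -> a < s i < b.
Proof.
move=> ab [p0 p1 p2 pc] pi.
have pi0 : 0 < p i by rewrite lt0r pi p0.
apply/andP; split.
- rewrite ltNge; apply/negP => sia.
  pose x := Num.min b (a + p i).
  have ax : a < x by rewrite /x lt_min ab ltrDl.
  have xb : x <= b by rewrite /x ge_min lexx.
  have xp : x <= a + p i by rewrite /x ge_min lexx orbT.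
  have := le_trans (call_ge x i p0) (pc x _); rewrite (ltW ax) xb => /(_ isT).
  rewrite pos_id; last by lra.
  nra.
- rewrite ltNge; apply/negP => sib.
  pose x := Num.max a (b - p i).
  have ax : a <= x by rewrite /x le_max lexx.
  have xb : x < b by rewrite /x gt_max ab/=; lra.
  have xp : b - p i <= x by rewrite /x le_max lexx orbT.
  have : (b - a) * x - (b ^+ 2 - a ^+ 2) / 2 + p i * (s i - x) <= call p x.
    rewrite -p1 -p2 mulr_suml -sumrB /call (bigD1 i)//= [leRHS](bigD1 i)//=.
    rewrite (pos_eq0 (_ : x - s i <= 0)); last by lra.
    have -> : p i * x - p i * s i +
        \sum_(j | j != i) (p j * x - p j * s j) + p i * (s i - x) =
        \sum_(j | j != i) (p j * x - p j * s j) by ring.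
    rewrite mulr0 add0r; apply: ler_sum => j _.
    by rewrite -mulrBr ler_wpM2l ?p0// pos_ge.
  have := pc x; rewrite ax (ltW xb) => /(_ isT).
  nra.
Qed.

Lemma block_mass_pos a b p : a < b -> cxblock a b p -> exists i, i \in supp p.
Proof.
move=> ab [p0 p1 _ _]; apply: contrapT => h.
have : \sum_i p i = 0.
  apply: big1 => i _; apply/eqP; apply: contrapT => /negP pi.
  by apply: h; exists i; rewrite inE.
by rewrite p1; lra.
Qed.

(** [call p] is convex and lies below a smooth parabola, so at an interior contact point the slopes
    agree: the mass left of [x0] is exactly [x0 - a] ([m1] and [m2] compare slopes on either side),
    and the contact value then fixes the first moment of the left part. *)
Lemma cxblock_split a b p x0 : a < x0 < b -> cxblock a b p ->
  call p x0 = (x0 - a) ^+ 2 / 2 ->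
  cxblock a x0 (fun i => if s i < x0 then p i else 0) /\
  cxblock x0 b (fun i => if s i < x0 then 0 else p i).
Proof.
move=> /andP[ax xb] [p0 p1 p2 pc] px0.
pose pl i := if s i < x0 then p i else 0.
pose pr i := if s i < x0 then 0 else p i.
have plr i : p i = pl i + pr i by rewrite /pl /pr; case: ifP; rewrite ?addr0 ?add0r.
have pl0 i : 0 <= pl i by rewrite /pl; case: ifP.
have pr0 i : 0 <= pr i by rewrite /pr; case: ifP.
have csplit x : call p x = call pl x + call pr x.
  by rewrite /call -big_split/=; apply: eq_bigr => i _; rewrite plr mulrDl.
have crx0 x : x <= x0 -> call pr x = 0.
  move=> xx; apply: big1 => i _; rewrite /pr; case: ltP => h; first by rewrite mul0r.
  by rewrite pos_eq0 ?mulr0//; lra.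
have clx0 x : x0 <= x -> call pl x = (\sum_i pl i) * x - \sum_i pl i * s i.
  move=> xx; rewrite mulr_suml -sumrB; apply: eq_bigr => i _.
  rewrite -mulrBr /pl; case: ltP => h; last by rewrite !mul0r.
  by rewrite pos_id//; lra.
have m1 : \sum_i pl i <= x0 - a.
  apply/ler_addgt0Pl => e e0.
  pose h := Num.min e (b - x0).
  have h0 : 0 < h by rewrite /h lt_min e0 subr_gt0.
  have he : h <= e by rewrite /h ge_min lexx.
  have hb : h <= b - x0 by rewrite /h ge_min lexx orbT.
  have := pc (x0 + h); rewrite (_ : (_ <= _ <= _)); last by apply/andP; split; lra.
  move=> /(_ isT).
  rewrite csplit clx0; last by lra.
  have := px0; rewrite csplit (crx0 x0)// clx0// addr0.
  have := call_ge0 (x0 + h) pr0.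
  set S := \sum_i pl i => c0 E1 E2.
  have : S * h <= (x0 - a + h) * h by nra.
  by rewrite ler_pM2r//; lra.
have m2 : x0 - a <= \sum_i pl i.
  apply/ler_addgt0Pl => e e0.
  pose h := Num.min e (x0 - a).
  have h0 : 0 < h by rewrite /h lt_min e0 subr_gt0.
  have he : h <= e by rewrite /h ge_min lexx.
  have hb : h <= x0 - a by rewrite /h ge_min lexx orbT.
  have := pc (x0 - h); rewrite (_ : (_ <= _ <= _)); last by apply/andP; split; lra.
  move=> /(_ isT).
  rewrite csplit (crx0 (x0 - h)) ?addr0; last by lra.
  have := px0; rewrite csplit (crx0 x0)// addr0 => E1 E2.
  have E3 : call pl x0 - call pl (x0 - h) <= (\sum_i pl i) * h.
    rewrite /call -sumrB mulr_suml; apply: ler_sum => i _.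
    rewrite -mulrBr ler_wpM2l//; apply: le_trans (pos_lip _) _; lra.
  have : (x0 - a - h) * h <= (\sum_i pl i) * h by nra.
  by rewrite ler_pM2r//; lra.
have m : \sum_i pl i = x0 - a by apply: le_anti; rewrite m1 m2.
have mom : \sum_i pl i * s i = (x0 ^+ 2 - a ^+ 2) / 2.
  by have := px0; rewrite csplit (crx0 x0)// clx0// addr0 m; lra.
have mr : \sum_i pr i = b - x0.
  have : \sum_i p i = \sum_i pl i + \sum_i pr i.
    by rewrite -big_split; apply: eq_bigr => i _; exact: plr.
  by rewrite p1 m; lra.
have momr : \sum_i pr i * s i = (b ^+ 2 - x0 ^+ 2) / 2.
  have : \sum_i p i * s i = \sum_i pl i * s i + \sum_i pr i * s i.
    by rewrite -big_split; apply: eq_bigr => i _; rewrite plr mulrDl.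
  by rewrite p2 mom; lra.
split; split => // x /andP[ax' xb'].
  have := pc x; rewrite csplit (crx0 x)// addr0; apply; lra.
have := pc x; rewrite csplit (clx0 x)// m mom => /(_ _) h.
have : (x0 - a) * x - (x0 ^+ 2 - a ^+ 2) / 2 + call pr x <= (x - a) ^+ 2 / 2.
  by apply: h; apply/andP; split; lra.
by lra.
Qed.

Lemma sum_bump p F i c : \sum_k (p k + c *+ (k == i)) * F k = \sum_k p k * F k + c * F i.
Proof.
under eq_bigr do rewrite mulrDl; rewrite big_split/=; congr (_ + _).
rewrite (bigD1 i)//= eqxx big1 ?addr0// => k /negbTE ->.
by rewrite mulr0n mul0r.
Qed.

Lemma supp_sub p p' : (forall i, p i = 0 -> p' i = 0) -> supp p' \subset supp p.
Proof.
by move=> h; apply/fintype.subsetP => i; rewrite !inE; apply: contra => /eqP/h ->.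
Qed.

Lemma supp_lt p p' j : (forall i, p i = 0 -> p' i = 0) -> j \in supp p -> p' j = 0 ->
  (#|supp p'| < #|supp p|)%N.
Proof.
move=> h jp p'j; apply: proper_card; apply/properP; split; first exact: supp_sub.
by exists j => //; rewrite inE p'j eqxx.
Qed.

Lemma sum_supp p F : \sum_i p i * F i = \sum_(i in supp p) p i * F i.
Proof.
rewrite [LHS](bigID (mem (supp p)))/= [X in _ + X]big1 ?addr0// => i.
by rewrite inE negbK => /eqP ->; rewrite mul0r.
Qed.

End convex_order_block.

Section dual_inequality.
Context {R : realType} {I : finType}.
Variables (s psi : I -> R) (n : nat) (phi Phi : R -> R).
Hypothesis n3 : (3 <= n)%N.
Hypothesis cphi : continuous phi.
Hypothesis dPhi : forall x : R, is_derive x 1 Phi (phi x).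
Hypothesis Hpsi : forall i (x : 'I_n -> R), (forall j, 0 <= x j <= 1) ->
  \sum_j x j = n%:R * s i -> n%:R * psi i <= \sum_j phi (x j).
Implicit Types (p : I -> R) (a b x : R).

Local Notation cxblock := (cxblock s).
Local Notation call := (call s).

Let value p := \sum_i p i * psi i.

Let sum_mul1 (p : I -> R) : \sum_k p k = \sum_k p k * (fun=> 1) k.
Proof. by apply: eq_bigr => k _; rewrite mulr1. Qed.

Let phi_rescaled a b : a < b ->
  continuous (fun y : R => phi (a + (b - a) * y)) /\
  (forall y : R, is_derive y 1 (fun y : R => (b - a)^-1 * Phi (a + (b - a) * y))
     (phi (a + (b - a) * y))).
Proof.
move=> ab; split=> [y|y].
  apply: (@continuous_comp _ _ _ (fun x : R => a + (b - a) * x) phi); last exact: cphi.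
  apply: cvgD; first exact: cvg_cst.
  by apply: cvgM; [exact: cvg_cst|exact: cvg_id].
apply: is_derive_eq (is_derive_scale _ (is_derive_affine a (b - a) y dPhi)) _.
by rewrite mulrC mulfK// subr_eq0 gt_eqF.
Qed.

Let H_rescaled a b i (x : 'I_n -> R) : 0 <= a -> a < b -> b <= 1 ->
  (forall j, 0 <= x j <= 1) ->
  \sum_j x j = n%:R * ((s i - a) / (b - a)) ->
  n%:R * psi i <= \sum_j phi (a + (b - a) * x j).
Proof.
move=> a0 ab b1 x01 sx; apply: Hpsi.
  by move=> j; have /andP[? ?] := x01 j; apply/andP; split; nra.
rewrite big_split/= sumr_const card_ord -mulr_sumr sx -[a *+ n]mulr_natl.
by field; rewrite subr_eq0 gt_eqF.
Qed.

Let block1 a b p i : 0 <= a -> a < b -> b <= 1 -> cxblock a b p ->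
  supp p = [set i]%SET -> value p <= Phi b - Phi a.
Proof.
move=> a0 ab b1 [p0 p1 p2 pc] Ei.
have ba : 0 < b - a by lra.
have sumi F : \sum_k p k * F k = p i * F i by rewrite sum_supp Ei big_set1.
have pi : p i = b - a.
  by rewrite -p1 (sum_mul1 p) sumi mulr1.
have si : s i = (a + b) / 2.
  by move: p2; rewrite sumi pi => E; apply: (mulfI (lt0r_neq0 ba)); rewrite E; lra.
have [cr dr] := phi_rescaled ab.
have := one_atom n3 dr (psi := psi i).
have -> : a + (b - a) * 1 = b by ring.
rewrite mulr0 addr0 => K.
rewrite /value sumi pi -ler_pdivlMl// mulrBr.
apply: K => x x01 sx; apply: (@H_rescaled a b) => //.
by rewrite sx si; field; rewrite gt_eqF.
Qed.

Let block2 a b p i j : 0 <= a -> a < b -> b <= 1 -> cxblock a b p ->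
  supp p = [set i; j]%SET -> s i < s j -> value p <= Phi b - Phi a.
Proof.
move=> a0 ab b1 cx Eij sij; have [p0 p1 p2 pc] := cx.
have ba : 0 < b - a by lra.
have ij : i != j by apply/eqP => ij; move: sij; rewrite ij ltxx.
have sumi F : \sum_k p k * F k = p i * F i + p j * F j.
  by rewrite sum_supp Eij big_setU1 ?inE// big_set1.
have pi0 : 0 < p i.
  by have : i \in supp p; [rewrite Eij !inE eqxx|rewrite inE lt0r p0 andbT].
have pj0 : 0 < p j.
  by have : j \in supp p; [rewrite Eij !inE eqxx orbT|rewrite inE lt0r p0 andbT].
have pj : p j = b - a - p i.
  by rewrite -p1 (sum_mul1 p) sumi !mulr1 addrC addKr.
have m : p i * s i + p j * s j = (b ^+ 2 - a ^+ 2) / 2 by rewrite -sumi.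
(* Testing the block condition at [a + p i] gives $s_i-a\ge p_i/2$, which after rescaling is the
   hypothesis [p / 2 <= s1] of [two_atoms]. *)
have h := le_trans (call_ge s (a + p i) i p0) (pc (a + p i) _).
have {}h : p i * (a + p i - s i) <= p i ^+ 2 / 2.
  apply: le_trans (ler_wpM2l (p0 i) (pos_ge _)) _.
  by have := h; rewrite [a + p i - a]addrC addKr; apply; apply/andP; split; lra.
have {}h : a + p i - s i <= p i / 2 by rewrite -(ler_pM2l pi0); lra.
have [cr dr] := phi_rescaled ab.
pose P := p i / (b - a).
have eP : p i = P * (b - a) by rewrite /P divfK// gt_eqF.
have eP' : p j = (1 - P) * (b - a) by rewrite pj eP; ring.
pose si := (s i - a) / (b - a); pose sj := (s j - a) / (b - a).
have esi : s i = a + si * (b - a) by rewrite /si divfK ?gt_eqF//; ring.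
have esj : s j = a + sj * (b - a) by rewrite /sj divfK ?gt_eqF//; ring.
have P0 : 0 < P by rewrite /P divr_gt0.
have P1 : P < 1 by rewrite /P ltr_pdivrMr// mul1r; lra.
have mean : P * si + (1 - P) * sj = 1 / 2.
  have : (b - a) ^+ 2 * (P * si + (1 - P) * sj) = (b - a) ^+ 2 * (1 / 2).
    have : (P * (b - a)) * (a + si * (b - a)) + ((1 - P) * (b - a)) * (a + sj * (b - a)) =
      (b ^+ 2 - a ^+ 2) / 2 by rewrite -eP -eP' -esi -esj.
    by move=> E; lra.
  by apply: mulfI; rewrite expf_neq0// gt_eqF.
have sisj : si < sj by rewrite /si /sj ltr_pM2r ?invr_gt0//; lra.
have := @two_atoms R n _ _ P si sj (psi i) (psi j) n3 cr dr.
have -> : a + (b - a) * 1 = b by ring.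
rewrite P0 P1 mulr0 addr0 => /(_ isT mean) K.
have {K} : P * psi i + (1 - P) * psi j <= (b - a)^-1 * Phi b - (b - a)^-1 * Phi a.
  apply: K.
  - apply/andP; split; last by nra.
    rewrite -(ler_pM2r ba) mulrAC -eP; move: h; rewrite esi.
    by lra.
  - by move=> x x01 sx; apply: (@H_rescaled a b).
  - by move=> x x01 sx; apply: (@H_rescaled a b).
rewrite -mulrBr ler_pdivlMl// /value sumi eP eP' => K.
by apply: le_trans K; lra.
Qed.

Let le_of_perturb (t t' V d B : R) : 0 < t -> 0 < t' -> V + - t * d <= B ->
  V + t' * d <= B -> V <= B.
Proof.
move=> t0 t'0 h h'; rewrite -(ler_pM2l (addr_gt0 t0 t'0)).
have -> : (t + t') * V = t' * (V + - t * d) + t * (V + t' * d) by ring.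
rewrite mulrDl addrC; apply: lerD; rewrite ler_pM2l//.
Qed.

Let bound k := forall a b p, 0 <= a -> a < b -> b <= 1 -> cxblock a b p ->
  (#|supp p| <= k)%N -> value p <= Phi b - Phi a.

(** At a contact point the block splits at [x0]; each side carries at least one atom, hence the
    other has strictly fewer atoms than [p], and the two bounds add up. *)
Let block_zero k a b p x0 : bound k -> 0 <= a -> a < x0 < b -> b <= 1 ->
  cxblock a b p -> (#|supp p| <= k.+1)%N -> call p x0 = (x0 - a) ^+ 2 / 2 ->
  value p <= Phi b - Phi a.
Proof.
move=> IH a0 /andP[ax xb] b1 cx pk px0.
have [cl cr] := cxblock_split (introT andP (conj ax xb)) cx px0.
set pl := (fun i => if s i < x0 then p i else 0) in cl.
set pr := (fun i => if s i < x0 then 0 else p i) in cr.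
have sub_l i : p i = 0 -> pl i = 0 by rewrite /pl => ->; rewrite if_same.
have sub_r i : p i = 0 -> pr i = 0 by rewrite /pr => ->; rewrite if_same.
have [i il] := block_mass_pos ax cl.
have [j jr] := block_mass_pos xb cr.
have pri : pr i = 0 by move: il; rewrite inE /pl /pr; case: ifP => //; rewrite eqxx.
have plj : pl j = 0 by move: jr; rewrite inE /pl /pr; case: ifP => //; rewrite eqxx.
have kl : (#|supp pl| <= k)%N.
  by rewrite -ltnS (leq_trans _ pk)// (supp_lt sub_l _ plj)// (fintype.subsetP (supp_sub sub_r)).
have kr : (#|supp pr| <= k)%N.
  by rewrite -ltnS (leq_trans _ pk)// (supp_lt sub_r _ pri)// (fintype.subsetP (supp_sub sub_l)).
have Vl := IH _ _ _ a0 ax (ltW (lt_le_trans xb b1)) cl kl.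
have Vr := IH _ _ _ (le_trans a0 (ltW ax)) xb b1 cr kr.
have -> : value p = value pl + value pr.
  rewrite /value -big_split/=; apply: eq_bigr => l _; rewrite /pl /pr.
  by case: ifP; rewrite mul0r ?addr0 ?add0r.
by lra.
Qed.

(** Moving the mass of [i] onto [j] leaves the measure on the line unchanged, does not lower the
    value, and removes an atom. *)
Let block_merge k a b p i j : bound k -> 0 <= a -> a < b -> b <= 1 ->
  cxblock a b p -> (#|supp p| <= k.+1)%N -> i \in supp p -> j \in supp p ->
  i != j ->  s i = s j -> psi i <= psi j -> value p <= Phi b - Phi a.
Proof.
move=> IH a0 ab b1 [p0 p1 p2 pc] pk ip jp ij sij psij.
pose p' l := p l + p i *+ (l == j) + (- p i) *+ (l == i).
have sum' F : \sum_l p' l * F l = \sum_l p l * F l + p i * (F j - F i).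
  by rewrite /p' sum_bump sum_bump; ring.
have p'i : p' i = 0 by rewrite /p' (negbTE ij) eqxx mulr0n mulr1n addr0 subrr.
have p'E l : l != i -> p' l = p l + p i *+ (l == j).
  by move=> /negbTE li; rewrite /p' li mulr0n addr0.
apply: (@le_trans _ _ (value p')).
  by rewrite /value sum' lerDl mulr_ge0// subr_ge0.
have cx' : cxblock a b p'.
  split.
  - move=> l; have [->|/p'E ->] := eqVneq l i; first by rewrite p'i.
    by rewrite addr_ge0// mulrn_wge0.
  - by rewrite (sum_mul1 p') sum' subrr mulr0 addr0 -sum_mul1.
  - by rewrite sum' sij subrr mulr0 addr0.
  - by move=> x xab; rewrite /call sum' sij subrr mulr0 addr0; exact: pc.
apply: IH => //; rewrite -ltnS; apply: leq_trans pk.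
apply: (@supp_lt _ _ p p' i) => // l pl; have [->//|/p'E ->] := eqVneq l i.
rewrite pl; have [lj|_] := eqVneq l j; last by rewrite mulr0n addr0.
by move: jp; rewrite inE -lj pl eqxx.
Qed.

(** [q t] moves mass [t] from the middle atom to the outer two, keeping mass and mean, and the value
    is affine in [t]; so it suffices to bound it at one negative and one positive [t]. In the
    negative direction [call] decreases and one proceeds until an outer atom vanishes. In the
    positive direction one stops when the middle atom vanishes or when [call] first touches the
    parabola, where [block_zero] applies. *)
Let block_three k a b p i1 i2 i3 : bound k -> 0 <= a -> a < b -> b <= 1 ->
  cxblock a b p -> (#|supp p| <= k.+1)%N ->
  (forall x, a < x < b -> call p x != (x - a) ^+ 2 / 2) ->
  i1 \in supp p -> i2 \in supp p -> i3 \in supp p -> s i1 < s i2 < s i3 ->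
  value p <= Phi b - Phi a.
Proof.
move=> IH a0 ab b1 cx pk noz j1 j2 j3 /andP[s12 s23].
have [p0 p1 p2 pc] := cx.
have pp i : i \in supp p -> 0 < p i by rewrite inE => pi; rewrite lt0r pi p0.
have [/andP[as1 s1b] /andP[as3 s3b]] : a < s i1 < b /\ a < s i3 < b.
  by move: j1 j3; rewrite !inE => j1 j3; split; apply: cxblock_supp cx _.
have n12 : i1 != i2 by apply/eqP => e; move: s12; rewrite e ltxx.
have n23 : i2 != i3 by apply/eqP => e; move: s23; rewrite e ltxx.
have n13 : i1 != i3 by apply/eqP => e; move: (lt_trans s12 s23); rewrite e ltxx.
have s31 : 0 < s i3 - s i1 by lra.
pose al := (s i3 - s i2) / (s i3 - s i1).
pose be := 1 - al.
have al0 : 0 < al by rewrite /al divr_gt0//; lra.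
have be0 : 0 < be by rewrite /be subr_gt0 /al ltr_pdivrMr// mul1r; lra.
have es2 : s i2 = al * s i1 + be * s i3.
  have : al * (s i3 - s i1) = s i3 - s i2 by rewrite /al divfK// gt_eqF.
  by rewrite /be; lra.
pose q t l := p l + (t * al) *+ (l == i1) + (- t) *+ (l == i2) + (t * be) *+ (l == i3).
have sumq t F : \sum_l q t l * F l = \sum_l p l * F l +
    t * (al * F i1 - F i2 + be * F i3).
  by rewrite /q !sum_bump; ring.
have q1 t : q t i1 = p i1 + t * al.
  by rewrite /q eqxx (negbTE n12) (negbTE n13) !mulr0n !addr0.
have q2 t : q t i2 = p i2 - t.
  by rewrite /q eqxx (eq_sym i2) (negbTE n12) (negbTE n23) !mulr0n !addr0.
have q3 t : q t i3 = p i3 + t * be.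
  by rewrite /q eqxx (eq_sym i3) (negbTE n13) (eq_sym i3) (negbTE n23) !mulr0n !addr0.
have qo t l : l != i1 -> l != i2 -> l != i3 -> q t l = p l.
  by move=> /negbTE e1 /negbTE e2 /negbTE e3; rewrite /q e1 e2 e3 !mulr0n !addr0.
have q0 t : 0 <= p i1 + t * al -> 0 <= p i2 - t -> 0 <= p i3 + t * be ->
    forall l, 0 <= q t l.
  move=> h1 h2 h3 l; have [->|e1] := eqVneq l i1; first by rewrite q1.
  have [->|e2] := eqVneq l i2; first by rewrite q2.
  by have [->|e3] := eqVneq l i3; [rewrite q3|rewrite qo].
have sq t l : p l = 0 -> q t l = 0.
  have ne i : i \in supp p -> p l = 0 -> l != i.
    by rewrite inE => pi pl; apply/eqP => e; move: pi; rewrite -e pl eqxx.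
  by move=> pl; rewrite qo// ne.
pose T x := al * pos (x - s i1) - pos (x - s i2) + be * pos (x - s i3).
have callq t x : call (q t) x = call p x + t * T x by rewrite /call sumq.
have T0 x : 0 <= T x.
  have g1 := ler_wpM2l (ltW al0) (pos_ge (x - s i1)).
  have g3 := ler_wpM2l (ltW be0) (pos_ge (x - s i3)).
  have k1 := mulr_ge0 (ltW al0) (pos_ge0 (x - s i1)).
  have k3 := mulr_ge0 (ltW be0) (pos_ge0 (x - s i3)).
  rewrite /T; have [h|/ltW h] := leP 0 (x - s i2); last by rewrite (pos_eq0 h); lra.
  rewrite (pos_id h); have : al * (x - s i1) + be * (x - s i3) = x - s i2.
    by rewrite es2 /be; ring.
  by lra.
have Tl (x : R) : x <= s i1 -> T x = 0.
  move=> h1; have h2 := le_trans h1 (ltW s12); have h3 := le_trans h2 (ltW s23).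
  by rewrite /T !pos_eq0 ?subr_le0// !mulr0 subrr addr0.
have Tr (x : R) : s i3 <= x -> T x = 0.
  move=> h3; have h2 := le_trans (ltW s23) h3; have h1 := le_trans (ltW s12) h2.
  by rewrite /T !pos_id ?subr_ge0// es2 /be; ring.
have cxq t : 0 <= p i1 + t * al -> 0 <= p i2 - t -> 0 <= p i3 + t * be ->
    (forall x, a <= x <= b -> call p x + t * T x <= (x - a) ^+ 2 / 2) ->
    cxblock a b (q t).
  move=> h1 h2 h3 h; split.
  - exact: q0.
  - by rewrite (sum_mul1 (q t)) sumq -sum_mul1 p1 /be; ring.
  - by rewrite sumq p2 es2 /be; ring.
  - by move=> x xab; rewrite callq; exact: h.
have valq t : value (q t) = value p + t * (al * psi i1 - psi i2 + be * psi i3).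
  exact: sumq.
have pi1 := pp _ j1; have pi2 := pp _ j2; have pi3 := pp _ j3.
have Vq_less t j : cxblock a b (q t) -> j \in supp p -> q t j = 0 ->
    value (q t) <= Phi b - Phi a.
  move=> cxt jp qj; apply: IH => //; rewrite -ltnS (leq_trans _ pk)//.
  exact: supp_lt (sq t) jp qj.
have [tm tm0 Vm] : exists2 t, 0 < t & value (q (- t)) <= Phi b - Phi a.
  have inner t : 0 < t -> forall x, a <= x <= b -> call p x + - t * T x <= (x - a) ^+ 2 / 2.
    move=> t0 x xab; have := pc x xab; have := mulr_ge0 (ltW t0) (T0 x); lra.
  have [h|/ltW h] := leP (p i1 / al) (p i3 / be).
    exists (p i1 / al); first exact: divr_gt0.
    have e1 : - (p i1 / al) * al = - p i1 by rewrite mulNr divfK// gt_eqF.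
    have e3 : (p i1 / al) * be <= p i3 by rewrite -ler_pdivlMr.
    have h0 := divr_gt0 pi1 al0.
    apply: (@Vq_less _ i1) => //; last by rewrite q1 e1; lra.
    apply: cxq; [by rewrite e1 subrr|by rewrite opprK addr_ge0 ?ltW| |exact: inner].
    by rewrite mulNr subr_ge0.
  exists (p i3 / be); first exact: divr_gt0.
  have e1 : - (p i3 / be) * be = - p i3 by rewrite mulNr divfK// gt_eqF.
  have e3 : (p i3 / be) * al <= p i1 by rewrite -ler_pdivlMr.
  have h0 := divr_gt0 pi3 be0.
  apply: (@Vq_less _ i3) => //; last by rewrite q3 e1; lra.
  apply: cxq; [|by rewrite opprK addr_ge0 ?ltW|by rewrite e1 subrr|exact: inner].
  by rewrite mulNr subr_ge0.
have [tp tp0 Vp] : exists2 t, 0 < t & value (q t) <= Phi b - Phi a.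
  have t1 (t : R) : 0 < t -> 0 <= t * al by move=> t0; rewrite mulr_ge0// ltW.
  have t3 (t : R) : 0 < t -> 0 <= t * be by move=> t0; rewrite mulr_ge0// ltW.
  have [h|/existsNP[x1 /not_implyP[x1ab /negP]]] :=
      pselect (forall x, a <= x <= b -> call p x + p i2 * T x <= (x - a) ^+ 2 / 2).
    exists (p i2) => //; apply: (@Vq_less _ i2) => //; last by rewrite q2 subrr.
    apply: cxq => //.
    - by apply: addr_ge0; [exact: ltW|exact: t1].
    - by rewrite subrr.
    - by apply: addr_ge0; [exact: ltW|exact: t3].
  rewrite -ltNge => hx1.
  pose D x := (x - a) ^+ 2 / 2 - call p x.
  have D0 x : a < x < b -> 0 < D x.
    move=> xab; rewrite /D subr_gt0 lt_neqAle noz//= pc//.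
    by case/andP: xab => /ltW -> /ltW ->.
  have Tx1 : 0 < T x1.
    rewrite lt0r T0 andbT; apply/eqP => e; move: hx1; rewrite e mulr0 addr0.
    by rewrite ltNge pc.
  have x1l : s i1 < x1 by rewrite ltNge; apply/negP => /Tl e; move: Tx1; rewrite e ltxx.
  have x1r : x1 < s i3 by rewrite ltNge; apply/negP => /Tr e; move: Tx1; rewrite e ltxx.
  have cposs i := @continuous_pos_shift R (s i).
  have cT : continuous T.
    move=> x; apply: cvgD; last by apply: cvgM; [exact: cvg_cst|exact: cposs].
    apply: cvgB; last exact: cposs.
    by apply: cvgM; [exact: cvg_cst|exact: cposs].
  have cD : continuous D.
    move=> x; apply: cvgB.
      apply: cvgM; last exact: cvg_cst.
      by rewrite /GRing.exp/=; apply: cvgM; apply: cvgB; (exact: cvg_id || exact: cvg_cst).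
    exact: continuous_call.
  have s13 : s i1 <= s i3 by exact: ltW (lt_trans s12 s23).
  have cR : {within `[s i1, s i3], continuous (fun x => T x / D x)}.
    apply: continuous_in_subspaceT => x; rewrite inE/= in_itv/= => /andP[x1' x3'].
    apply: cvgM; first exact: cT.
    by apply: cvgV; [rewrite gt_eqF// D0// (lt_le_trans as1 x1') (le_lt_trans x3' s3b)|exact: cD].
  (* The first contact occurs at the least ratio [D / T], that is at the maximum of [T / D]. This
     quotient is continuous since [D > 0] on the compact interval between the outer atoms, and [T]
     vanishes outside it. *)
  have [x0 x0i x0max] := EVT_max s13 cR.
  move: x0i; rewrite in_itv/= => /andP[x0l x0r].
  have x0ab : a < x0 < b by rewrite (lt_le_trans as1 x0l) (le_lt_trans x0r s3b).
  have Dx0 := D0 _ x0ab.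
  have Dx1 : 0 < D x1 by apply: D0; rewrite (lt_trans as1 x1l) (lt_trans x1r s3b).
  have R01 : T x1 / D x1 <= T x0 / D x0.
    by apply: x0max; rewrite in_itv/=; apply/andP; split; exact: ltW.
  have Tx0 : 0 < T x0.
    have : 0 < T x0 / D x0 by apply: lt_le_trans R01; exact: divr_gt0.
    by rewrite pmulr_lgt0// invr_gt0.
  pose t := D x0 / T x0.
  have t0 : 0 < t by exact: divr_gt0.
  have tT : t * T x0 = D x0 by rewrite /t divfK// gt_eqF.
  have tle : t <= p i2.
    rewrite /t ler_pdivrMr//.
    have : T x1 * D x0 <= T x0 * D x1.
      by rewrite -ler_pdivlMr// mulrAC -ler_pdivrMr.
    have : D x1 < p i2 * T x1 by rewrite /D ltrBlDl.
    move=> /ltW/(ler_wpM2l (ltW Tx0)) h1 h2; rewrite -(ler_pM2l Tx1).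
    by apply: (le_trans h2 (le_trans h1 _)); rewrite mulrA mulrC [T x0 * _]mulrC.
  exists t => //.
  apply: (@block_zero k a b (q t) x0) => //.
  - apply: cxq.
    + by apply: addr_ge0; [exact: ltW|exact: t1].
    + by rewrite subr_ge0.
    + by apply: addr_ge0; [exact: ltW|exact: t3].
    move=> x xab; have [xl|xl] := leP x (s i1); first by rewrite Tl// mulr0 addr0; exact: pc.
    have [xr|xr] := leP (s i3) x; first by rewrite Tr// mulr0 addr0; exact: pc.
    have Dx : 0 < D x by apply: D0; rewrite (lt_trans as1 xl) (lt_trans xr s3b).
    have : T x / D x <= T x0 / D x0.
      by apply: x0max; rewrite in_itv/=; apply/andP; split; exact: ltW.
    rewrite ler_pdivrMr// mulrAC ler_pdivlMr// => h.
    have : t * T x <= D x by rewrite /t mulrAC ler_pdivrMr// mulrC [leRHS]mulrC.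
    by rewrite /D lerBrDl.
  - by apply: leq_trans pk; apply: subset_leq_card; exact: supp_sub (sq t).
  - by rewrite callq tT /D addrC subrK.
rewrite !valq in Vm Vp; exact: le_of_perturb tm0 tp0 Vm Vp.
Qed.

(** Induction on the number of atoms, for all subintervals at once because [block_zero] passes to
    subintervals. Contact points, coinciding positions and three distinct positions are each reduced
    to fewer atoms or to such a split; one or two atoms remain. *)
Lemma dual_bound a b p : 0 <= a -> a < b -> b <= 1 -> cxblock a b p ->
  \sum_i p i * psi i <= Phi b - Phi a.
Proof.
move: {-1}#|supp p| (leqnn #|supp p|) => k; elim: k a b p => [|k IH] a b p pk a0 ab b1 cx.
  have [i ip] := block_mass_pos ab cx.
  by move: pk; rewrite leqn0 cards_eq0 => /eqP e; move: ip; rewrite e inE.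
have {}IH : bound k by move=> *; apply: IH.
have [[x0 x0ab px0]|noz] := pselect (exists2 x0, a < x0 < b & call p x0 = (x0 - a) ^+ 2 / 2).
  exact: block_zero IH _ x0ab _ cx pk px0.
have {}noz x : a < x < b -> call p x != (x - a) ^+ 2 / 2.
  by move=> xab; apply/eqP => e; apply: noz; exists x.
have [[i [j [ip jp ij sij]]]|dist] := pselect (exists i j,
    [/\ i \in supp p, j \in supp p, i != j & s i = s j]).
  have [h|/ltW h] := leP (psi i) (psi j); first exact: block_merge IH _ _ _ cx pk ip jp ij sij h.
  by apply: block_merge IH _ _ _ cx pk jp ip _ (esym sij) h => //; rewrite eq_sym.
have {}dist i j : i \in supp p -> j \in supp p -> i != j -> s i != s j.
  by move=> ip jp ij; apply/eqP => e; apply: dist; exists i, j.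
have [c3|c3] := ltnP 2 #|supp p|.
  have /card_gt2P[i [j [l [[ip jp lp] [ij jl li]]]]] := c3.
  have dij := dist _ _ ip jp ij; have djl := dist _ _ jp lp jl.
  have dli := dist _ _ lp ip li.
  have three := block_three IH a0 ab b1 cx pk noz.
  case: (ltgtP (s i) (s j)) dij => // h1 _; case: (ltgtP (s j) (s l)) djl => // h2 _;
    case: (ltgtP (s l) (s i)) dli => // h3 _; first [
      by have := lt_trans (lt_trans h1 h2) h3; rewrite ltxx
    | by apply: three ip jp lp _; rewrite h1
    | by apply: three ip lp jp _; rewrite h3
    | by apply: three jp ip lp _; rewrite h1
    | by apply: three jp lp ip _; rewrite h2
    | by apply: three lp ip jp _; rewrite h3
    | by apply: three lp jp ip _; rewrite h2 ].
have [i ip] := block_mass_pos ab cx.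
have : (0 < #|supp p|)%N by apply/card_gt0P; exists i.
case E : #|supp p| c3 => [|[|[|]]]// _ _.
  move/eqP/cards1P: E => [j Ej]; exact: block1 a0 ab b1 cx Ej.
move/eqP/cards2P: E => [j [l [jl Ejl]]].
have jp : j \in supp p by rewrite Ejl !inE eqxx.
have lp : l \in supp p by rewrite Ejl !inE eqxx orbT.
have := dist _ _ jp lp jl; case: (ltgtP (s j) (s l)) => // h _; first exact: block2 a0 ab b1 cx Ejl h.
by apply: block2 a0 ab b1 cx _ h => //; rewrite Ejl finset.setUC.
Qed.
End dual_inequality.

                                     

(** * Separation and approximate solutions by finitely additive states *)

Section separation.
Context {R : realType} {I : finType}.
Implicit Types (C : set (I -> R)) (x y v : I -> R).

                                                                          
            
(** [C] need not be closed, so a nearly closest point [x] replaces the projection of [v]. If the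
    infimum [d] of the squared distances were positive, the half-space with normal [x - v] through
    [x], relaxed by [d / 2], would contain [C] but not [v]. *)
Lemma approx_of_separation C v (B : R) : C !=set0 ->
  (forall x y (t : R), C x -> C y -> 0 <= t <= 1 ->
     C (fun i => x i + t * (y i - x i))) ->
  (forall x y, C x -> C y -> \sum_i (y i - x i) ^+ 2 <= B) ->
  (forall (c : I -> R) (g : R), (forall x, C x -> g <= \sum_i c i * x i) ->
     g <= \sum_i c i * v i) ->
  forall e : R, 0 < e -> exists2 x, C x & \sum_i (x i - v i) ^+ 2 < e.
Proof.
move=> [x0 Cx0] Cconv CB Csep e e0.
pose D x := \sum_i (x i - v i) ^+ 2.
have D0 x : 0 <= D x by apply: sumr_ge0 => i _; exact: sqr_ge0.
pose S := [set D x | x in C].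
have hS : has_inf S.
  by split; [exists (D x0), x0|exists 0 => _ [x Cx <-]].
pose d := inf S.
have dle x : C x -> d <= D x by move=> Cx; apply: (inf_lbound hS.2); exists x.
have d0 : 0 <= d by apply: lb_le_inf; [exact: hS.1|move=> _ [x _ <-]].
suff dd : d <= 0.
  have [_ [x Cx <-] Dx] := inf_adherent e0 hS.
  by exists x => //; apply: lt_le_trans Dx _; rewrite -/d; lra.
rewrite leNgt; apply/negP => dpos.
have B0 : 0 <= B by apply: le_trans (CB _ _ Cx0 Cx0); apply: sumr_ge0 => i _; exact: sqr_ge0.
pose k := d / 2.
have k0 : 0 < k by rewrite /k divr_gt0.
(* The step from [x] towards [y] is so short that the quadratic term costs at most [t * k / 2];
   near-minimality of [x] within [t * k] then forces the inner product with [y - x] to be at least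
   [- k]. *)
pose t := Num.min 1 (k / (2 * (B + 1))).
have B1 : 0 < 2 * (B + 1) by lra.
have t0 : 0 < t by rewrite /t lt_min ltr01 divr_gt0.
have t1 : t <= 1 by rewrite /t ge_min lexx.
have tB : t * B <= k / 2.
  have : t <= k / (2 * (B + 1)) by rewrite /t ge_min lexx orbT.
  by rewrite ler_pdivlMr// => h; nra.
have tk : 0 < t * k by exact: mulr_gt0.
have [_ [x Cx <-] Dx] := inf_adherent tk hS.
rewrite -/d in Dx.
have := Csep (fun i => x i - v i) (\sum_i (x i - v i) * x i - k) _.
case/(_ _)/wrap.
  move=> y Cy.
  have Cz := Cconv x y t Cx Cy (introT andP (conj (ltW t0) t1)).
  have := dle _ Cz.
  have -> : D (fun i => x i + t * (y i - x i)) =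
     D x + 2 * t * (\sum_i (x i - v i) * (y i - x i)) + t ^+ 2 * \sum_i (y i - x i) ^+ 2.
    rewrite /D !mulr_sumr -!big_split/=; apply: eq_bigr => i _; ring.
  have := CB x y Cx Cy; set A := \sum_i (y i - x i) ^+ 2 => hA hD.
  have -> : \sum_i (x i - v i) * y i = \sum_i (x i - v i) * x i +
     \sum_i (x i - v i) * (y i - x i).
    by rewrite -big_split/=; apply: eq_bigr => i _; ring.
  set G := \sum_i (x i - v i) * (y i - x i) in hD *.
  suff : - k <= G by lra.
  have : t ^+ 2 * A <= t * (k / 2).
    by rewrite expr2 -mulrA ler_pM2l// (le_trans _ tB)// ler_pM2l.
  move=> hA'; rewrite -(ler_pM2l t0); nra.
move=> h.
have : D x <= k.
  have -> : D x = \sum_i (x i - v i) * x i - \sum_i (x i - v i) * v i.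
    by rewrite /D -sumrB; apply: eq_bigr => i _; ring.
  lra.
by have := dle _ Cx; rewrite /k; lra.
Qed.
End separation.

Section hinge.
Context {R : realType}.

Lemma is_derive_pos2 (x : R) : is_derive x 1 (fun y : R => pos y ^+ 2 / 2) (pos x).
Proof.
pose f (y : R) := pos y ^+ 2 / 2.
have quad h : `|f (h + x) - f x - h * pos x| <= h ^+ 2.
  rewrite /f ler_norml; case: (leP 0 x) => x0; case: (leP 0 (h + x)) => hx0;
    rewrite ?(pos_id x0) ?(pos_id hx0) ?(pos_eq0 (ltW x0)) ?(pos_eq0 (ltW hx0));
    apply/andP; split; nra.
have lim : h^-1 *: ((f \o shift x) (h *: 1) - f x) @[h --> 0^'] --> pos x.
  apply/cvgrPdist_le => /= e e0; near=> h.
  have h0 : h != 0 by near: h; exact: nbhs_dnbhs_neq.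
  rewrite /GRing.scale/= mulr1 -normrN opprB.
  have -> : h^-1 * (f (h + x) - f x) - pos x = h^-1 * (f (h + x) - f x - h * pos x).
    by field.
  rewrite normrM normfV ler_pdivrMl ?normr_gt0//.
  apply: le_trans (quad h) _; rewrite -real_normK ?num_real// expr2 ler_pM2l ?normr_gt0//.
  by near: h; apply: dnbhs0_le.
split; first exact/cvg_ex/(ex_intro _ (pos x)).
by apply/cvg_lim.
Unshelve. all: by end_near.
Qed.
End hinge.

Section states.
Context {R : realType} {A : Type} (good : set A).
Implicit Types (E : (A -> R) -> R) (f g : A -> R).

                                                                         
                                                                          
(** A finitely additive probability concentrated on [good], given by its expectation on all
    functions, so that no measurability or integrability condition arises. *)
Definition is_state E :=
  [/\ forall f g, E (fun a => f a + g a) = E f + E g,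
      forall c f, E (fun a => c * f a) = c * E f,
      forall f, (forall a, good a -> 0 <= f a) -> 0 <= E f &
      E (fun=> 1) = 1].

Lemma state_pt a : good a -> is_state (fun f => f a).
Proof. by move=> ga; split=> // f; apply. Qed.

Lemma state_le E f g : is_state E -> (forall a, good a -> f a <= g a) -> E f <= E g.
Proof.
move=> [ED EZ E0 _] fg; have := E0 (fun a => g a + (-1) * f a).
rewrite ED EZ mulN1r subr_ge0; apply => a ga.
by rewrite mulN1r subr_ge0 fg.
Qed.

Lemma state_cst E c : is_state E -> E (fun=> c) = c.
Proof.
move=> [_ EZ _ E1]; by have := EZ c (fun=> 1); rewrite E1 mulr1.
Qed.

Lemma state_sum E (J : Type) (r : seq J) (P : pred J) (F : J -> A -> R) : is_state E ->
  E (fun a => \sum_(j <- r | P j) F j a) = \sum_(j <- r | P j) E (F j).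
Proof.
move=> sE; have [ED EZ E0 _] := sE; elim: r => [|j r IH].
  by under eq_fun do rewrite big_nil; rewrite big_nil (state_cst _ sE).
under eq_fun do rewrite big_cons; rewrite big_cons; case: (P j) => //.
by rewrite ED IH.
Qed.

Lemma state_convex E E' (t : R) : is_state E -> is_state E' -> 0 <= t <= 1 ->
  is_state (fun f => E f + t * (E' f - E f)).
Proof.
move=> [ED EZ E0 E1] [ED' EZ' E0' E1'] /andP[t0 t1]; split.
- by move=> f g; rewrite ED ED'; ring.
- by move=> c f; rewrite EZ EZ'; ring.
- move=> f f0; have := E0 f f0; have := E0' f f0 => h' h.
  have -> : E f + t * (E' f - E f) = (1 - t) * E f + t * E' f by ring.
  by rewrite addr_ge0// mulr_ge0// subr_ge0.
- by rewrite E1 E1' subrr mulr0 addr0.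
Qed.
End states.

(** Among the [n] cyclic shifts every pair of a function and a point is matched exactly once. This
    replaces coordinate-dependent test functions by their sum. *)
Lemma sum_shifts (R : realType) n (F : 'I_n -> R -> R) (x : 'I_n -> R) (c : R) :
  (forall sg : {perm 'I_n}, c <= \sum_i F i (x (sg i))) ->
  n%:R * c <= \sum_j \sum_i F i (x j).
Proof.
case: n F x => [|n] F x H; first by rewrite mul0r big_ord0.
have -> : \sum_j \sum_i F i (x j) = \sum_(r < n.+1) \sum_i F i (x (i + r)).
  rewrite exchange_big [RHS]exchange_big/=; apply: eq_bigr => i _.
  exact: (reindex_inj (addrI i)).
rewrite mulr_natl -[X in _ *+ X]card_ord -sumr_const; apply: ler_sum => r _.
apply: le_trans (H (perm (addIr r))) _.
by apply: ler_sum => i _; rewrite permE.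
Qed.

Section finite_approximation.
Context {R : realType} {K : finType} (s p : K -> R) (n N : nat) (t : 'I_N -> R).

Let A : Type := (K * ('I_n -> R))%type.

Definition good_config : set A :=
  [set a | (forall i, 0 <= a.2 i <= 1) /\ \sum_i a.2 i = n%:R * s a.1].

Let J : finType := ('I_n * 'I_N + K)%type.
Let stat_fun (j : J) (a : A) : R :=
  match j with inl ij => pos (a.2 ij.1 - t ij.2) | inr k => (a.1 == k)%:R end.
Let target (j : J) : R :=
  match j with inl ij => (1 - t ij.2) ^+ 2 / 2 | inr k => p k end.

(** The vectors of expectations of [stat_fun] under states form a bounded convex set, so only
    separating functionals need be examined. Coefficients [c] and a level [g] give $\phi=\sum
    c_{ij}(\cdot-t_j)^+$ and $\psi_k=g-c_k$: since good configurations are stable under permuting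
    coordinates, [sum_shifts] yields the hypothesis of [dual_bound]. The targets $(1-t)^2/2$ are the
    expectations of $(U-t)^+$ for $U$ uniform on $[0,1]$. *)
Lemma state_approx (e : R) : (3 <= n)%N -> (forall j, 0 <= t j <= 1) ->
  cxblock s 0 1 p -> 0 < e ->
  exists E : (A -> R) -> R, [/\ is_state good_config E,
    forall i j, `|E (fun a => pos (a.2 i - t j)) - (1 - t j) ^+ 2 / 2| <= e &
    forall k, `|E (fun a => (a.1 == k)%:R) - p k| <= e].
Proof.
move=> n3 t01 cx e0.
pose C := [set x : J -> R | exists2 E, is_state good_config E & x = fun j => E (stat_fun j)].
have stat01 E j : is_state good_config E -> 0 <= E (stat_fun j) <= 1.
  move=> sE; have [_ _ E0 _] := sE; apply/andP; split.
    by apply: E0 => a ga; case: j => [[i j]|k] /=; [exact: pos_ge0|rewrite ler0n].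
  rewrite -(state_cst 1 sE); apply: (state_le sE) => a [a01 _].
  case: j => [[i j]|k] /=; last by case: (_ == _).
  rewrite -[leRHS](pos_id (ler01 : (0 : R) <= 1)); apply: pos_homo.
  by have /andP[_ ?] := a01 i; have /andP[? _] := t01 j; lra.
have sqe0 : 0 < e ^+ 2 by rewrite exprn_gt0.
have [|||c g Hc|x [E sE ->] xe] := @approx_of_separation R J C target #|J|%:R _ _ _ _ (e ^+ 2) sqe0.
- have [k kp] := block_mass_pos (ltr01 : (0 : R) < 1) cx.
  have /andP[s0 s1] : 0 < s k < 1.
    by apply: cxblock_supp cx _ => //; move: kp; rewrite inE.
  exists (fun j => stat_fun j (k, fun=> s k)), (fun f => f (k, fun=> s k)) => //.
  apply: state_pt; split => /=; first by move=> i; rewrite (ltW s0) ltW.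
  by rewrite sumr_const card_ord mulr_natl.
- move=> x y u [E sE ->] [E' sE' ->] u01.
  by exists (fun f => E f + u * (E' f - E f)) => //; exact: state_convex.
- move=> x y [E sE ->] [E' sE' ->].
  rewrite -sum1_card natr_sum; apply: ler_sum => j _.
  by have /andP[? ?] := stat01 E j sE; have /andP[? ?] := stat01 E' j sE'; nra.
- pose phi (y : R) := \sum_(ij : 'I_n * 'I_N) c (inl ij) * pos (y - t ij.2).
  pose Phi (y : R) := \sum_(ij : 'I_n * 'I_N) c (inl ij) * (pos (y - t ij.2) ^+ 2 / 2).
  have cphi : continuous phi.
    apply: continuous_big => [|i _ x]; first exact: add_continuous.
    by apply: cvgM; [exact: cvg_cst|exact: continuous_pos_shift].
  have dPhi (x : R) : is_derive x 1 Phi (phi x).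
    pose F (ij : 'I_n * 'I_N) (y : R) := c (inl ij) * (pos (y - t ij.2) ^+ 2 / 2).
    pose dF (ij : 'I_n * 'I_N) (y : R) := c (inl ij) * pos (y - t ij.2).
    apply: (@is_derive_bigsum R _ _ xpredT F dF) => ij.
    apply: is_derive_scale.
    have := is_derive_affine (- t ij.2) 1 x (@is_derive_pos2 R).
    by rewrite mulr1 mul1r [- _ + x]addrC; under eq_fun do rewrite mul1r addrC.
  have Hpt a : good_config a -> g <= \sum_(ij : 'I_n * 'I_N) c (inl ij) * pos (a.2 ij.1 - t ij.2) + c (inr a.1).
    move=> ga; have := Hc (fun j => stat_fun j a) _.
    case/(_ _)/wrap; first by exists (fun f => f a) => //; exact: state_pt.
    rewrite big_sumType/= [X in _ + X](bigD1 a.1)//= eqxx mulr1 [X in _ + (_ + X)]big1 ?addr0// => k.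
    by rewrite eq_sym => /negbTE ->; rewrite mulr0.
  have Hpsi k (x : 'I_n -> R) : (forall j, 0 <= x j <= 1) ->
     \sum_j x j = n%:R * s k -> n%:R * (g - c (inr k)) <= \sum_j phi (x j).
    move=> x01 sx; rewrite /phi.
    have -> : \sum_j \sum_(ij : 'I_n * 'I_N) c (inl ij) * pos (x j - t ij.2) =
        \sum_j \sum_i \sum_l c (inl (i, l)) * pos (x j - t l).
      by apply: eq_bigr => j _; rewrite pair_bigA; apply: eq_bigr => -[].
    apply: (@sum_shifts R n (fun i y => \sum_l c (inl (i, l)) * pos (y - t l))) => sg.
    rewrite lerBlDr; apply: le_trans (Hpt (k, fun i => x (sg i)) _) _.
      by split => //=; rewrite -sx [RHS](reindex_inj (@perm_inj _ sg)).
    by rewrite /= lerD2r pair_bigA; apply: ler_sum => -[].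
  have [_ p1 _ _] := cx.
  have := dual_bound n3 cphi dPhi Hpsi (lexx 0) ltr01 (lexx 1) cx.
  have -> : Phi 0 = 0.
    apply: big1 => ij _; rewrite pos_eq0 ?expr0n/= ?mul0r ?mulr0//.
    by have /andP[? _] := t01 ij.2; lra.
  under eq_bigr do rewrite mulrBr; rewrite sumrB -mulr_suml p1 !subr0 mul1r lerBlDr.
  move/le_trans; apply.
  rewrite big_sumType/=; apply: lerD.
    apply: ler_sum => ij _; rewrite pos_id//.
    by have /andP[_ ?] := t01 ij.2; lra.
  by apply: ler_sum => k _; rewrite mulrC.
have ae (j : J) : `|E (stat_fun j) - target j| <= e.
  rewrite -(@ler_pXn2r _ 2) ?nnegrE//; last exact: ltW.
  rewrite real_normK ?num_real//; apply: le_trans (ltW xe).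
  rewrite (bigD1 j)//= lerDl; apply: sumr_ge0 => i _; exact: sqr_ge0.
exists E; split => //.
- by move=> i j; have := ae (inl (i, j)).
- by move=> k; have := ae (inr k).
Qed.
End finite_approximation.

                                         

(** * Subdivision of an atomless probability space *)

Section real_probability.
Context {R : realType} d {T : measurableType d} (P : probability T R).
Implicit Types A B C : set T.

Definition pr A : R := fine (P A).

Lemma prE A : measurable A -> P A = (pr A)%:E.
Proof. by move=> mA; rewrite fineK// fin_num_measure. Qed.

Lemma pr_ge0 A : 0 <= pr A.
Proof. by apply: fine_ge0; exact: measure_ge0. Qed.

Lemma pr_set0 : pr set0 = 0. Proof. by rewrite /pr measure0. Qed.

Lemma pr_setT : pr setT = 1. Proof. by rewrite /pr probability_setT. Qed.

Lemma pr_le A B : measurable A -> measurable B -> A `<=` B -> pr A <= pr B.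
Proof.
move=> mA mB AB; rewrite -lee_fin -!prE//.
by apply: le_measure; rewrite ?inE.
Qed.

Lemma pr_le1 A : measurable A -> pr A <= 1.
Proof. by move=> mA; rewrite -pr_setT; apply: pr_le. Qed.

Lemma prU A B : measurable A -> measurable B -> A `&` B = set0 ->
  pr (A `|` B) = pr A + pr B.
Proof.
move=> mA mB AB; apply: EFin_inj.
by rewrite EFinD -!prE//; [exact: measureU|exact: measurableU].
Qed.

Lemma prD A B : measurable A -> measurable B -> B `<=` A ->
  pr (A `\` B) = pr A - pr B.
Proof.
move=> mA mB BA; have := @prU B (A `\` B) mB (measurableD mA mB) (setDIK _ _).
by rewrite setDUK// => ->; rewrite addrC addKr.
Qed.

Lemma pr_bigcup_le (B : (set T)^nat) (t : R) : (forall i, measurable (B i)) ->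
  (forall i j, (i <= j)%N -> B i `<=` B j) -> (forall i, pr (B i) <= t) ->
  pr (\bigcup_i B i) <= t.
Proof.
move=> mB ndB Bt; have mU : measurable (\bigcup_i B i) by exact: bigcup_measurable.
have ndB' : {homo B : i j / (i <= j)%N >-> (i <= j)%O}.
  by move=> i j ij; apply/subsetPset; exact: ndB.
have := nondecreasing_cvg_mu (mu := P) mB mU ndB'.
rewrite -lee_fin -prE// => /cvg_lim <-//.
apply: lime_le; last by near=> i; rewrite /= prE// lee_fin.
by apply: ereal_nondecreasing_is_cvgn => i j ij; apply: le_measure; rewrite ?inE//; exact: ndB.
Unshelve. all: by end_near.
Qed.

Hypothesis P_atomless : atomless P.

Lemma small_subset A (e : R) : measurable A -> 0 < pr A -> 0 < e ->
  exists B, [/\ measurable B, B `<=` A & 0 < pr B < e].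
Proof.
move=> mA A0 e0.
have half C : measurable C -> 0 < pr C ->
    exists B, [/\ measurable B, B `<=` C & 0 < pr B <= pr C / 2].
  move=> mC C0; have [|B [mB BC]] := P_atomless mC; first by rewrite prE// lte_fin.
  rewrite !prE// !lte_fin => /andP[B0 BC'].
  have [h|h] := leP (pr B) (pr C / 2); first by exists B; rewrite B0.
  exists (C `\` B); rewrite prD//; split; [exact: measurableD|exact: subDsetl|].
  by apply/andP; split; lra.
have iter k : exists B, [/\ measurable B, B `<=` A & 0 < pr B <= pr A / 2 ^+ k].
  elim: k => [|k [B [mB BA /andP[B0 Bk]]]].
    by exists A; split => //; rewrite expr0 divr1 A0 lexx.
  have [C [mC CB /andP[C0 CB']]] := half B mB B0.
  exists C; split => //; first exact: subset_trans BA.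
  rewrite C0 (le_trans CB')//= exprS invfM mulrA [leRHS]mulrAC ler_pM2r ?invr_gt0//.
pose k := Num.truncn (pr A / e).
have [B [mB BA /andP[B0 Bk]]] := iter k.+1.
exists B; split => //; rewrite B0 (le_lt_trans Bk)//.
rewrite ltr_pdivrMr ?exprn_gt0// mulrC -ltr_pdivrMr//.
apply: lt_le_trans (truncnS_gt _) _; rewrite -/k -natrX ler_nat.
exact: ltnW (ltn_expl _ _).
Qed.

                                                                              
                      
(** Sierpinski's theorem by a greedy exhaustion: each step adjoins a set of at least half the
    largest probability that still fits. If the union fell short of [t], a small piece of the
    remainder would fit at every step, so each step would add at least half its probability and the
    total would exceed 1. *)
Lemma subset_of_prob A (t : R) : measurable A -> 0 <= t <= pr A ->
  exists B, [/\ measurable B, B `<=` A & pr B = t].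
Proof.
move=> mA /andP[t0 tA].
pose fits B := [set C | [/\ measurable C, C `<=` A `\` B & pr B + pr C <= t]].
pose ok B := [/\ measurable B, B `<=` A & pr B <= t].
have next B : exists C, ok B -> fits B C /\ (forall C', fits B C' -> pr C' <= 2 * pr C).
  have [okB|nok] := pselect (ok B); last by exists set0.
  have [mB BA Bt] := okB.
  pose S := [set pr C | C in fits B].
  have f0 : fits B set0 by split => //; rewrite pr_set0 addr0.
  have hS : has_sup S.
    split; first by exists (pr set0), set0.
    by exists 1 => _ [C [mC _ _] <-]; exact: pr_le1.
  have [s0|s0] := leP (sup S) 0.
    exists set0 => _; split => // C' fC'; rewrite pr_set0 mulr0 (le_trans _ s0)//.
    by apply: (sup_upper_bound hS); exists C'.
    have s2 : 0 < sup S / 2 by rewrite divr_gt0.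
    have [_ [C fC <-] hC] := sup_adherent s2 hS.
  exists C => _; split => // C' fC'.
  have : pr C' <= sup S by apply: (sup_upper_bound hS); exists C'.
  by lra.
have [f Hf] := choice next.
pose B k := iter k (fun B => B `|` f B) set0.
have okB k : ok (B k).
  elim: k => [|k okBk]; first by split => //=; rewrite pr_set0.
  have [[mC CA Ct] _] := Hf _ okBk; have [mB BA _] := okBk.
  split => /=; first exact: measurableU.
    by rewrite subUset; split => //; apply: subset_trans CA _; exact: subDsetl.
  rewrite prU//; apply/seteqP; split => // x [Bx Cx].
  by have [_] := CA _ Cx.
have ndB i j : (i <= j)%N -> B i `<=` B j.
  move=> /subnK <-; elim: (j - i)%N => // k IH.
  by rewrite addSn /= => x Bx; left; exact: IH.
have mB k : measurable (B k) by have [] := okB k.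
have mU : measurable (\bigcup_k B k) by exact: bigcup_measurable.
have UA : \bigcup_k B k `<=` A by apply: bigcup_sub => k _; have [] := okB k.
exists (\bigcup_k B k); split => //.
have Ut : pr (\bigcup_k B k) <= t by apply: pr_bigcup_le => // k; have [] := okB k.
apply/eqP; rewrite eq_le Ut/= leNgt; apply/negP => Ut'.
have AU : 0 < pr (A `\` \bigcup_k B k) by rewrite prD// subr_gt0; lra.
have tU : 0 < t - pr (\bigcup_k B k) by lra.
have [C [mC CAU /andP[C0 CU]]] := small_subset (measurableD mA mU) AU tU.
have fitC k : fits (B k) C.
  split => //; first by move=> x /CAU [Ax nU]; split => // Bx; apply: nU; exists k.
  have : pr (B k) <= pr (\bigcup_k B k) by apply: pr_le => //; exact: bigcup_sup.
  by lra.
have grow k : k%:R * (pr C / 2) <= pr (B k).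
  elim: k => [|k IH]; first by rewrite mul0r pr_ge0.
  have [[mf fA _] fmax] := Hf _ (okB k).
  rewrite /= prU//; last first.
    by apply/seteqP; split => // x [Bx Cx]; have [_] := fA _ Cx.
  have := fmax _ (fitC k); rewrite -[k.+1%:R]natr1; lra.
pose k := (Num.truncn (2 / pr C)).+1.
have : 1 < k%:R * (pr C / 2).
  have : 2 / pr C < k%:R by exact: truncnS_gt.
  by rewrite ltr_pdivrMr//; lra.
by have := grow k; have := pr_le1 (mB k); lra.
Qed.

Lemma partition_of_prob {D : finType} (d0 : D) A (w : D -> R) : measurable A ->
  (forall x, 0 <= w x) -> \sum_x w x = pr A ->
  exists h : T -> D, (forall x, measurable [set u | h u = x]) /\
    (forall x, pr (A `&` [set u | h u = x]) = w x).
Proof.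
move=> mA w0 wA.
have part (r : seq D) B : uniq (d0 :: r) -> measurable B ->
  \sum_(x <- d0 :: r) w x = pr B ->
  exists h : T -> D, [/\ forall x, measurable [set u | h u = x],
    forall u, h u \in d0 :: r &
    forall x, x \in d0 :: r -> pr (B `&` [set u | h u = x]) = w x].
  elim: r B => [|x r IH] B ur mB sB.
    exists (fun=> d0); split => [x|u|x].
    - have [->|ne] := eqVneq d0 x.
        by rewrite (_ : [set u | x = x] = setT)//; apply/seteqP; split.
      rewrite (_ : [set u | d0 = x] = set0)//.
      by apply/seteqP; split => // u /= e; rewrite e eqxx in ne.
    - by rewrite inE.
    - rewrite inE => /eqP ->; rewrite (_ : [set u | d0 = d0] = setT).
        by rewrite setIT -sB big_seq1.
      by apply/seteqP; split.
  have ur' : uniq (d0 :: r).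
    by move: ur; rewrite /= inE negb_or => /andP[/andP[_ ->] /andP[_ ->]].
  have xr : x \notin d0 :: r.
    move: ur; rewrite /= !inE !negb_or eq_sym => /andP[/andP[-> _] /andP[-> _]]//.
  have sB' : w x + \sum_(y <- d0 :: r) w y = pr B.
    by rewrite -sB !big_cons addrCA.
  have wx : 0 <= w x <= pr B.
    by rewrite w0 -sB' lerDl sumr_ge0.
  have [C [mC CB prC]] := subset_of_prob mB wx.
  have [|h [mh hr ph]] := IH (B `\` C) ur' (measurableD mB mC).
    by rewrite prD// prC -sB' [w x + _]addrC addrK.
  pose h' u := if u \in C then x else h u.
  have h'E y : y != x -> [set u | h' u = y] = [set u | h u = y] `\` C.
    move=> yx; apply/seteqP; split => u; rewrite /h'/=.
      by case: ifPn => [_ e|]; [rewrite e eqxx in yx|rewrite notin_setE].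
    by move=> [hy Cu]; rewrite memNset.
  have h'x : [set u | h' u = x] = C.
    apply/seteqP; split => u; rewrite /h'/=; last by move=> Cu; rewrite mem_set.
    case: ifPn => [/set_mem//|_ e]; by move: xr; rewrite -e hr.
  exists h'; split => [y|u|y].
  - have [->|yx] := eqVneq y x; first by rewrite h'x.
    by rewrite h'E//; exact: measurableD.
  - by rewrite /h'; case: ifP => _; rewrite !inE ?eqxx ?orbT//; have := hr u; rewrite inE => /orP[->|->]; rewrite ?orbT.
  - have [-> _|yx] := eqVneq y x; first by rewrite h'x setIC setIidl.
    rewrite !inE (negbTE yx)/= => yr; rewrite h'E// -(ph y) ?inE//; congr pr.
    by apply/seteqP; split => u /=; tauto.
have [||h [mh _ ph]] := part (rem d0 (enum D)) A _ mA.
- by rewrite /= mem_rem_uniq ?enum_uniq// inE eqxx/= rem_uniq ?enum_uniq.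
- rewrite -wA (perm_big (enum D)) ?big_enum//.
  by rewrite perm_sym perm_to_rem// mem_enum.
exists h; split => // x; apply: ph.
by rewrite -(perm_mem (perm_to_rem (_ : d0 \in enum D))) mem_enum.
Qed.
End real_probability.

(** * Limits of states and their realization by random variables *)

Section limit_state.
Context {R : realType} {A : Type} (good : set A).
Implicit Types f g : A -> R.

Definition bounded_on_good f := exists M : R, forall a, good a -> `|f a| <= M.

Lemma bounded_sum (J : Type) (r : seq J) (P : pred J) (F : J -> A -> R) :
  (forall j, bounded_on_good (F j)) ->
  bounded_on_good (fun a => \sum_(j <- r | P j) F j a).
Proof.
move=> bF; elim: r => [|j r [M IH]].
  by exists 0 => a _; rewrite big_nil normr0.
have [M' HM'] := bF j; exists (M' + `|M|) => a ga; rewrite big_cons.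
have M0 : `|\sum_(j <- r | P j) F j a| <= `|M| := le_trans (IH a ga) (ler_norm _).
have h := HM' a ga; case: (P j); first exact: le_trans (ler_normD _ _) (lerD h M0).
by rewrite (le_trans M0)// lerDr (le_trans (normr_ge0 _) h).
Qed.

                                                                       
                             
(** The limit along a free ultrafilter; for a function bounded on [good] the expectations stay in a
    compact interval, hence converge, and bounds holding eventually persist. *)
Lemma limit_state (E : nat -> (A -> R) -> R) : (forall m, is_state good (E m)) ->
  exists L : (A -> R) -> R,
  [/\ forall f g, bounded_on_good f -> bounded_on_good g ->
        L (fun a => f a + g a) = L f + L g,
      forall f (r : R), bounded_on_good f -> (\forall m \near \oo, E m f <= r) -> L f <= r &
      forall f (r : R), bounded_on_good f -> (\forall m \near \oo, r <= E m f) -> r <= L f].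
Proof.
move=> sE; have [U [uU ooU]] := ultraFilterLemma eventually_filter.
have cvgU f : bounded_on_good f -> cvg (E m f @[m --> U]).
  move=> [M HM].
  have uFU : UltraFilter (E m f @[m --> U]).
    apply: Build_UltraFilter => G pG sub.
    apply/seteqP; split=> // S GS.
    have [//|US] := in_ultra_setVsetC ((fun m => E m f) @^-1` S) uU.
    have GC : G (~` S) by apply: sub.
    by have := @filter_not_empty _ G pG; case; rewrite -(setICr S); exact: filterI.
  have := @segment_compact R (- M) M; rewrite compact_ultra.
  move=> /(_ _ uFU)[|l [_ El]]; last by apply/cvg_ex; exists l.
  suff K m : `[- M, M]%classic (E m f) by exact: (@filterE _ U _ _ K).
  rewrite /= in_itv/=.
  by rewrite -(state_cst (- M) (sE m)) -{2}(state_cst M (sE m)); apply/andP; split;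
    apply: (state_le (sE m)) => a /HM; rewrite ler_norml => /andP[].
exists (fun f => lim (E m f @[m --> U])); split.
- move=> f g bf bg; rewrite -limD; [|exact: cvgU..].
  by congr (lim (_ @ U)); apply/funext => m; have [-> _ _ _] := sE m.
- by move=> f r bf h; apply: limr_le; [exact: cvgU|exact: ooU].
- by move=> f r bf h; apply: limr_ge; [exact: cvgU|exact: ooU].
Qed.
End limit_state.

Section code_tree.
Context {R : realType} d {T : measurableType d} (P : probability T R).
Hypothesis P_atomless : atomless P.

(** Realizes consistent cylinder masses directly, by splitting every cell into pieces of the
    prescribed probabilities, generation after generation. Words grow at the head: [x :: c] is a
    child of [c]. *)
Lemma code_tree {D : finType} (d0 : D) (Q : seq D -> R) : Q [::] = 1 ->
  (forall c, 0 <= Q c) -> (forall c, \sum_x Q (x :: c) = Q c) ->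
  exists code : nat -> T -> seq D,
  [/\ forall u, code 0 u = [::],
      forall l u, exists x, code l.+1 u = x :: code l u,
      forall c, measurable [set u | code (size c) u = c] &
      forall c, pr P [set u | code (size c) u = c] = Q c].
Proof.
move=> Q1 Q0 QS.
have [h Hh] : {h : set T * (D -> R) -> T -> D & forall Aw, measurable Aw.1 ->
    (forall x, 0 <= Aw.2 x) -> \sum_x Aw.2 x = pr P Aw.1 ->
    (forall x, measurable [set u | h Aw u = x]) /\
    (forall x, pr P (Aw.1 `&` [set u | h Aw u = x]) = Aw.2 x)}.
  apply: (@choice _ _ (fun (Aw : set T * (D -> R)) h => measurable Aw.1 ->
    (forall x, 0 <= Aw.2 x) -> \sum_x Aw.2 x = pr P Aw.1 ->
    (forall x, measurable [set u | h u = x]) /\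
    (forall x, pr P (Aw.1 `&` [set u | h u = x]) = Aw.2 x))) => -[A w]/=.
  have [[mA w0 wA]|no] := pselect [/\ measurable A, forall x, 0 <= w x & \sum_x w x = pr P A].
    by have [h Hh] := partition_of_prob P_atomless d0 mA w0 wA; exists h.
  by exists (fun=> d0) => mA w0 wA; exfalso; exact: no.
(* The splitting function depends on [u] only through its cell, so all points of a cell use the same
   partition. *)
pose step (f : T -> seq D) u := h ([set v | f v = f u], fun x => Q (x :: f u)) u :: f u.
pose code l := iter l step (fun=> [::]).
have szcode l u : size (code l u) = l by elim: l => //= l ->.
have key l c : size c = l -> measurable [set u | code l u = c] /\
    pr P [set u | code l u = c] = Q c.
  elim: l c => [|l IH] [|x c]//=.
    move=> _; rewrite (_ : [set u | _] = setT) ?pr_setT//.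
    by apply/seteqP; split.
  move=> [/IH[mc pc]].
  have -> : [set u | step (code l) u = x :: c] = [set u | code l u = c] `&`
     [set u | h ([set u | code l u = c], fun x => Q (x :: c)) u = x].
    apply/seteqP; split => u; rewrite /step/=; first by move=> [+ e]; rewrite e.
    by move=> [e]; rewrite e => ->.
  have [mh ph] := Hh ([set u | code l u = c], fun x => Q (x :: c)) mc
     (fun x => Q0 (x :: c)) (etrans (QS c) (esym pc)).
  by split; [exact: measurableI|exact: ph].
exists code; split => // [l u|c|c].
- by eexists; rewrite /code/= /step.
- by have [] := key _ c erefl.
- by have [] := key _ c erefl.
Qed.
End code_tree.

Section binary_codes.
Context {R : realType} {n : nat}.
Let D : finType := {ffun 'I_n -> bool}.
Implicit Types (c : seq D) (x : 'I_n -> R).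

                                                                              
            
(** Left end, in coordinate [i], of the dyadic cube coded by [c]; the head of the word is the finest
    binary digit. *)
Fixpoint lft c (i : 'I_n) : R :=
  if c is b :: c' then lft c' i + (b i)%:R * (2 ^+ (size c').+1)^-1 else 0.

Definition ccode l x : seq D :=
  iter l (fun c => [ffun i => lft c i + (2 ^+ (size c).+1)^-1 <= x i] :: c) [::].

Lemma size_ccode l x : size (ccode l x) = l.
Proof. by elim: l => //= l ->. Qed.

Lemma half_pow l : (2 ^+ l)^-1 = (2 ^+ l.+1)^-1 + (2 ^+ l.+1)^-1 :> R.
Proof. by rewrite exprS invfM; field; rewrite expf_neq0. Qed.

Lemma ccode_bounds l x i : 0 <= x i <= 1 ->
  lft (ccode l x) i <= x i <= lft (ccode l x) i + (2 ^+ l)^-1.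
Proof.
move=> /andP[x0 x1]; elim: l => [|l /andP[IH1 IH2]].
  by rewrite /= expr0 invr1 add0r x0.
rewrite [ccode _ _]/= -/(ccode l x) /= size_ccode ffunE.
rewrite (half_pow l) in IH2.
have [h|h] := leP (lft (ccode l x) i + (2 ^+ l.+1)^-1) (x i).
  by rewrite mul1r; apply/andP; split; lra.
by rewrite mul0r addr0; apply/andP; split; lra.
Qed.

Lemma pow_small (e : R) : 0 < e -> exists l, n%:R * (2 ^+ l)^-1 <= e.
Proof.
move=> e0; exists (Num.truncn (n%:R / e)).+1.
set k := _.+1; rewrite ler_pdivrMr ?exprn_gt0// mulrC -ler_pdivrMr//.
apply: le_trans (ltW (truncnS_gt _)) _; rewrite -natrX ler_nat.
exact: ltnW (ltn_expl _ _).
Qed.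
End binary_codes.

Section realization.
Context {R : realType} d {T : measurableType d} (P : probability T R).
Hypothesis P_atomless : atomless P.
Variable n : nat.
Let D : finType := {ffun 'I_n -> bool}.

Definition cube : set ('I_n -> R) := [set x | forall i, 0 <= x i <= 1].

Variable E : nat -> (('I_n -> R) -> R) -> R.
Hypothesis sE : forall m, is_state cube (E m).

Let psum (S : pred 'I_n) (x : 'I_n -> R) : R := \sum_(i | S i) x i.

(** The ultrafilter limit prescribes the masses of dyadic cubes, and [X i] is the limit of the left
    ends along the resulting tree. Since [X i] stays within $2^{-l}$ of its left end of generation
    $l$, the law of a partial sum is squeezed between values of [F] at nearby points. The index set
    [S] is arbitrary so as to cover both single coordinates and the full sum. *)
Lemma realize_limit : exists X : 'I_n -> T -> R,
  [/\ forall i, measurable_fun setT (X i), forall i u, 0 <= X i u <= 1 &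
  forall (S : pred 'I_n) (F : R -> R),
    (forall s t, s <= t -> F s <= F t) ->
    (forall t e, 0 < e -> exists2 e', 0 < e' & F (t + e') <= F t + e) ->
    (forall t e, 0 < e -> \forall m \near \oo,
       F (t - e) - e <= E m (fun x => (\sum_(i | S i) x i <= t)%R%:R) <= F (t + e) + e) ->
    forall t, pr P [set u | \sum_(i | S i) X i u <= t] = F t].
Proof.
have [L [LD Lle Lge]] := limit_state sE.
have bb (B : ('I_n -> R) -> bool) : bounded_on_good cube (fun x => (B x)%:R : R).
  by exists 1 => a _; case: (B a); rewrite ?normr1 ?normr0.
have LB_le (B : ('I_n -> R) -> bool) (r : R) :
    (\forall m \near \oo, E m (fun x => (B x)%:R) <= r) -> L (fun x => (B x)%:R) <= r.
  exact: Lle.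
have LB_ge (B : ('I_n -> R) -> bool) (r : R) :
    (\forall m \near \oo, r <= E m (fun x => (B x)%:R)) -> r <= L (fun x => (B x)%:R).
  exact: Lge.
have L1 : L (fun=> 1) = 1.
  apply: le_anti; apply/andP; split.
    by apply: (LB_le xpredT); near=> m; rewrite (state_cst _ (sE m)).
  by apply: (LB_ge xpredT); near=> m; rewrite (state_cst _ (sE m)).
have L0 : L (fun=> 0) = 0.
  apply: le_anti; apply/andP; split.
    by apply: (LB_le xpred0); near=> m; rewrite (state_cst _ (sE m)).
  by apply: (LB_ge xpred0); near=> m; rewrite (state_cst _ (sE m)).
have Lsum (J : Type) (r : seq J) (B : J -> ('I_n -> R) -> bool) :
    L (fun x => \sum_(j <- r) (B j x)%:R) = \sum_(j <- r) L (fun x => (B j x)%:R).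
  elim: r => [|j r IH].
    by rewrite big_nil -[RHS]L0; congr L; apply/funext => x; rewrite big_nil.
  rewrite big_cons -IH -LD//; last exact: bounded_sum.
  by congr L; apply/funext => x; rewrite big_cons.
pose Q (c : seq D) := L (fun x => (ccode (size c) x == c)%:R).
have Q1 : Q [::] = 1 by rewrite -[RHS]L1.
have Q0 c : 0 <= Q c.
  apply: (LB_ge (fun x => ccode (size c) x == c)); near=> m.
  by have [_ _ E0 _] := sE m; apply: E0 => x _; rewrite ler0n.
have QS c : \sum_b Q (b :: c) = Q c.
  rewrite /Q -Lsum; congr L; apply/funext => x /=; rewrite -/(ccode (size c) x).
  set b0 := finfun _; rewrite (bigD1 b0)//= big1 ?addr0; first by rewrite eqseq_cons eqxx.
  by move=> b bb0; rewrite eqseq_cons eq_sym (negbTE bb0).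
have [code [code0 codeS mcode pcode]] := code_tree P_atomless [ffun=> false] Q1 Q0 QS.
have szcode l u : size (code l u) = l.
  by elim: l => [|l IH]; [rewrite code0|have [b ->] := codeS l u; rewrite /= IH].
have list_event l (s : seq (seq D)) : uniq s -> all (fun c => size c == l) s ->
    measurable [set u | code l u \in s] /\
    pr P [set u | code l u \in s] = L (fun x => (ccode l x \in s)%:R).
  elim: s => [_ _|c s IH /= /andP[cs us] /andP[/eqP cl sl]].
    rewrite (_ : [set u | _] = set0); first by split=> //; rewrite pr_set0 -[LHS]L0.
    by apply/seteqP; split.
  have [ms ps] := IH us sl.
  have -> : [set u | code l u \in c :: s] =
      [set u | code (size c) u = c] `|` [set u | code l u \in s].
    apply/seteqP; split => u /=; rewrite inE cl.
      by move=> /orP[/eqP|]; [left|right].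
    by move=> [->|->]; rewrite ?eqxx ?orbT.
  split; first exact: measurableU.
  rewrite prU//; last first.
    by apply/seteqP; split => // u /=; rewrite cl => -[->]; rewrite (negbTE cs).
  rewrite pcode ps /Q -LD//; congr L; apply/funext => x; rewrite inE cl.
  by have [->|_] := eqVneq (ccode l x) c; rewrite ?(negbTE cs) ?addr0 ?add0r.
(* [P] and the limit state agree on every event that depends only on the first [l] digits. *)
have event l (B : seq D -> bool) : measurable [set u | B (code l u)] /\
    pr P [set u | B (code l u)] = L (fun x => (B (ccode l x))%:R).
  pose s := [seq c <- [seq val c | c <- enum {: l.-tuple D}] | B c].
  have smem c : size c = l -> (c \in s) = B c.
    move=> cl; rewrite mem_filter; case: (B c) => //=.
    apply/mapP; exists (tcast cl (in_tuple c)); first by rewrite mem_enum.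
    by rewrite val_tcast.
  have us : uniq s by rewrite filter_uniq// map_inj_uniq ?enum_uniq//; exact: val_inj.
  have sl : all (fun c => size c == l) s.
    apply/allP => c; rewrite mem_filter => /andP[_ /mapP[c' _ ->]].
    by rewrite size_tuple.
  have := list_event l s us sl.
  rewrite (_ : [set u | code l u \in s] = [set u | B (code l u)]); last first.
    by apply/seteqP; split => u /=; rewrite smem.
  by rewrite (_ : (fun x => _) = (fun x => (B (ccode l x))%:R))//; apply/funext => x; rewrite smem ?size_ccode.
pose a i u l := lft (code l u) i : R.
have aS i u l : a i u l <= a i u l.+1 /\ a i u l.+1 + (2 ^+ l.+1)^-1 <= a i u l + (2 ^+ l)^-1.
  rewrite /a; have [b ->] := codeS l u; rewrite /= szcode (half_pow l).
  have h : 0 < (2 ^+ l.+1)^-1 :> R by rewrite invr_gt0 exprn_gt0.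
  by case: (b i); rewrite ?mul1r ?mul0r; lra.
have a_nd i u : nondecreasing_seq (a i u).
  by apply/nondecreasing_seqP => l; have [] := aS i u l.
have a_ub i u l l' : a i u l' <= a i u l + (2 ^+ l)^-1.
  have pw k : 0 <= (2 ^+ k)^-1 :> R by rewrite invr_ge0 exprn_ge0.
  have ni : forall k, a i u (l + k)%N + (2 ^+ (l + k)%N)^-1 <= a i u l + (2 ^+ l)^-1.
    elim => [|k IH]; first by rewrite addn0.
    by rewrite addnS; apply: le_trans IH; have [] := aS i u (l + k)%N.
  have [ll|ll] := leqP l l'.
    by have := ni (l' - l)%N; rewrite subnKC// => h; have := pw l'; lra.
  by apply: le_trans (a_nd i u _ _ (ltnW ll)) _; rewrite lerDl.
have a_cvg i u : cvgn (a i u).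
  apply: nondecreasing_is_cvgn => //; exists (a i u 0 + (2 ^+ 0)^-1) => _ [l _ <-].
  exact: a_ub.
pose X i u := limn (a i u).
have X_ge i u l : a i u l <= X i u by apply: nondecreasing_cvgn_le.
have X_le i u l : X i u <= a i u l + (2 ^+ l)^-1.
  by apply: limr_le => //; near=> l'; exact: a_ub.
have mX i : measurable_fun setT (X i).
  apply: (@measurable_fun_cvg _ _ _ _ (fun l u => a i u l)) => [l|u _]; last exact: a_cvg.
  move=> _ Y mY; rewrite setTI.
  have [+ _] := event l (fun c => `[< Y (lft c i) >]).
  rewrite (_ : [set u | _] = (a i ^~ l) @^-1` Y)//.
  by apply/seteqP; split => u /= /asboolP.
have mpX (S : pred 'I_n) : measurable_fun setT (fun u => psum S (fun i => X i u)).
  by rewrite /psum; under eq_fun do rewrite -big_filter; apply: measurable_sum => i; exact: mX.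
have mle S t : measurable [set u | psum S (fun i => X i u) <= t].
  rewrite (_ : [set u | _] = (fun u => psum S (fun i => X i u)) @^-1` `]-oo, t]).
    by rewrite -[Y in measurable Y]setTI; exact: mpX.
  by apply/seteqP; split => u /=; rewrite in_itv.
exists X; split => //.
  move=> i u; have := X_ge i u 0; have := X_le i u 0.
  by rewrite /a code0 /= expr0 invr1 add0r => -> ->.
move=> S F Fnd Frc FE t; rewrite -/(psum S (X^~ _)).
have Sle (x y : 'I_n -> R) (e : R) : 0 <= e -> (forall i, x i <= y i + e) ->
    psum S x <= psum S y + n%:R * e.
  move=> e0 xy; apply: (@le_trans _ _ (psum S y + \sum_(i | S i) e)).
    by rewrite /psum -big_split/=; apply: ler_sum => i _.
  rewrite lerD2l sumr_const -[e *+ _]mulr_natl ler_wpM2r// ler_nat.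
  by rewrite -[leqRHS](card_ord n) max_card.
have pw k : 0 <= (2 ^+ k)^-1 :> R by rewrite invr_ge0 exprn_ge0.
have lower s e : 0 < e -> F (s - e) - e <= pr P [set u | psum S (fun i => X i u) <= s].
  move=> e0; have e20 : 0 < e / 2 by rewrite divr_gt0.
  have [l hl] := pow_small (n := n) e20.
  have [mB pB] := event l (fun c => psum S (lft c) <= s - n%:R * (2 ^+ l)^-1).
  apply: (@le_trans _ _ (pr P [set u | psum S (lft (code l u)) <= s - n%:R * (2 ^+ l)^-1])).
    rewrite pB; apply: (LB_ge (fun x => psum S (lft (ccode l x)) <= s - n%:R * (2 ^+ l)^-1)).
    near=> m.
    have : F (s - n%:R * (2 ^+ l)^-1 - e / 2) - e / 2 <=
        E m (fun x => (psum S x <= s - n%:R * (2 ^+ l)^-1)%R%:R).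
      by near: m; apply: filterS (FE (s - n%:R * (2 ^+ l)^-1) _ e20) => m /andP[].
    have h : F (s - e) <= F (s - n%:R * (2 ^+ l)^-1 - e / 2) by apply: Fnd; move: hl; clear - P_atomless sE psum D; lra.
    have : E m (fun x => (psum S x <= s - n%:R * (2 ^+ l)^-1)%R%:R) <=
        E m (fun x => (psum S (lft (ccode l x)) <= s - n%:R * (2 ^+ l)^-1)%R%:R).
      apply: (state_le (sE m)) => x cx; rewrite ler_nat.
      case: leP => // hx; rewrite (_ : _ <= _)//; apply: le_trans hx.
      by apply: ler_sum => i _; have /andP[] := ccode_bounds l (cx i).
    by move: h e0; clear - P_atomless sE psum D; lra.
  apply: pr_le => // u /= hu.
  have := Sle (fun i => X i u) (lft (code l u)) _ (pw l) (fun i => X_le i u l).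
  by move: hu; clear - P_atomless sE psum D; lra.
have upper e : 0 < e -> pr P [set u | psum S (fun i => X i u) <= t] <= F t + e.
  move=> e0; have e20 : 0 < e / 2 by rewrite divr_gt0.
  have [e' e'0 he'] := Frc t _ e20.
  have e'20 : 0 < e' / 2 by rewrite divr_gt0.
  pose r := Num.min (e' / 2) (e / 2).
  have r0 : 0 < r by rewrite /r lt_min e'20.
  have re : r <= e / 2 by rewrite /r ge_min lexx orbT.
  have re' : r <= e' / 2 by rewrite /r ge_min lexx.
  have [l hl] := pow_small (n := n) e'20.
  have [mB pB] := event l (fun c => psum S (lft c) <= t).
  apply: (@le_trans _ _ (pr P [set u | psum S (lft (code l u)) <= t])).
    apply: pr_le => // u /=; apply: le_trans.
    by apply: ler_sum => i _; exact: X_ge.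
  rewrite pB; apply: (LB_le (fun x => psum S (lft (ccode l x)) <= t)).
  near=> m.
  have : E m (fun x => (psum S x <= t + n%:R * (2 ^+ l)^-1)%R%:R) <=
      F (t + n%:R * (2 ^+ l)^-1 + r) + r.
    by near: m; apply: filterS (FE (t + n%:R * (2 ^+ l)^-1) _ r0) => m /andP[].
  have h : F (t + n%:R * (2 ^+ l)^-1 + r) <= F (t + e').
    by apply: Fnd; move: hl re'; clear - P_atomless sE psum D; lra.
  have : E m (fun x => (psum S (lft (ccode l x)) <= t)%R%:R) <=
      E m (fun x => (psum S x <= t + n%:R * (2 ^+ l)^-1)%R%:R).
    apply: (state_le (sE m)) => x cx; rewrite ler_nat.
    case: leP => // hx; rewrite (_ : _ <= _)//.
    have := Sle x (lft (ccode l x)) _ (pw l)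
      (fun i => proj2 (andP (ccode_bounds l (cx i)))).
    by move: hx; clear - P_atomless sE psum D; lra.
  by move: h he' re; clear - P_atomless sE psum D; lra.
apply: le_anti; apply/andP; split; first exact/ler_addgt0Pr.
pose gt s := [set u | s < psum S (fun i => X i u)].
have gtE s : gt s = ~` [set u | psum S (fun i => X i u) <= s].
  by apply/seteqP; split => u /=; rewrite /gt/= => h;
    [apply/negP; rewrite -ltNge|rewrite ltNge; apply/negP].
have prgt s : pr P (gt s) = 1 - pr P [set u | psum S (fun i => X i u) <= s].
  by rewrite gtE -setTD prD ?pr_setT//.
have mgt s : measurable (gt s) by rewrite gtE; exact: measurableC.
(* At [t] itself [lower] only reaches the left limit of [F]. It is therefore applied slightly to the
   right of [t], and countable additivity of [P] passes to the limit. *)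
suff : pr P (gt t) <= 1 - F t by rewrite prgt; lra.
have -> : gt t = \bigcup_k gt (t + k.+1%:R^-1).
  apply/seteqP; split => u /=; last first.
    by move=> [k _]; apply: le_lt_trans; rewrite lerDl invr_ge0.
  move=> tu; have d0 : 0 < (psum S (X^~ u) - t)^-1 by rewrite invr_gt0 subr_gt0.
  exists (Num.truncn (psum S (X^~ u) - t)^-1) => //.
  rewrite /gt/= -ltrBrDl invf_plt ?posrE ?ltr0n ?subr_gt0//.
  exact: truncnS_gt.
apply: pr_bigcup_le => // [i j ij u|k].
  apply: le_lt_trans; rewrite lerD2l lef_pV2 ?posrE ?ltr0n// ler_nat//.
rewrite prgt; apply/ler_addgt0Pl => e e0.
have : 0 < k.+1%:R^-1 :> R by rewrite invr_gt0 ltr0n.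
move: (k.+1%:R^-1) => q q0.
pose r := Num.min e q.
have r0 : 0 < r by rewrite /r lt_min e0.
have re : r <= e by rewrite /r ge_min lexx.
have rk : r <= q by rewrite /r ge_min lexx orbT.
have := lower (t + q) r r0.
have : F t <= F (t + q - r) by apply: Fnd; lra.
lra.
Unshelve. all: by end_near.
Qed.
End realization.

                                                 

(** * Distribution functions and stop-loss integrals of uniform laws *)

Section distribution_functions.
Context {R : realType}.
Local Notation RT := (measurableTypeR R).

Lemma probability_eq_cdf (m1 m2 : probability RT R) :
  (forall t, m1 `]-oo, t]%classic = m2 `]-oo, t]%classic) ->
  forall A, measurable A -> m1 A = m2 A.
Proof.
move=> h.
apply: (@measure_unique _ R RT (@RGenOInfty.G R) (fun k => `]- k%:R, +oo[%classic) _ _ _ _ m1 m2).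
- exact: RGenOInfty.measurableE.
- move=> _ _ [x ->] [y ->]; exists (Num.max x y).
  by apply/seteqP; split => z /=; rewrite !in_itv/= !andbT gt_max => /andP.
- by move=> k; exists (- k%:R).
- apply/seteqP; split => // x _; exists (Num.truncn (- x)).+1 => //=.
  by rewrite in_itv/= andbT ltrNl truncnS_gt.
- move=> _ [x ->].
  have E (m : probability RT R) :
      m `]x, +oo[%classic = (1 - m `]-oo, x]%classic)%E.
    have -> : `]x, +oo[%classic = ~` `]-oo, x]%classic :> set R.
      by rewrite setCitvl.
    exact: probability_setC.
  by rewrite [LHS]E [RHS]E h.
- by move=> k; rewrite (le_lt_trans (probability_le1 _ _)) ?ltry.
Qed.

Definition unif_cdf (x : R) : R := Num.max 0 (Num.min 1 x).

Lemma uniform_cdf (a b : R) (ab : a < b) (t : R) :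
  uniform_prob ab `]-oo, t]%classic = (unif_cdf ((t - a) / (b - a)))%:E.
Proof.
have ba : 0 < b - a by rewrite subr_gt0.
rewrite /uniform_prob integral_uniform_pdf.
transitivity (\int[lebesgue_measure]_(x in `]-oo, t] `&` `[a, b]) (cst (b - a)^-1%:E x))%E.
  apply: eq_integral => x; rewrite inE => -[_]; rewrite /= in_itv/= => xab.
  by rewrite /uniform_pdf xab.
rewrite integral_cst; last exact: measurableI.
have [ta|ta] := ltP t a.
  rewrite (_ : _ `&` _ = set0).
    rewrite measure0 mule0 /unif_cdf max_l//.
    by rewrite ge_min pmulr_lle0 ?invr_gt0// subr_le0 (ltW ta) orbT.
  apply/seteqP; split => // x []; rewrite /= !in_itv/= => xt /andP[ax _].
  by have := le_lt_trans (le_trans ax xt) ta; rewrite ltxx.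
have -> : `]-oo, t] `&` `[a, b] = `[a, Num.min t b]%classic :> set R.
  apply/seteqP; split => x /=; rewrite !in_itv/= le_min.
    by move=> [-> /andP[-> ->]].
  by move=> /andP[-> /andP[-> ->]].
transitivity ((b - a)^-1%:E * lebesgue_measure (`[a, Num.min t b]%classic : set R))%E => //.
rewrite lebesgue_measure_itv/= lte_fin.
have E : unif_cdf ((t - a) / (b - a)) = (Num.min t b - a) / (b - a).
  rewrite /unif_cdf; have [tb|tb] := leP t b.
    by rewrite (min_r (_ : _ <= 1)) ?ler_pdivrMr ?mul1r ?lerD2r// max_r// divr_ge0 ?subr_ge0// ltW.
  rewrite (min_l (_ : 1 <= _)) ?max_r ?divff ?gt_eqF//.
  by rewrite ler_pdivlMr// mul1r lerD2r ltW.
rewrite E; case: ltP => h; last first.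
  have -> : Num.min t b = a by apply: le_anti; rewrite h le_min ta ltW.
  by rewrite mule0 subrr mul0r.
by rewrite -EFinD -EFinM mulrC.
Qed.
End distribution_functions.

Section uniform_stop_loss.
Context {R : realType} (n : R) (n0 : 0 < n).

Lemma convex_functionP (phi : R -> R) : convex_function [set: R^o] phi <->
  forall t u v : R, 0 <= t <= 1 ->
    phi (t * u + (1 - t) * v) <= t * phi u + (1 - t) * phi v.
Proof.
split=> [h t u v /andP[t0 t1]|h t u v _ _].
  by apply: (h (Itv01 t0 t1) u v); rewrite in_setT.
by apply: h; apply/andP; split.
Qed.

Lemma convex_pos_shift (y : R) : convex_function [set: R^o] (fun x : R => pos (x - y)).
Proof.
apply/convex_functionP => t u v /andP[t0]; rewrite -subr_ge0 => t1.
have hu := ler_wpM2l t0 (pos_ge (u - y)); have hv := ler_wpM2l t1 (pos_ge (v - y)).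
have hu0 := mulr_ge0 t0 (pos_ge0 (u - y)); have hv0 := mulr_ge0 t1 (pos_ge0 (v - y)).
by rewrite {1}/pos ge_max addr_ge0// andbT (le_trans _ (lerD hu hv))//; lra.
Qed.

Lemma convex_pos_shiftN (y : R) : convex_function [set: R^o] (fun x : R => pos (y - x)).
Proof.
apply/convex_functionP => t u v /andP[t0]; rewrite -subr_ge0 => t1.
have hu := ler_wpM2l t0 (pos_ge (y - u)); have hv := ler_wpM2l t1 (pos_ge (y - v)).
have hu0 := mulr_ge0 t0 (pos_ge0 (y - u)); have hv0 := mulr_ge0 t1 (pos_ge0 (y - v)).
by rewrite {1}/pos ge_max addr_ge0// andbT (le_trans _ (lerD hu hv))//; lra.
Qed.

Lemma integral_uniform_FTC (f F : R -> R) : continuous f ->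
  (forall x, 0 <= f x) -> (forall x : R, is_derive x 1 F (f x)) ->
  (\int[uniform_prob n0]_x (f x)%:E = ((F n - F 0) / n)%:E)%E.
Proof.
move=> cf f0 dF.
have mf : measurable_fun setT f by exact: continuous_measurable_fun.
have mEf : measurable_fun [set: measurableTypeR R] (fun x => (f x)%:E).
  exact/measurable_EFinP.
have Ef0 (x : measurableTypeR R) : (0 <= (f x)%:E)%E by rewrite lee_fin.
rewrite (integral_uniform n0 mEf Ef0).
rewrite (@continuous_FTC2 _ f F)//.
- by rewrite -EFinB -EFinM subr0 mulrC.
- exact: continuous_subspaceT.
- split; first by move=> x _; have [] := dF x.
  + by apply: cvg_at_right_filter; apply: (continuous_of_derive dF).
  + by apply: cvg_at_left_filter; apply: (continuous_of_derive dF).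
- by move=> x _; rewrite derive1E; have [_ ->] := dF x.
Qed.

Lemma uniform_call (y : R) : 0 <= y <= n ->
  (\int[uniform_prob n0]_x (pos (x - y))%:E = ((n - y) ^+ 2 / (2 * n))%:E)%E.
Proof.
move=> /andP[y0 yn].
have d (x : R) : is_derive x 1 (fun x : R => pos (x - y) ^+ 2 / 2) (pos (x - y)).
  have := is_derive_affine (- y) 1 x (@is_derive_pos2 R).
  by rewrite mulr1 mul1r [- _ + x]addrC; under eq_fun do rewrite mul1r addrC.
rewrite (integral_uniform_FTC (@continuous_pos_shift R y) (fun x => pos_ge0 _) d).
rewrite (pos_id (_ : 0 <= n - y)) ?subr_ge0// pos_eq0 ?sub0r ?oppr_le0//.
by congr EFin; field; rewrite gt_eqF.
Qed.

Lemma uniform_put (y : R) : 0 <= y <= n ->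
  (\int[uniform_prob n0]_x (pos (y - x))%:E = (y ^+ 2 / (2 * n))%:E)%E.
Proof.
move=> /andP[y0 yn].
have d (x : R) : is_derive x 1 (fun x : R => -1 * (pos (y - x) ^+ 2 / 2)) (pos (y - x)).
  have e z : y - z = y + -1 * z by rewrite mulN1r.
  under eq_fun do rewrite e; rewrite e.
  apply: is_derive_eq (is_derive_scale (-1) (is_derive_affine y (-1) x (@is_derive_pos2 R))) _.
  by ring.
have c : continuous (fun x : R => pos (y - x)).
  move=> x; apply: (@continuous_comp _ _ _ (fun x : R => y - x) (@pos R)).
    by apply: cvgB; [exact: cvg_cst|exact: cvg_id].
  exact: continuous_pos.
rewrite (integral_uniform_FTC c (fun x => pos_ge0 _) d).
rewrite (pos_eq0 (_ : y - n <= 0)) ?subr_le0// subr0 pos_id//.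
by congr EFin; field; rewrite gt_eqF.
Qed.
End uniform_stop_loss.

(** * Discretization of the target law *)

Section discretization.
Context {R : realType} (n : R) (n0 : 0 < n).
Variable G : probability (measurableTypeR R) R.
Hypothesis Gput : forall y, 0 <= y <= n ->
  (\int[G]_x (pos (y - x))%:E <= (y ^+ 2 / (2 * n))%:E)%E.
Hypothesis Gcall0 : (\int[G]_x (pos x)%:E <= (n / 2)%:E)%E.
Hypothesis Gcalln : (\int[G]_x (pos (x - n))%:E <= 0)%E.
Implicit Types f g : R -> R.

Let measurable_pos (f : R -> R) : measurable_fun setT f ->
  measurable_fun setT (fun x => pos (f x)).
Proof.
move=> mf; apply: (measurableT_comp (f := @pos R)) => //.
exact: continuous_measurable_fun (@continuous_pos R).
Qed.

Let null_of_integral0 f : measurable_fun setT f -> (forall x, 0 <= f x) ->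
  (\int[G]_x (f x)%:E <= 0)%E -> G [set x | 0 < f x] = 0%E.
Proof.
move=> mf f0 If.
have mEf : measurable_fun [set: measurableTypeR R] (EFin \o f) by exact/measurable_EFinP.
have [+ _] := @ae_eq_integral_abs _ _ _ G setT measurableT (EFin \o f) mEf.
have -> : (\int[G]_x `|(EFin \o f) x| = 0)%E.
  apply/eqP; rewrite eq_le integral_ge0// andbT (le_trans _ If)//.
  by under eq_integral do rewrite /= ger0_norm//.
move=> /(_ erefl) h.
have mS : measurable ([set x | 0 < f x] : set (measurableTypeR R)).
  rewrite (_ : [set x | _] = f @^-1` `]0, +oo[).
    by rewrite -[X in measurable X]setTI; apply: mf.
  by apply/seteqP; split => x /=; rewrite in_itv/= andbT.
apply/(negligibleP G mS); apply: negligibleS h => x /= fx /(_ I)[] e.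
by rewrite e ltxx in fx.
Qed.

Let I := `[0, n]%classic : set (measurableTypeR R).
Let mI : measurable I. Proof. exact: measurable_itv. Qed.

(** The bounds at $y=0$ and at $n$ say that $x^-$ and $(x-n)^+$ have zero integral. *)
Let GCI : G (~` I) = 0%E.
Proof.
have h0 : G [set x | 0 < pos (0 - x)] = 0%E.
  apply: null_of_integral0 => [|x|]; last 2 first.
  - exact: pos_ge0.
  - by have := Gput (y := 0); rewrite lexx ltW// expr0n/= mul0r; apply.
  by apply: measurable_pos; apply: measurable_funB.
have hn : G [set x | 0 < pos (x - n)] = 0%E.
  apply: null_of_integral0 => [|x|//]; last exact: pos_ge0.
  by apply: measurable_pos; apply: measurable_funB.
have mp f : measurable_fun setT f -> measurable ([set x | 0 < f x] : set (measurableTypeR R)).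
  move=> mf; rewrite (_ : [set x | _] = f @^-1` `]0, +oo[).
    by rewrite -[X in measurable X]setTI; apply: mf.
  by apply/seteqP; split => x /=; rewrite in_itv/= andbT.
have m0 : measurable ([set x | 0 < pos (0 - x)] : set (measurableTypeR R)).
  by apply: mp; apply: measurable_pos; apply: measurable_funB.
have mn : measurable ([set x | 0 < pos (x - n)] : set (measurableTypeR R)).
  by apply: mp; apply: measurable_pos; apply: measurable_funB.
apply: (@subset_measure0 _ _ _ G _ ([set x | 0 < pos (0 - x)] `|` [set x | 0 < pos (x - n)])).
- exact: measurableC.
- exact: measurableU.
- move=> x; rewrite /I/= in_itv/= => /negP; rewrite negb_and -!ltNge => /orP[h|h].
    by left => /=; rewrite pos_id; lra.
  by right => /=; rewrite pos_id; lra.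
exact: null_set_setU.
Qed.

Let GI A : measurable A -> pr G (A `&` I) = pr G A.
Proof.
move=> mA; have mAI := measurableI _ _ mA mI; have mAD := measurableD mA mI.
rewrite -[in RHS](setUIDK A I) prU//; last by rewrite setIDA setIAC -setIDA setDv setI0.
suff -> : pr G (A `\` I) = 0 by rewrite addr0.
rewrite /pr; have -> // : G (A `\` I) = 0%E.
by apply: (subset_measure0 mAD (measurableC mI) _ GCI) => x [].
Qed.

Let Ef f := \int[G]_(x in I) f x.
Let nice f := measurable_fun setT f /\ exists M, forall x, 0 <= x <= n -> `|f x| <= M.

Let nice_integrable f : nice f -> G.-integrable I (EFin \o f).
Proof.
move=> [mf [M HM]]; apply: measurable_bounded_integrable => //.
- by rewrite (le_lt_trans (probability_le1 _ _)) ?ltry.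
- exact: measurable_funTS.
- exists M; split; first exact: num_real.
  move=> M' MM' x; rewrite /I/= in_itv/= => /HM h; exact: le_trans h (ltW MM').
Qed.

Let nice_cst c : nice (fun=> c).
Proof. by split=> //; exists `|c|. Qed.

Let nice_id : nice id.
Proof. by split=> //; exists n => x /andP[x0 xn]; rewrite ger0_norm. Qed.

Let niceD f g : nice f -> nice g -> nice (fun x => f x + g x).
Proof.
move=> [mf [M HM]] [mg [M' HM']]; split; first exact: measurable_funD.
by exists (M + M') => x xI; apply: le_trans (ler_normD _ _) _; rewrite lerD ?HM ?HM'.
Qed.

Let niceM f g : nice f -> nice g -> nice (fun x => f x * g x).
Proof.
move=> [mf [M HM]] [mg [M' HM']]; split; first exact: measurable_funM.
by exists (M * M') => x xI; rewrite normrM ler_pM ?HM ?HM'.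
Qed.

Let niceB f g : nice f -> nice g -> nice (fun x => f x - g x).
Proof.
move=> [mf [M HM]] [mg [M' HM']]; split; first exact: measurable_funB.
by exists (M + M') => x xI; apply: le_trans (ler_normB _ _) _; rewrite lerD ?HM ?HM'.
Qed.

Let nice_pos f : nice f -> nice (fun x => pos (f x)).
Proof.
move=> [mf [M HM]]; split; first exact: measurable_pos.
exists M => x /HM; apply: le_trans; rewrite ger0_norm ?pos_ge0//.
by rewrite /pos ge_max ler_norm normr_ge0.
Qed.

Let nice_sum (J : Type) (r : seq J) (P : pred J) (F : J -> R -> R) :
  (forall j, nice (F j)) -> nice (fun x => \sum_(j <- r | P j) F j x).
Proof.
move=> nF; elim: r => [|j r IH].
  by under eq_fun do rewrite big_nil; exact: nice_cst.
under eq_fun do rewrite big_cons; case: (P j) => //.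
exact: niceD.
Qed.

Let EfD f g : nice f -> nice g -> Ef (fun x => f x + g x) = Ef f + Ef g.
Proof. by move=> nf ng; apply: RintegralD => //; exact: nice_integrable. Qed.

Let EfZ c f : nice f -> Ef (fun x => c * f x) = c * Ef f.
Proof. by move=> nf; apply: RintegralZl => //; exact: nice_integrable. Qed.

Let Ef_le f g : nice f -> nice g -> (forall x, 0 <= x <= n -> f x <= g x) -> Ef f <= Ef g.
Proof.
move=> nf ng fg.
apply: (le_Rintegral mI (nice_integrable nf) (nice_integrable ng)) => x.
by rewrite /I/= in_itv/=; exact: fg.
Qed.

Let Ef_eq f g : (forall x, 0 <= x <= n -> f x = g x) -> Ef f = Ef g.
Proof.
move=> fg; apply: eq_Rintegral => x; rewrite inE /I/= in_itv/=; exact: fg.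
Qed.

Let Ef0 : Ef (fun=> 0) = 0.
Proof.
rewrite -[RHS](mul0r (Ef (fun=> 0))) -(EfZ 0 (nice_cst 0)).
by apply: Ef_eq => x _; rewrite mul0r.
Qed.

Let Ef_sum (J : Type) (r : seq J) (P : pred J) (F : J -> R -> R) :
  (forall j, nice (F j)) ->
  Ef (fun x => \sum_(j <- r | P j) F j x) = \sum_(j <- r | P j) Ef (F j).
Proof.
move=> nF; elim: r => [|j r IH].
  by rewrite big_nil -[RHS]Ef0; apply: Ef_eq => x _; rewrite big_nil.
rewrite big_cons -IH; case: ifP => Pj; last first.
  by apply: Ef_eq => x _; rewrite big_cons Pj.
rewrite -EfD//; last exact: nice_sum.
by apply: Ef_eq => x _; rewrite big_cons Pj.
Qed.

Let Ef_indic (A : set (measurableTypeR R)) : measurable A -> Ef (\1_A) = pr G A.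
Proof. by move=> mA; rewrite /Ef /Rintegral integral_indic// -GI. Qed.

Let nice_indic (A : set (measurableTypeR R)) : measurable A -> nice (\1_A).
Proof.
move=> mA; split; first exact: measurable_indic.
by exists 1 => x _; rewrite indicE; case: (_ \in _); rewrite ?normr1 ?normr0.
Qed.

Let Ef1 : Ef (fun=> 1) = 1.
Proof.
rewrite -[RHS](pr_setT G) -(Ef_indic measurableT); apply: Ef_eq => x _.
by rewrite indicE in_setT.
Qed.

Let Ef_ge0_le f (r : R) : nice f -> (forall x, 0 <= f x) ->
  (\int[G]_x (f x)%:E <= r%:E)%E -> Ef f <= r.
Proof.
move=> nf f0 h; rewrite -lee_fin /Ef /Rintegral fineK; last first.
  exact: (integrable_fin_num mI (nice_integrable nf)).
apply: le_trans h; apply: ge0_subset_integral => //.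
  by apply/measurable_EFinP; exact: (proj1 nf).
by move=> x _; rewrite lee_fin.
Qed.

Let Ef_put y : 0 <= y <= n -> Ef (fun x => pos (y - x)) <= y ^+ 2 / (2 * n).
Proof.
move=> yn; apply: Ef_ge0_le; [|by move=> x; exact: pos_ge0|exact: Gput].
by apply: nice_pos; apply: niceB; [exact: nice_cst|exact: nice_id].
Qed.

(** The bound on $x^+$ gives one inequality, the bound on $(n-x)^+$ the other. *)
Let Ef_id : Ef id = n / 2.
Proof.
apply: le_anti; apply/andP; split.
  have <- : Ef (fun x => pos x) = Ef id by apply: Ef_eq => x /andP[x0 _]; rewrite pos_id.
  by apply: Ef_ge0_le => //; [apply: nice_pos; exact: nice_id|exact: pos_ge0].
have h : 0 <= n <= n by rewrite lexx ltW.
have := Ef_put h.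
have -> : Ef (fun x => pos (n - x)) = Ef (fun x => n + (-1) * x).
  by apply: Ef_eq => x /andP[x0 xn]; rewrite pos_id ?mulN1r// subr_ge0.
rewrite EfD; [|exact: nice_cst|by apply: niceM; [exact: nice_cst|exact: nice_id]].
rewrite (EfZ (-1) nice_id) (_ : Ef (fun=> n) = n).
  have -> : n ^+ 2 / (2 * n) = n / 2 by field; rewrite gt_eqF.
  lra.
rewrite -[RHS]mulr1 -[X in _ = _ * X]Ef1 -(EfZ n (nice_cst 1)).
by apply: Ef_eq => x _; rewrite mulr1.
Qed.

                                                                         
                         
(** The mass of each cell is concentrated at its conditional mean. By Jensen's inequality on the
    cells the integrated distribution function does not increase, and no mass moves farther than the
    cell width. *)
Lemma discretize (e : R) : 0 < e -> exists M, exists s p : 'I_M.+1 -> R,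
  cxblock s 0 1 p /\
  forall t : R, pr G (`]-oo, (t - e)]%classic : set R) <= \sum_(j | n * s j <= t) p j <=
            pr G (`]-oo, (t + e)]%classic : set R).
Proof.
move=> e0; pose M := (Num.truncn (n / e)).+1.
have M0 : 0 < M%:R :> R by rewrite ltr0n.
pose w := n / M%:R.
have w0 : 0 < w by rewrite /w divr_gt0.
have we : w <= e.
  by rewrite /w ler_pdivrMr// mulrC -ler_pdivrMr//; apply: ltW; exact: truncnS_gt.
have Mw : M%:R * w = n by rewrite /w mulrC divfK// gt_eqF.
(* Half-open cells: since $Mw=n$, the extra cell of index [M] is there to catch the endpoint $n$. *)
pose C (j : 'I_M.+1) := `[j%:R * w, j.+1%:R * w[%classic : set (measurableTypeR R).
have mC j : measurable (C j) by exact: measurable_itv.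
pose ind (j : 'I_M.+1) : R -> R := \1_(C j).
have n_ind j : nice (ind j) by exact: nice_indic.
have indE j x : ind j x = (j%:R * w <= x < j.+1%:R * w)%R%:R.
  by rewrite /ind indicE; congr (nat_of_bool _)%:R; apply/idP/idP; rewrite inE /C/= in_itv.
have ind0 j x : 0 <= ind j x by rewrite indE ler0n.
have cell x : 0 <= x <= n -> exists j : 'I_M.+1, ind j x = 1 /\
    forall k, k != j -> ind k x = 0.
  move=> /andP[x0 xn]; have xw0 : 0 <= x / w by rewrite divr_ge0// ltW.
  have := truncn_itv xw0; set k := Num.truncn _ => /andP[k1 k2].
  have kM : (k < M.+1)%N.
    rewrite -(ltr_nat R) (le_lt_trans k1)// ltr_pdivrMr// -[M.+1%:R]natr1 mulrDl Mw mul1r.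
    lra.
  rewrite ler_pdivlMr// in k1; rewrite ltr_pdivrMr// in k2.
  exists (Ordinal kM); split; first by rewrite indE/= k1 k2.
  move=> j; rewrite indE -(inj_eq val_inj)/= neq_ltn => /orP[h|h].
    rewrite [X in _ && X]ltNge (_ : j.+1%:R * w <= x) ?andbF//.
    by apply: le_trans k1; rewrite ler_pM2r// ler_nat.
  rewrite leNgt (_ : x < j%:R * w)//.
  by apply: lt_le_trans k2 _; rewrite ler_pM2r// ler_nat.
pose p (j : 'I_M.+1) := Ef (ind j).
pose m (j : 'I_M.+1) := Ef (fun x => ind j x * id x).
have n_m (j : 'I_M.+1) : nice (fun x => ind j x * id x) by apply: niceM => //; exact: nice_id.
have m_lo (j : 'I_M.+1) : j%:R * w * p j <= m j.
  rewrite -EfZ//; apply: Ef_le => //; first by apply: niceM => //; exact: nice_cst.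
  by move=> x _; rewrite indE; case: andP => [[h _]|_]; rewrite ?mulr1 ?mul1r ?mulr0 ?mul0r.
have m_hi (j : 'I_M.+1) : m j <= j.+1%:R * w * p j.
  rewrite -EfZ//; apply: Ef_le => //; first by apply: niceM => //; exact: nice_cst.
  by move=> x _; rewrite indE; case: andP => [[_ /ltW h]|_]; rewrite ?mulr1 ?mul1r ?mulr0 ?mul0r.
have p0 (j : 'I_M.+1) : 0 <= p j.
  by rewrite -Ef0; apply: Ef_le => //; exact: nice_cst.
(* A cell without mass is assigned its left end, so that [s' j] always lies in the closed cell
   ([s'b]). *)
pose s' (j : 'I_M.+1) := if p j == 0 then j%:R * w else m j / p j.
have s'p (j : 'I_M.+1) : p j * s' j = m j.
  rewrite /s'; case: eqP => [pj|/eqP pj]; last by rewrite mulrC divfK.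
  rewrite pj mul0r; apply: le_anti.
  by have := m_lo j; have := m_hi j; rewrite pj !mulr0 => -> ->.
have s'b (j : 'I_M.+1) : j%:R * w <= s' j <= j.+1%:R * w.
  rewrite /s'; case: eqP => [_|/eqP pj].
    by rewrite lexx ler_pM2r// ler_nat leqnSn.
  have pj0 : 0 < p j by rewrite lt0r pj p0.
  by rewrite ler_pdivlMr// m_lo ler_pdivrMr// m_hi.
pose s (j : 'I_M.+1) := s' j / n.
have ns (j : 'I_M.+1) : n * s j = s' j by rewrite /s mulrC divfK// gt_eqF.
have sum_ind x : 0 <= x <= n -> \sum_j ind j x = 1.
  move=> /cell[j [j1 jk]]; rewrite (bigD1 j)//= j1 big1 ?addr0// => k; exact: jk.
exists M, s, p; split.
- split => //.
  + rewrite subr0 -[RHS]Ef1 -Ef_sum//; exact: Ef_eq.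
  + transitivity ((\sum_j m j) / n).
      by rewrite mulr_suml; apply: eq_bigr => j _; rewrite /s mulrA s'p.
    rewrite -Ef_sum// (@Ef_eq _ id); last first.
      by move=> x xI; rewrite -mulr_suml sum_ind// mul1r.
    by rewrite Ef_id; field; rewrite gt_eqF.
  + move=> y y01; have /andP[y0 y1] := y01.
    have ny : 0 <= n * y <= n by rewrite (mulr_ge0 (ltW n0) y0) ger_pMr.
    have nput : nice (fun x => pos (n * y - x)).
      by apply: nice_pos; apply: niceB; [exact: nice_cst|exact: nice_id].
    have key j : p j * pos (n * y - s' j) <= Ef (fun x => ind j x * pos (n * y - x)).
      have nj : nice (fun x => ind j x * pos (n * y - x)) by exact: niceM.
      have [h|/ltW h] := leP (n * y - s' j) 0.
        rewrite (pos_eq0 h) mulr0 -Ef0; apply: Ef_le (nice_cst 0) nj _ => x _.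
        by rewrite mulr_ge0// pos_ge0.
      rewrite (pos_id h) mulrBr s'p mulrC /p /m.
      have -> : n * y * Ef (ind j) - Ef (fun x => ind j x * id x) =
          Ef (fun x => n * y * ind j x + (-1) * (ind j x * id x)).
        rewrite EfD; [|by apply: niceM => //; exact: nice_cst|by apply: niceM => //; exact: nice_cst].
        by rewrite EfZ// EfZ// mulN1r.
      apply: Ef_le => //.
        by apply: niceD; apply: niceM => //; exact: nice_cst.
      move=> x _; have := ler_wpM2l (ind0 j x) (pos_ge (n * y - x)); rewrite /=; lra.
    rewrite subr0 /call -(ler_pM2l n0).
    have -> : n * \sum_i p i * pos (y - s i) = \sum_j p j * pos (n * y - s' j).
      rewrite mulr_sumr; apply: eq_bigr => j _; rewrite mulrCA; congr (_ * _).
      by rewrite /pos maxr_pMr ?ltW// mulr0 mulrBr ns.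
    apply: le_trans (ler_sum _ (fun j _ => key j)) _.
    rewrite -Ef_sum; last by move=> j; exact: niceM.
    rewrite (@Ef_eq _ (fun x => pos (n * y - x))); last first.
      by move=> x xI; rewrite -mulr_suml sum_ind// mul1r.
    apply: le_trans (Ef_put ny) _.
    by have -> : (n * y) ^+ 2 / (2 * n) = n * (y ^+ 2 / 2) by field; rewrite gt_eqF.
move=> t; have half u : measurable (`]-oo, u]%classic : set (measurableTypeR R)) by exact: measurable_itv.
have halfE u x : \1_(`]-oo, u]%classic) x = (x <= u)%R%:R :> R.
  by rewrite indicE; congr (nat_of_bool _)%:R; apply/idP/idP; rewrite inE /= in_itv.
under eq_bigl do rewrite ns.
rewrite -!Ef_indic// -Ef_sum//; apply/andP; split; apply: Ef_le => //; do ?exact: nice_indic; do ?exact: nice_sum.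
- move=> x xI; have [j [j1 jk]] := cell x xI.
  rewrite halfE; case: (leP x (t - e)) => h; last by rewrite mulr0n; apply: sumr_ge0.
  have jt : s' j <= t.
    have : ind j x != 0 by rewrite j1 oner_eq0.
    rewrite indE; case: andP => [[h1 h2] _|]; last by rewrite eqxx.
    have /andP[_ h3] := s'b j.
    by move: h3 h1; rewrite -natr1; lra.
  by rewrite mulr1n (bigD1 j)//= j1 lerDl sumr_ge0.
- move=> x xI; rewrite halfE; case: (leP x (t + e)) => h.
    rewrite mulr1n -(sum_ind x xI) [leRHS](bigID (fun j => s' j <= t))/= lerDl; exact: sumr_ge0.
  rewrite mulr0n big1// => j jt; rewrite indE; case: andP => // -[h1 h2].
  have /andP[h3 _] := s'b j.
  by move: h2; rewrite -natr1; lra.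
Qed.
End discretization.

(** * From stop-loss bounds to random variables with the required sum *)

Section unif_cdf_lemmas.
Context {R : realType}.
Implicit Types x : R.

Lemma unif_cdf_ge0 x : 0 <= unif_cdf x. Proof. by rewrite /unif_cdf le_max lexx. Qed.

Lemma unif_cdf_le1 x : unif_cdf x <= 1.
Proof. by rewrite /unif_cdf ge_max ler01 ge_min lexx. Qed.

Lemma unif_cdf_id x : 0 <= x <= 1 -> unif_cdf x = x.
Proof. by move=> /andP[x0 x1]; rewrite /unif_cdf min_r// max_r. Qed.

Lemma unif_cdf_eq0 x : x <= 0 -> unif_cdf x = 0.
Proof. by move=> x0; rewrite /unif_cdf max_l// ge_min x0 orbT. Qed.

Lemma unif_cdf_eq1 x : 1 <= x -> unif_cdf x = 1.
Proof. by move=> x1; rewrite /unif_cdf min_l// max_r. Qed.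

Lemma unif_cdf_homo x y : x <= y -> unif_cdf x <= unif_cdf y.
Proof.
move=> xy; have [x0|/ltW x0] := leP x 0; first by rewrite unif_cdf_eq0// unif_cdf_ge0.
have [y1|/ltW y1] := leP 1 y; first by rewrite (unif_cdf_eq1 y1) unif_cdf_le1.
by rewrite !unif_cdf_id ?x0 ?y1 ?(le_trans x0)//= (le_trans xy).
Qed.

Lemma unif_cdf_lip x e : 0 <= e -> unif_cdf (x + e) <= unif_cdf x + e.
Proof.
move=> e0; have [x0|/ltW x0] := leP (x + e) 0.
  by rewrite unif_cdf_eq0// addr_ge0// unif_cdf_ge0.
have [x1|/ltW x1] := leP 1 x.
  by rewrite (unif_cdf_eq1 x1) (le_trans (unif_cdf_le1 _))// lerDl.
have [xn|/ltW xp] := leP x 0.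
  rewrite (unif_cdf_eq0 xn) add0r; have [e1|/ltW e1] := leP 1 (x + e).
    by rewrite unif_cdf_eq1//; lra.
  by rewrite unif_cdf_id ?x0//; lra.
rewrite (unif_cdf_id (_ : 0 <= x <= 1)) ?xp ?x1//.
have [e1|/ltW e1] := leP 1 (x + e); first by rewrite unif_cdf_eq1.
by rewrite unif_cdf_id ?x0.
Qed.
End unif_cdf_lemmas.

Lemma le_indic {R : realType} (b c : bool) : (b -> c) -> b%:R <= c%:R :> R.
Proof. by case: b; case: c => // /(_ isT). Qed.

Section close_states.
Context {R : realType} (n : nat).
Hypothesis n3 : (3 <= n)%N.
Variable G : probability (measurableTypeR R) R.
Hypothesis Gput : forall y, 0 <= y <= n%:R ->
  (\int[G]_x (pos (y - x))%:E <= (y ^+ 2 / (2 * n%:R))%:E)%E.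
Hypothesis Gcall0 : (\int[G]_x (pos x)%:E <= (n%:R / 2)%:E)%E.
Hypothesis Gcalln : (\int[G]_x (pos (x - n%:R))%:E <= 0)%E.

Definition gcdf (t : R) := pr G `]-oo, t]%classic.

(** Difference quotients of hinges at adjacent grid points lie between indicators of half-lines, so
    the hinge expectations of [state_approx] control the marginal distribution functions. The
    distribution of the sum is read off the label $k$, because the sum equals $ns_k$ on good
    configurations. *)
Lemma close_state (e : R) : 0 < e -> exists E, [/\ is_state (@cube R n) E,
  forall i t, unif_cdf (t - e) - e <= E (fun x => (x i <= t)%R%:R) <= unif_cdf (t + e) + e &
  forall t, gcdf (t - e) - e <= E (fun x => (\sum_i x i <= t)%R%:R) <= gcdf (t + e) + e].
Proof.
move=> e0.
have n0 : 0 < n%:R :> R by rewrite ltr0n (leq_trans _ n3).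
have [M [s [p [cx Hp]]]] := discretize n0 Gput Gcall0 Gcalln e0.
pose N := (Num.truncn (4 / e)).+1.
have N0 : 0 < N%:R :> R by rewrite ltr0n.
have Ne : 4 / N%:R <= e.
  by rewrite ler_pdivrMr// mulrC -ler_pdivrMr//; apply: ltW; exact: truncnS_gt.
pose t (j : 'I_N.+1) : R := j%:R / N%:R.
have t01 j : 0 <= t j <= 1.
  by rewrite divr_ge0//= ler_pdivrMr// mul1r ler_nat -ltnS ltn_ord.
(* The errors of the [M.+1] atoms must add up to at most [e], and a hinge error, multiplied by the
   slope [N], must stay below one grid step. *)
pose dl : R := Num.min (e / M.+1%:R) (N%:R ^- 2).
have dl0 : 0 < dl by rewrite lt_min divr_gt0//= invr_gt0 exprn_gt0.
have dlM : dl * M.+1%:R <= e by rewrite -ler_pdivlMr// /dl ge_min lexx.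
have dlN : N%:R * dl <= N%:R^-1.
  have : dl <= N%:R ^- 2 by rewrite /dl ge_min lexx orbT.
  by rewrite -(ler_pM2l N0) => /le_trans; apply; rewrite expr2 invfM mulrA divff ?gt_eqF// mul1r.
have [E0 [sE0 Ecall Eatom]] := @state_approx R 'I_M.+1 s p n N.+1 t dl n3 t01 cx dl0.
pose E f := E0 (fun a => f a.2).
have sE : is_state (@cube R n) E.
  have [ED EZ Epos E1] := sE0; split=> [f g|c f|f f0|].
  - exact: ED.
  - exact: EZ.
  - by apply: Epos => a [a01 _]; exact: f0.
  - exact: E1.
have E01 (B : ('I_n -> R) -> bool) : 0 <= E (fun x => (B x)%:R) <= 1.
  have [_ _ Epos _] := sE; apply/andP; split; first by apply: Epos => x _; rewrite ler0n.
  by rewrite -[leRHS](state_cst 1 sE); apply: (state_le sE) => x _; case: (B x).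
pose q : R := N%:R^-1.
have q0 : 0 < q by rewrite invr_gt0.
have qe : 4 * q <= e by [].
have hinge i j : (j < N)%N ->
    E (fun x => (x i <= j%:R * q)%R%:R) <= j%:R * q + q / 2 + 2 * q /\
    j%:R * q + q / 2 - 2 * q <= E (fun x => (x i <= j.+1%:R * q)%R%:R).
  move=> jN; pose j1 := Ordinal (ltnW jN : (j < N.+1)%N); pose j2 := Ordinal (jN : (j.+1 < N.+1)%N).
  have e1 : t j1 = j%:R * q by []. have e2 : t j2 = j%:R * q + q.
    by rewrite /t/= -natr1 mulrDl mul1r.
  (* As a function of [x i], [h] equals 1 up to [t j1] and 0 from [t j2] on, and is linear in
     between. *)
  pose h x := 1 + (- N%:R) * (pos (x i - t j1) + (-1) * pos (x i - t j2)).
  have [ED EZ _ _] := sE.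
  have Eh : E h = 1 - N%:R * (E (fun x => pos (x i - t j1)) - E (fun x => pos (x i - t j2))).
    by rewrite /h ED EZ ED EZ (state_cst _ sE); ring.
  have := Ecall i j1; have := Ecall i j2; rewrite !ler_distl -!/(E (fun x => pos (x i - _))).
  move=> /andP[b1 b2] /andP[a1 a2].
  have Nq : N%:R * q = 1 by rewrite /q divff// gt_eqF.
  have val : 1 - N%:R * ((1 - t j1) ^+ 2 / 2 - (1 - t j2) ^+ 2 / 2) = j%:R * q + q / 2.
    rewrite e1 e2; set u := j%:R * q.
    have -> : N%:R * ((1 - u) ^+ 2 / 2 - (1 - (u + q)) ^+ 2 / 2) =
      (N%:R * q) * (2 - 2 * u - q) / 2 by ring.
    by rewrite Nq; lra.
  have bnd : `|E h - (j%:R * q + q / 2)| <= 2 * q.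
    rewrite -val Eh ler_distl; move: dlN; rewrite -/q => dlN.
    set A := E _ in a1 a2 *; set B := E _ in b1 b2 *.
    have k1 := ler_wpM2l (ltW N0) a1; have k2 := ler_wpM2l (ltW N0) a2.
    have k3 := ler_wpM2l (ltW N0) b1; have k4 := ler_wpM2l (ltW N0) b2.
    apply/andP; split; move: k1 k2 k3 k4 dlN; clear - n3 Gput Gcall0 Gcalln; lra.
  move: bnd; rewrite ler_distl => /andP[h1 h2].
  have lip x : pos (x i - t j1) - pos (x i - t j2) <= q.
    by apply: le_trans (pos_lip _) _; rewrite e1 e2; move: q0; clear - n3 Gput Gcall0 Gcalln; lra.
  split.
    apply: le_trans h2; apply: (state_le sE) => x _; rewrite /h.
    have [hx|hx] := leP (x i) (j%:R * q).
      by rewrite !pos_eq0 ?e1 ?e2 ?mulr0 ?addr0 ?mulr0 ?addr0//; lra.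
    have := ler_wpM2l (ltW N0) (lip x); rewrite Nq mulr0n; lra.
  apply: le_trans h1 _; apply: (state_le sE) => x _; rewrite /h.
  have e2' : t j2 = j.+1%:R * q by rewrite e2 -natr1; ring.
  have [hx|hx] := leP (x i) (j.+1%:R * q).
    have : pos (x i - t j2) <= pos (x i - t j1) by apply: pos_homo; rewrite e1 e2; lra.
    by move=> /(ler_wpM2l (ltW N0)); rewrite mulr1n; lra.
  rewrite -e2' in hx; have hx1 : t j1 < x i by move: hx; rewrite e1 e2; lra.
  rewrite mulr0n !pos_id; [|by rewrite subr_ge0 ltW|by rewrite subr_ge0 ltW].
  by rewrite e1 e2; move: Nq; lra.
exists E; split => // [i u|u].
  have /andP[Eu0 Eu1] := E01 (fun x => x i <= u)%R.
  apply/andP; split.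
    have [ue|ue] := leP (u - e) 0; first by rewrite unif_cdf_eq0//; lra.
    have [u1|u1] := leP 1 u.
      apply: (@le_trans _ _ 1); first by have := unif_cdf_le1 (u - e); lra.
      rewrite -[leLHS](state_cst 1 sE); apply: (state_le sE) => x cx'.
      by have /andP[_ xi] := cx' i; rewrite (le_trans xi u1).
    rewrite unif_cdf_id; last by apply/andP; split; lra.
    have uN0 : 0 <= u * N%:R by apply: mulr_ge0; lra.
    have /andP[k1 k2] := truncn_itv uN0; set k := Num.truncn _ in k1 k2.
    have uq : u = u * N%:R * q by rewrite /q mulfK// gt_eqF.
    have k0 : (0 < k)%N.
      rewrite lt0n; apply/eqP => k0; move: k2; rewrite k0.
      have : 4 <= e * N%:R by rewrite -ler_pdivrMr.
      have : e * N%:R <= u * N%:R by rewrite ler_pM2r//; lra.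
      by rewrite /=; lra.
    have kN : (k <= N)%N.
      rewrite -(ler_nat R) (le_trans k1)// ler_piMl//; lra.
    have kN' : (k.-1 < N)%N by rewrite prednK.
    have [_ hk] := hinge i k.-1 kN'; rewrite prednK// in hk.
    apply: (@le_trans _ _ (E (fun x => (x i <= k%:R * q)%R%:R))).
      apply: le_trans hk; rewrite -subn1 natrB//.
      have : u * N%:R * q <= k.+1%:R * q by rewrite ler_pM2r// ltW.
      by rewrite -uq -natr1; lra.
    apply: (state_le sE) => x _; apply: le_indic => hx; apply: (le_trans hx).
    by rewrite [leRHS]uq ler_pM2r.
  have [u1|u1] := leP 1 (u + e).
    by rewrite unif_cdf_eq1// (le_trans Eu1)// lerDl ltW.
  have [u0|u0] := leP 0 u; last first.
    apply: (@le_trans _ _ 0); last by rewrite addr_ge0 ?unif_cdf_ge0// ltW.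
    rewrite -[leRHS](state_cst 0 sE); apply: (state_le sE) => x cx'.
    have /andP[xi _] := cx' i; rewrite (_ : (x i <= u) = false)//.
    by apply/negbTE; rewrite -ltNge (lt_le_trans u0 xi).
  rewrite unif_cdf_id; last by apply/andP; split; lra.
  have uN0 : 0 <= u * N%:R by apply: mulr_ge0; lra.
  have /andP[k1 k2] := truncn_itv uN0; set k := Num.truncn _ in k1 k2.
  have uq : u = u * N%:R * q by rewrite /q mulfK// gt_eqF.
  have kq : k%:R * q <= u by rewrite [leRHS]uq ler_pM2r.
  have kN : (k.+1 < N)%N.
    rewrite -(ltr_nat R) -(ltr_pM2r q0) [N%:R * q]divff ?gt_eqF// -natr1; lra.
  have [hk _] := hinge i k.+1 kN.
  apply: (@le_trans _ _ (E (fun x => (x i <= k.+1%:R * q)%R%:R))); last first.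
    by apply: le_trans hk _; rewrite -natr1; lra.
  apply: (state_le sE) => x _; apply: le_indic => hx; apply: (le_trans hx).
  by rewrite [leLHS]uq ler_pM2r// ltW.
have /andP[Hp1 Hp2] := Hp u.
have -> : E (fun x => (\sum_i x i <= u)%R%:R) =
    \sum_(k | n%:R * s k <= u) E0 (fun a => (a.1 == k)%:R).
  rewrite -(state_sum _ _ _ sE0); apply: le_anti; apply/andP; split;
    apply: (state_le sE0) => -[k x] [/= x01 ->];
    have [h|h] := leP (n%:R * s k) u.
  - by rewrite (bigD1 k)//= eqxx lerDl; apply: sumr_ge0 => k' _; rewrite ler0n.
  - by apply: sumr_ge0 => k' _; rewrite ler0n.
  - rewrite (bigD1 k)//= eqxx big1 ?addr0// => k' /andP[_].
    by rewrite eq_sym => /negbTE ->.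
  - rewrite big1// => k' hk'; case: eqP => // kk'; move: h; rewrite kk' ltNge hk'//.
have D : `|\sum_(k | n%:R * s k <= u) E0 (fun a => (a.1 == k)%:R) - \sum_(k | n%:R * s k <= u) p k| <= e.
  rewrite -sumrB; apply: le_trans (ler_norm_sum _ _ _) _.
  apply: (@le_trans _ _ (\sum_(k < M.+1) dl)).
    rewrite [leRHS](bigID (fun k => n%:R * s k <= u))/= -[leLHS]addr0; apply: lerD.
      by apply: ler_sum => k _; exact: Eatom.
    by apply: sumr_ge0 => k _; exact: ltW.
  by rewrite sumr_const card_ord -[leLHS]mulr_natr.
move: D; rewrite ler_distl /gcdf => /andP[D1 D2].
by apply/andP; split; lra.
Qed.
End close_states.

Section realization_of_dominated.
Context {R : realType} d {T : measurableType d} (P : probability T R).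
Hypothesis P_atomless : atomless P.
Variable n : nat.
Hypothesis n3 : (3 <= n)%N.
Variable G : probability (measurableTypeR R) R.

Let n0 : 0 < n%:R :> R. Proof. by rewrite ltr0n (leq_trans _ n3). Qed.

Let half_measurable (u : R) : measurable (`]-oo, u]%classic : set (measurableTypeR R)).
Proof. exact: measurable_itv. Qed.

Lemma gcdf_homo u v : u <= v -> gcdf G u <= gcdf G v.
Proof.
move=> uv; apply: pr_le => // x; rewrite /= !in_itv/= => xu; exact: le_trans uv.
Qed.

Lemma gcdf_right_continuous u e : 0 < e -> exists2 e', 0 < e' & gcdf G (u + e') <= gcdf G u + e.
Proof.
move=> e0; apply: contrapT => h.
have gt v : `]v, +oo[%classic = ~` `]-oo, v]%classic :> set R by rewrite setCitvl.
have prgt v : pr G `]v, +oo[%classic = 1 - gcdf G v.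
  by rewrite gt -setTD prD ?pr_setT.
suff : pr G `]u, +oo[%classic <= 1 - gcdf G u - e by rewrite prgt; lra.
have -> : `]u, +oo[%classic = \bigcup_k `](u + k.+1%:R^-1), +oo[%classic :> set R.
  apply/seteqP; split => x /=; rewrite in_itv/= andbT.
    move=> ux; exists (Num.truncn (x - u)^-1) => //=.
    rewrite in_itv/= andbT -ltrBrDl invf_plt ?posrE ?ltr0n ?subr_gt0//.
    exact: truncnS_gt.
  by move=> [k _]; rewrite /= in_itv/= andbT; apply: le_lt_trans; rewrite lerDl invr_ge0.
apply: pr_bigcup_le => [k|i j ij x|k].
- exact: measurable_itv.
- rewrite /= !in_itv/= !andbT; apply: le_lt_trans.
  by rewrite lerD2l lef_pV2 ?posrE ?ltr0n// ler_nat.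
rewrite prgt leNgt; apply/negP => hk; apply: h; exists k.+1%:R^-1; first by rewrite invr_gt0 ltr0n.
by move: hk; set q := k.+1%:R^-1; lra.
Qed.

Hypothesis Gput : forall y, 0 <= y <= n%:R ->
  (\int[G]_x (pos (y - x))%:E <= (y ^+ 2 / (2 * n%:R))%:E)%E.
Hypothesis Gcall0 : (\int[G]_x (pos x)%:E <= (n%:R / 2)%:E)%E.
Hypothesis Gcalln : (\int[G]_x (pos (x - n%:R))%:E <= 0)%E.

(** States with errors tending to zero are fed to [realize_limit]: singleton index sets give the
    uniform marginals, the full index set gives the law [G] of the sum. *)
Lemma uniform_sums_of_dominated : uniform_sums P n G.
Proof.
pose close (e : R) E := [/\ is_state (@cube R n) E,
  forall i t, unif_cdf (t - e) - e <= E (fun x => (x i <= t)%R%:R) <= unif_cdf (t + e) + e &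
  forall t, gcdf G (t - e) - e <= E (fun x => (\sum_i x i <= t)%R%:R) <= gcdf G (t + e) + e].
have ex m : exists E, close m.+1%:R^-1 E.
  by apply: (close_state n3 Gput Gcall0 Gcalln); rewrite invr_gt0 ltr0n.
have [E HE] := choice ex.
have sE m : is_state (@cube R n) (E m) by have [] := HE m.
have [X [mX X01 XF]] := realize_limit P_atomless sE.
have squeeze (F : R -> R) (Em : nat -> R) (u e : R) : (forall s t, s <= t -> F s <= F t) -> 0 < e ->
    (forall m, F (u - m.+1%:R^-1) - m.+1%:R^-1 <= Em m <= F (u + m.+1%:R^-1) + m.+1%:R^-1) ->
    \forall m \near \oo, F (u - e) - e <= Em m <= F (u + e) + e.
  move=> Fnd e0 h; near=> m.
  have me : m.+1%:R^-1 <= e.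
    by apply: ltW; near: m; exact: (near_infty_natSinv_lt (PosNum e0)).
  have /andP[h1 h2] := h m.
  have k1 : F (u - e) <= F (u - m.+1%:R^-1) by apply: Fnd; rewrite lerD2l lerN2.
  have k2 : F (u + m.+1%:R^-1) <= F (u + e) by apply: Fnd; rewrite lerD2l.
  move: (m.+1%:R^-1) me h1 h2 k1 k2 => q *; apply/andP; split; lra.
pose Y i : {RV P >-> R} := mfun_Sub (mem_set (mX i)).
exists Y; split.
  move=> i A mA.
  have mX' : @measurable_fun _ _ T (measurableTypeR R) setT (X i) := mX i.
  pose Y' : {mfun T >-> measurableTypeR R} := @mfun_Sub _ _ T (measurableTypeR R) (X i) (mem_set mX').
  pose D : probability (measurableTypeR R) R := distribution P Y'.
  pose U : probability (measurableTypeR R) R := uniform_prob (@ltr01 R).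
  suff h : forall t, D `]-oo, t]%classic = U `]-oo, t]%classic by exact: (@probability_eq_cdf R D U h A mA).
  move=> u; apply: etrans (esym (uniform_cdf (@ltr01 R) u)).
  rewrite !subr0 divr1.
  apply: (@etrans _ _ (P [set w | X i w <= u])).
    by congr (P _); apply/seteqP; split => w /=; rewrite in_itv.
  have mXu : measurable [set w | X i w <= u].
    rewrite (_ : [set w | _] = X i @^-1` `]-oo, u]).
      by rewrite -[Z in measurable Z]setTI; exact: (mX i).
    by apply/seteqP; split => w /=; rewrite in_itv.
  rewrite prE//; congr EFin.
  have -> : [set w | X i w <= u] = [set w | \sum_(j | pred1 i j) X j w <= u].
    by apply/seteqP; split => w /=; rewrite big_pred1_eq.
  apply: (XF (pred1 i) unif_cdf unif_cdf_homo).
    by move=> t e e0; exists e => //; exact: unif_cdf_lip (ltW e0).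
  move=> t e e0; apply: squeeze => // [|m]; first exact: unif_cdf_homo.
  have [_ h _] := HE m.
  have -> : (fun x : 'I_n -> R => (\sum_(j | pred1 i j) x j <= t)%R%:R : R) = (fun x => (x i <= t)%R%:R).
    by apply/funext => x; rewrite big_pred1_eq.
  exact: h.
move=> u.
have mXu : measurable [set w | \sum_i X i w <= u].
  rewrite (_ : [set w | _] = (fun w => \sum_i X i w) @^-1` `]-oo, u]).
    rewrite -[Z in measurable Z]setTI; apply: measurable_sum => //.
  by apply/seteqP; split => w /=; rewrite in_itv.
rewrite /cdf; have -> : distribution P (\sum_(i < n) Y i) `]-oo, u]%classic = P [set w | \sum_i X i w <= u].
  by congr (P _); apply/seteqP; split => w /=; rewrite in_itv/= mfun_sum.
rewrite prE// [RHS]prE//; congr EFin.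
apply: (XF xpredT (gcdf G)).
- exact: gcdf_homo.
- exact: gcdf_right_continuous.
move=> t e e0; apply: squeeze => // [|m]; first exact: gcdf_homo.
by have [_ _ h] := HE m; exact: h.
Unshelve. all: by end_near.
Qed.
End realization_of_dominated.

Section dominated_of_convex_le.
Context {R : realType}.

Lemma integral_exists_ge0 (F : probability (measurableTypeR R) R) (f : R -> R) :
  (forall x, 0 <= f x) -> integral_exists F f.
Proof.
move=> f0; right; rewrite (eq_integral (cst 0%E)) ?integral0 ?ltry// => x _.
by rewrite (@ge0_funenegE _ _ setT) ?inE// => y _; rewrite lee_fin.
Qed.

Lemma uniform_sums_of_convex_le d (T : measurableType d) (P : probability T R)
    (n : nat) (n0 : (0 < n)%N) (G : probability (measurableTypeR R) R) :
  atomless P -> (3 <= n)%N -> convex_le G (uniform_prob (Defs.natr_gt0 R n0)) ->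
  uniform_sums P n G.
Proof.
move=> Pa n3 GU; have n0' := Defs.natr_gt0 R n0.
have call (y : R) : 0 <= y <= n%:R ->
    (\int[G]_x (pos (x - y))%:E <= ((n%:R - y) ^+ 2 / (2 * n%:R))%:E)%E.
  move=> yn; rewrite -(uniform_call (Defs.natr_gt0 R n0) yn).
  apply: GU; first exact: convex_pos_shift.
    by apply: integral_exists_ge0 => x; exact: pos_ge0.
  by apply: integral_exists_ge0 => x; exact: pos_ge0.
apply: uniform_sums_of_dominated => //.
- move=> y yn; rewrite -(uniform_put (Defs.natr_gt0 R n0) yn).
  apply: GU; first exact: convex_pos_shiftN.
    by apply: integral_exists_ge0 => x; exact: pos_ge0.
  by apply: integral_exists_ge0 => x; exact: pos_ge0.
- have := call 0; under eq_integral do rewrite subr0.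
  have -> : (n%:R - 0) ^+ 2 / (2 * n%:R) = n%:R / 2 :> R by field; rewrite gt_eqF.
  by apply; rewrite lexx ltW.
- have := call n%:R; rewrite subrr expr0n/= mul0r; apply.
  by rewrite lexx ltW.
Qed.
End dominated_of_convex_le.

                                                

(** * Necessity, by Jensen's inequality *)

Section law_of_variable.
Context {R : realType} d {T : measurableType d} (P : probability T R).

Lemma probability_ae_eq (f g : T -> R) (B : set R) :
  measurable_fun setT f -> measurable_fun setT g -> measurable B ->
  {ae P, forall w, f w = g w} -> P (f @^-1` B) = P (g @^-1` B).
Proof.
have H f' g' : measurable_fun setT f' -> measurable_fun setT g' -> measurable B ->
    {ae P, forall w, f' w = g' w} -> (P (f' @^-1` B) <= P (g' @^-1` B))%E.
  move=> mf mg mB [N [mN N0 sub]].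
  have mfB : measurable (f' @^-1` B) by rewrite -[X in measurable X]setTI; exact: mf.
  have mgB : measurable (g' @^-1` B) by rewrite -[X in measurable X]setTI; exact: mg.
  apply: (@le_trans _ _ (P (g' @^-1` B `|` N))).
    apply: le_measure; rewrite ?inE//; first exact: measurableU.
    move=> w /= fB; have [fg|fg] := pselect (f' w = g' w); first by left; rewrite /= -fg.
    by right; apply: sub.
  by rewrite measureU0.
move=> mf mg mB fg; apply: le_anti; rewrite !H//.
by apply: filterS fg => w ->.
Qed.

Lemma integral_law (F : probability (measurableTypeR R) R) (Y : T -> R) (f : R -> R) :
  measurable_fun setT Y ->
  (forall t, P [set w | Y w <= t] = F `]-oo, t]%classic) ->
  measurable_fun setT f -> P.-integrable setT (fun w => (f (Y w))%:E) ->
  F.-integrable setT (fun x => (f x)%:E) /\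
  (\int[F]_x (f x)%:E = \int[P]_w (f (Y w))%:E)%E.
Proof.
move=> mY YF mf fY.
have mY' : @measurable_fun _ _ T (measurableTypeR R) setT Y := mY.
pose Y' : {mfun T >-> measurableTypeR R} := @mfun_Sub _ _ T (measurableTypeR R) Y (mem_set mY').
pose D : probability (measurableTypeR R) R := distribution P Y'.
have DF : forall A, measurable A -> D A = F A.
  apply: probability_eq_cdf => t; rewrite -YF.
  by congr (P _); apply/seteqP; split => w /=; rewrite in_itv.
have mEf : measurable_fun [set: measurableTypeR R] (fun x => (f x)%:E) by exact/measurable_EFinP.
have E : (\int[F]_x (f x)%:E = \int[P]_w (f (Y w))%:E)%E.
  rewrite -(@integral_distribution _ _ _ _ R P Y' (fun x => (f x)%:E))//.
  by apply: eq_measure_integral => A mA _; exact: (esym (DF A mA)).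
split=> //.
have DI : D.-integrable setT (fun x => (f x)%:E).
  exact: integrable_pushforward.
move/integrableP : DI => [_ DI]; apply/integrableP; split => //.
apply: le_lt_trans DI; rewrite le_eqVlt; apply/orP; left; apply/eqP.
by apply: eq_measure_integral => A mA _; exact: (esym (DF A mA)).
Qed.

End law_of_variable.

Section convex_functions.
Context {R : realType} (phi : R -> R) (cphi : convex_function [set: R^o] phi).

Lemma convex_le_max (s u t : R) : s <= u <= t -> phi u <= Num.max (phi s) (phi t).
Proof.
move=> /andP[su ut]; have [st|st] := eqVneq s t.
  have -> : u = s by apply: le_anti; rewrite su st ut.
  by rewrite le_max lexx.
have ts : 0 < t - s by rewrite subr_gt0 lt_neqAle st (le_trans su).
pose l := (t - u) / (t - s).
have l0 : 0 <= l by apply: divr_ge0; rewrite ?subr_ge0 ?(le_trans su).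
have l1 : 0 <= 1 - l by rewrite subr_ge0 ler_pdivrMr// mul1r lerD2l lerN2.
have ul : u = l * s + (1 - l) * t by rewrite /l; field; rewrite gt_eqF.
rewrite [X in phi X]ul.
have l01 : 0 <= l <= 1 by rewrite l0 -subr_ge0.
apply: le_trans ((convex_functionP phi).1 cphi l s t l01) _.
have m1 : phi s <= Num.max (phi s) (phi t) by rewrite le_max lexx.
have m2 : phi t <= Num.max (phi s) (phi t) by rewrite le_max lexx orbT.
by have := ler_wpM2l l0 m1; have := ler_wpM2l l1 m2; lra.
Qed.

(** Strict sublevel sets of a convex function are intervals. *)
Lemma convex_measurable : measurable_fun setT phi.
Proof.
apply: (measurability (@RGenInftyO.G R)) => [|/= _ [_] [r] -> <-].
  exact: RGenInftyO.measurableE.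
rewrite setTI; apply: is_interval_measurable => s t/=.
rewrite !in_itv/= => fs ft u sut.
by rewrite in_itv/= (le_lt_trans (convex_le_max sut))// gt_max fs.
Qed.

(** The end values bound [phi] from above; convexity at the midpoint of [x] and its reflection
    [a - x] then bounds it from below. *)
Lemma convex_bounded (a : R) : exists M, forall x, 0 <= x <= a -> `|phi x| <= M.
Proof.
pose m := Num.max (phi 0) (phi a).
exists (`|m| + 2 * `|phi (a / 2)|) => x /andP[x0 xa].
have h1 : phi x <= m by apply: convex_le_max; rewrite x0.
have h2 : phi (a - x) <= m by apply: convex_le_max; apply/andP; split; lra.
have half01 : 0 <= (2^-1 : R) <= 1 by apply/andP; split; lra.
have := (convex_functionP phi).1 cphi 2^-1 x (a - x) half01.
have -> : 2^-1 * x + (1 - 2^-1) * (a - x) = a / 2 by field.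
move=> h3; have := ler_norm m; have := ler_norm (- phi (a / 2)); have := normr_ge0 (phi (a/2)).
rewrite normrN ler_norml => *; apply/andP; split; lra.
Qed.

Lemma convex_mean (m : nat) (z : 'I_m -> R) : (0 < m)%N ->
  phi ((\sum_i z i) / m%:R) <= (\sum_i phi (z i)) / m%:R.
Proof.
case: m z => // k z _; elim: k z => [|k IH] z; first by rewrite !big_ord_recl !big_ord0 !addr0 !divr1.
rewrite !(big_ord_recr k.+1)/=.
pose l : R := k.+1%:R / k.+2%:R.
have K0 : 0 < k.+2%:R :> R by rewrite ltr0n.
have K1 : 0 < k.+1%:R :> R by rewrite ltr0n.
have K2 : k.+2%:R = k.+1%:R + 1 :> R by rewrite natr1.
have l0 : 0 <= l by rewrite divr_ge0.
have l1 : l <= 1 by rewrite ler_pdivrMr// mul1r ler_nat.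
set A := \sum_i _; set B := \sum_i _.
have -> : (A + z ord_max) / k.+2%:R = l * (A / k.+1%:R) + (1 - l) * z ord_max.
  by rewrite /l K2; field; rewrite !gt_eqF//= -K2.
have l01 : 0 <= l <= 1 by rewrite l0.
apply: le_trans ((convex_functionP phi).1 cphi _ _ _ l01) _.
have := ler_wpM2l l0 (IH (fun i => z (widen_ord (leqnSn k.+1) i))).
rewrite -/A -/B.
have -> : (B + phi (z ord_max)) / k.+2%:R = l * (B / k.+1%:R) + (1 - l) * phi (z ord_max).
  by rewrite /l K2; field; rewrite !gt_eqF//= -K2.
by rewrite lerD2r.
Qed.

End convex_functions.

Section convex_le_of_sums.
Context {R : realType} d {T : measurableType d} (P : probability T R).

Lemma uniform_ae01 (X : T -> R) : measurable_fun setT X ->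
  (forall A, measurable A -> P (X @^-1` A) = uniform_prob (@ltr01 R) A) ->
  {ae P, forall w, 0 <= X w <= 1}.
Proof.
move=> mX hX.
have mp A : measurable A -> measurable (X @^-1` A).
  by move=> mA; rewrite -[X in measurable X]setTI; exact: mX.
exists (X @^-1` `]-oo, 0] `|` X @^-1` `]1, +oo[); split.
- by apply: measurableU; apply: mp; exact: measurable_itv.
- apply: null_set_setU; try by apply: mp; exact: measurable_itv.
    apply: etrans (hX _ (measurable_itv _)) _; apply: etrans (uniform_cdf _ _) _.
    by rewrite subrr mul0r /unif_cdf min_r// maxxx.
  apply: etrans (hX _ (measurable_itv _)) _.
  have -> : `]1, +oo[%classic = ~` `]-oo, 1]%classic :> set R by rewrite setCitvl.
  apply: etrans (@probability_setC _ _ R (uniform_prob (@ltr01 R)) `]-oo, 1]%classic (measurable_itv _)) _.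
  have e : uniform_prob (@ltr01 R) `]-oo, 1]%classic = 1%E.
    by apply: etrans (uniform_cdf _ _) _; rewrite !subr0 divr1 /unif_cdf minxx max_r.
  by apply: etrans (congr1 (fun x => 1 - x)%E e) _; rewrite subee.
- move=> w /=; rewrite !in_itv/= andbT => h.
  have [|h0] := leP (X w) 0; first by left.
  by right; rewrite ltNge; apply/negP => h1; apply: h; rewrite (ltW h0).
Qed.

(** Clipping each [X i] to $[0,1]$ changes it only on a null set and keeps all arguments of [phi] in
    $[0,n]$, where [phi] is bounded; every integral is then finite, and Jensen's inequality for the
    average of the $nY_i$ can be integrated. *)
Lemma convex_le_of_uniform_sums (n : nat) (n0 : (0 < n)%N) (G : probability (measurableTypeR R) R) :
  uniform_sums P n G -> uniform_cx n0 G.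
Proof.
move=> [X [XU XG]].
have mX i : measurable_fun setT (X i) by [].
pose Y i w := Num.max 0 (Num.min 1 (X i w)).
have mY i : measurable_fun setT (Y i).
  by apply: measurable_maxr => //; apply: measurable_minr.
have Y01 i w : 0 <= Y i w <= 1 by rewrite /Y le_max lexx/= ge_max ler01 ge_min lexx.
have XY i : {ae P, forall w, X i w = Y i w}.
  apply: filterS (uniform_ae01 (mX i) (XU i)) => w /andP[h0 h1].
  by rewrite /Y min_r// max_r.
have mS : measurable_fun setT (fun w => \sum_i Y i w) by exact: measurable_sum.
have SXY : {ae P, forall w, \sum_i X i w = \sum_i Y i w}.
  have F : Filter (almost_everywhere P) by exact: ae_filter_ringOfSetsType.
  by apply: filterS (filter_forall F XY) => w h; apply: eq_bigr.
have half t : measurable (`]-oo, t]%classic : set R) by exact: measurable_itv.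
have lawS t : P [set w | \sum_i Y i w <= t] = G `]-oo, t]%classic.
  rewrite -XG /cdf.
  apply: (@etrans _ _ (P ((fun w => \sum_i Y i w) @^-1` `]-oo, t]))).
    by congr (P _); apply/seteqP; split => w /=; rewrite in_itv.
  rewrite -(@probability_ae_eq _ _ _ P (fun w => \sum_i X i w))//; last exact: measurable_sum.
  by congr (P _); apply/seteqP; split => w /=; rewrite mfun_sum.
have n0' : 0 < n%:R :> R by rewrite ltr0n.
have lawY i t : P [set w | n%:R * Y i w <= t] = uniform_prob (Defs.natr_gt0 R n0) `]-oo, t]%classic.
  apply: etrans (esym (uniform_cdf _ _)).
  apply: (@etrans _ _ (P (Y i @^-1` `]-oo, t / n%:R]))).
    by congr (P _); apply/seteqP; split => w /=; rewrite in_itv/= ler_pdivlMr// mulrC.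
  rewrite -(@probability_ae_eq _ _ _ P (X i))//.
  rewrite [LHS](XU i)// !subr0.
  by apply: etrans (uniform_cdf _ _) _; rewrite subr0 subr0 divr1.
have SY0n w : 0 <= \sum_i Y i w <= n%:R.
  rewrite sumr_ge0/=; last by move=> i _; case/andP: (Y01 i w).
  have -> : n%:R = \sum_(i < n) 1 :> R by rewrite sumr_const card_ord.
  by apply: ler_sum => i _; case/andP: (Y01 i w).
have nY0n i w : 0 <= n%:R * Y i w <= n%:R.
  by have /andP[h0 h1] := Y01 i w; rewrite mulr_ge0//= ler_piMr.
have intb (f : R -> R) (Z : T -> R) M : measurable_fun setT f -> measurable_fun setT Z ->
    (forall x, 0 <= x <= n%:R -> `|f x| <= M) -> (forall w, 0 <= Z w <= n%:R) ->
    P.-integrable setT (fun w => (f (Z w))%:E).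
  move=> mf mZ fM Z0n; apply: (@measurable_bounded_integrable _ _ _ _ (f \o Z)) => //.
  - by rewrite (le_lt_trans (probability_le1 _ _)) ?ltry.
  - exact: measurableT_comp.
  - exists M; split; first exact: num_real.
    by move=> N MN w _ /=; apply: le_trans (ltW MN); exact: fM.
split.
  have mid : measurable_fun setT (@id R) by exact: measurable_id.
  have id_le x : 0 <= x <= n%:R -> `|id x| <= n%:R :> R.
    by move=> /andP[x0 xn]; rewrite ger0_norm.
  exact: (integral_law mS lawS mid (intb id _ _ mid mS id_le SY0n)).1.
move=> phi cphi _ _.
have mphi := convex_measurable cphi.
have [M phiM] := convex_bounded cphi n%:R.
have iS := intb phi _ M mphi mS phiM SY0n.
have [_ ->] := integral_law mS lawS mphi iS.
have mnY i : measurable_fun setT (fun w => n%:R * Y i w) by exact: measurable_funM.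
have iY i := intb phi _ M mphi (mnY i) phiM (nY0n i).
have lY i := (integral_law (mnY i) (lawY i) mphi (iY i)).2.
have n0E : n%:R != 0 :> R by rewrite gt_eqF.
apply: (@le_trans _ _ (\int[P]_w (\sum_(i < n) ((n%:R^-1)%R%:E * (phi (n%:R * Y i w)%R)%:E))%E)%E).
  apply: le_integral => //.
    by apply: integrable_sum => // i _; apply: integrableZl.
  move=> w _ /=; under [leRHS]eq_bigr do rewrite -EFinM.
  rewrite sumEFin lee_fin -mulr_sumr.
  have -> : \sum_i Y i w = (\sum_i n%:R * Y i w) / n%:R by rewrite -mulr_sumr mulrAC mulfV// mul1r.
  rewrite [leRHS]mulrC.
  exact: (convex_mean cphi (fun i => n%:R * Y i w)).
have iE : (uniform_prob (Defs.natr_gt0 R n0)).-integrable setT (fun x => (phi x)%:E).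
  exact: (integral_law (mnY (Ordinal n0)) (lawY _) mphi (iY _)).1.
rewrite integral_sum//; last by move=> i; apply: integrableZl.
under eq_bigr => i _ do rewrite integralZl// -lY.
set I := (\int[_]_x _)%E.
have -> : I = (fine I)%:E by rewrite fineK//; exact: integrable_fin_num.
under eq_bigr do rewrite -EFinM.
by rewrite sumEFin lee_fin sumr_const card_ord -[leLHS]mulr_natl mulrA mulfV// mul1r.
Qed.
End convex_le_of_sums.

Theorem theorem4p2 (R : realType) (d : measure_display) (T : measurableType d)
    (P : probability T R) (P_atomless : atomless P)
    (n : nat) (n_ge3 : (3 <= n)%N) :
  uniform_sums P n = uniform_cx (leq_trans (isT : (0 < 3)%N) n_ge3).
Proof.
apply/seteqP; split => G; first exact: convex_le_of_uniform_sums.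
by move=> [_ GU]; exact: uniform_sums_of_convex_le GU.
Qed.
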